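(* Let $\overline{X}=(X_0,X_1)$ be an $L$-convex quasi-Banach lattice couple. Then every $L$-convex quasi-Banach lattice $X$ that is $K$-monotone with respect to $\overline{X}$ can be represented as $X=\overline{X}_{E:K}$ (with equivalent quasi-norms), where $E$ is some $L$-convex quasi-Banach function lattice on $(0,\infty)$ such that $E\in Int(\overline{L^\infty})$.
   Context: All spaces are real. A quasi-Banach lattice is a vector lattice with a complete quasi-norm such that $\|x\|\le\|y\|$ whenever $|x|\le|y|$. It is $L$-convex if there is $0<\varepsilon<1$ such that whenever $0\le x\in X$, $\|x\|_X=1$, $0\le x_i\le x$ ($i=1,\dots,n$) and $\frac1n\sum_{i=1}^n x_i\ge(1-\varepsilon)x$, then $\max_i\|x_i\|_X\ge\varepsilon$. A quasi-Banach lattice couple $\overline{X}=(X_0,X_1)$ is a pair of quasi-Banach lattices both embedded into some Hausdorff topological vector lattice by continuous, interval preserving, injective lattice homomorphisms; it is $L$-convex if both $X_0$, $X_1$ are. $\Delta(\overline X)=X_0\cap X_1$ with quasi-norm $\max(\|x\|_{X_0},\|x\|_{X_1})$; $\Sigma(\overline X)=X_0+X_1$ with quasi-norm $\inf\{\|x_0\|_{X_0}+\|x_1\|_{X_1}:x=x_0+x_1\}$. $K(t,x;\overline{X})=\inf\{\|x_0\|_{X_0}+t\|x_1\|_{X_1}:x=x_0+x_1,\ x_i\in X_i\}$. A quasi-Banach lattice $X$ is intermediate if $\Delta(\overline X)\subset X\subset\Sigma(\overline X)$, the inclusions being continuous interval preserving lattice homomorphisms. An intermediate lattice $X$ is $K$-monotone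 with respect to $\overline X$ if $x\in X$, $y\in\Sigma(\overline X)$ and $K(t,y;\overline X)\le K(t,x;\overline X)$ for all $t>0$ imply $y\in X$. $\overline{L^\infty}=(L^\infty,L^\infty(1/t))$ is the couple on $(0,\infty)$ (Lebesgue measure) with norms $\operatorname{ess\,sup}|f(t)|$ and $\operatorname{ess\,sup}|f(t)|/t$. $E\in Int(\overline{L^\infty})$ means that $E$ is intermediate for $\overline{L^\infty}$ and every linear operator on $\Sigma(\overline{L^\infty})$ bounded on both $L^\infty$ and $L^\infty(1/t)$ is bounded on $E$. $\overline{X}_{E:K}$ is the space of $x\in\Sigma(\overline X)$ with $\|x\|=\|K(\cdot,x;\overline X)\|_E<\infty$. *)

(* Defs.v *)
From HB Require Import structures.
From mathcomp Require Import all_boot all_order all_algebra.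
From mathcomp Require Import all_classical all_reals all_analysis.
From mathcomp Require Import measurable_realfun.

Set Implicit Arguments.
Unset Strict Implicit.
Unset Printing Implicit Defensive.

Import Order.TTheory GRing.Theory Num.Theory.
Import numFieldNormedType.Exports.

Local Open Scope classical_set_scope.
Local Open Scope ring_scope.

(* The binary supremum is a field of its own: HB rejects a join of             *)
(* Order.Lattice with GRing.Zmodule declared above Num.RealDomain. Infima are *)
(* obtained as - vjoin (- x) (- y).                                           *)
HB.mixin Record POrderedLmodule_isVectorLattice (R : realType) V
    & GRing.Lmodule R V & Num.POrderedZmodule V := {
  vjoin : V -> V -> V ;
  vjoin_leP : forall x y z : V, (vjoin x y <= z) = (x <= z) && (y <= z) ;
  vl_leD2r : forall z x y : V, x <= y -> x + z <= y + z ;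
  vl_scale_ge0 : forall (a : R) (x : V), 0 <= a -> 0 <= x -> 0 <= a *: x }.

#[short(type="vectorLatticeType")]
HB.structure Definition VectorLattice (R : realType) :=
  {V of GRing.Lmodule R V & Num.POrderedZmodule V
      & POrderedLmodule_isVectorLattice R V}.

Definition vabs (R : realType) (V : vectorLatticeType R) (x : V) : V :=
  vjoin x (- x).

Definition solid (R : realType) (V : vectorLatticeType R) (S : set V) :=
  forall x y, S y -> vabs x <= vabs y -> S x.

(* Topological vector lattices are taken in the usual locally solid sense;    *)
(* local convexity is not assumed, and separation is a separate hypothesis.   *)
HB.mixin Record TopLmodule_VectorLattice_isTopVectorLattice (R : realType) W
    & TopologicalLmodule R W & VectorLattice R W := {
  nbhs0_solid : forall U : set W, nbhs (0 : W) U ->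
    exists V : set W, [/\ nbhs (0 : W) V, solid V & V `<=` U] }.

#[short(type="topVectorLatticeType")]
HB.structure Definition TopVectorLattice (R : realType) :=
  {W of TopologicalLmodule R W & VectorLattice R W
      & TopLmodule_VectorLattice_isTopVectorLattice R W}.

(* The quasi-normed lattices below all live inside an ambient vector lattice  *)
(* W, from which they inherit the operations and the order: a lattice         *)
(* embedded in W by an injective lattice homomorphism is identified with its  *)
(* image. Only the values of qnorm on the carrier are relevant.               *)
Record qnspace (R : realType) (W : vectorLatticeType R) := QNSpace {
  carrier :> W -> Prop ;
  qnorm : W -> R }.

Section quasi_Banach_lattices.
Context {R : realType} {W : vectorLatticeType R}.
Implicit Types A B X : qnspace W.

Definition linear_sublattice A :=
  [/\ A 0, (forall (a : R) x y, A x -> A y -> A (a *: x + y))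
    & (forall x y, A x -> A y -> A (vjoin x y))].

Definition quasi_norm A :=
  [/\ (forall x, A x -> 0 <= qnorm A x),
      (forall x, A x -> qnorm A x = 0 -> x = 0),
      (forall (a : R) x, A x -> qnorm A (a *: x) = `|a| * qnorm A x)
    & exists C : R, forall x y, A x -> A y ->
        qnorm A (x + y) <= C * (qnorm A x + qnorm A y)].

Definition qn_complete A := forall u : nat -> W, (forall n, A (u n)) ->
  (forall e : R, 0 < e -> exists N : nat, forall m n : nat,
     (N <= m)%N -> (N <= n)%N -> qnorm A (u m - u n) < e) ->
  exists2 x, A x & (fun n => qnorm A (u n - x)) @ \oo --> (0 : R).

Definition quasi_Banach_lattice A :=
  [/\ linear_sublattice A, quasi_norm A, qn_complete A
    & forall x y, A x -> A y -> vabs x <= vabs y -> qnorm A x <= qnorm A y].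

Definition L_convex A := exists2 eps : R, 0 < eps < 1 &
  forall (n : nat) (x : W) (s : 'I_n.+1 -> W),
    A x -> 0 <= x -> qnorm A x = 1 ->
    (forall i, A (s i) /\ 0 <= s i <= x) ->
    (1 - eps) *: x <= n.+1%:R^-1 *: \sum_i s i ->
    exists i, eps <= qnorm A (s i).

(* The inclusion S -> S' maps order intervals [0, x] onto order intervals.    *)
Definition interval_preserving (S S' : W -> Prop) :=
  forall x y, S x -> S' y -> 0 <= y <= x -> S y.

(* For the linear inclusion A -> B of quasi-normed spaces, continuity is      *)
(* boundedness. Since A and B carry the order of W, the inclusion of          *)
(* sublattices is automatically a lattice homomorphism.                       *)
Definition lattice_inclusion A B :=
  [/\ (forall x, A x -> B x), interval_preserving A B
    & exists C : R, forall x, A x -> qnorm B x <= C * qnorm A x].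

Definition qn_equiv A B := (forall x, A x <-> B x) /\
  exists c C : R, [/\ 0 < c, 0 < C &
    forall x, A x -> c * qnorm B x <= qnorm A x <= C * qnorm B x].

Definition decomposition A B (x : W) : set (W * W) :=
  [set p | [/\ A p.1, B p.2 & x = p.1 + p.2]].

Definition Delta A B : qnspace W := QNSpace (fun x => A x /\ B x)
  (fun x => Num.max (qnorm A x) (qnorm B x)).

Definition Sigma A B : qnspace W := QNSpace
  (fun x => decomposition A B x !=set0)
  (fun x => inf [set qnorm A p.1 + qnorm B p.2 | p in decomposition A B x]).

Definition Kfun A B (t : R) (x : W) : R :=
  inf [set qnorm A p.1 + t * qnorm B p.2 | p in decomposition A B x].

Definition intermediate A B X :=
  [/\ quasi_Banach_lattice X, lattice_inclusion (Delta A B) X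
    & lattice_inclusion X (Sigma A B)].

Definition K_monotone A B X := intermediate A B X /\
  forall x y, X x -> Sigma A B y ->
    (forall t : R, 0 < t -> Kfun A B t y <= Kfun A B t x) -> X y.

Definition bounded_on (T : W -> W) A := exists C : R, forall x, A x ->
  A (T x) /\ qnorm A (T x) <= C * qnorm A x.

(* The values of T outside of A are irrelevant.                               *)
Definition linear_operator_on (T : W -> W) A :=
  (forall x, A x -> A (T x)) /\
  forall (a : R) x y, A x -> A y -> T (a *: x + y) = a *: T x + T y.

Definition Int A B X := intermediate A B X /\
  forall T : W -> W, linear_operator_on T (Sigma A B) ->
    bounded_on T A -> bounded_on T B -> bounded_on T X.

End quasi_Banach_lattices.

Section couples.
Context {R : realType} {W : topVectorLatticeType R}.

Definition continuously_embedded (A : qnspace W) :=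
  interval_preserving A setT /\
  forall U : set W, nbhs (0 : W) U ->
    exists2 d : R, 0 < d & forall x, A x -> qnorm A x < d -> U x.

Definition qb_lattice_couple (X0 X1 : qnspace W) :=
  [/\ hausdorff_space W,
      quasi_Banach_lattice X0 /\ continuously_embedded X0
    & quasi_Banach_lattice X1 /\ continuously_embedded X1].

End couples.

Section L0.
Context d (T : measurableType d) (R : realType).
Variable mu : {measure set T -> \bar R}.

(* Classes of measurable functions modulo equality almost everywhere.         *)
Definition L0 : Type := {mfun_ mu, T >-> R}.

HB.instance Definition _ := Choice.on L0.

Definition L0_repr (f : L0) : {mfun T >-> R} := repr f.
Definition L0_fun (f : L0) : T -> R := L0_repr f.
Coercion L0_fun : L0 >-> Funclass.

Definition L0_class (f : {mfun T >-> R}) : L0 := (\pi f)%qT.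

Lemma L0_classE f : {ae mu, forall t, L0_class f t = f t}.
Proof.
have /eqP : (repr (\pi f : L0) = f %[mod L0])%qT by rewrite reprK.
rewrite eqmodE => /asboolP; apply: filterS => t; exact.
Qed.

Lemma L0P (f g : L0) : {ae mu, forall t, f t = g t} -> f = g.
Proof.
move=> fg; rewrite -[f]reprK -[g]reprK; apply/eqP; rewrite eqmodE.
by apply/asboolP; apply: filterS fg => t fgt _.
Qed.

Let addL f g := L0_class (L0_repr f + L0_repr g).
Let oppL f := L0_class (- L0_repr f).
Let zeroL := L0_class 0.
Let scaleL (a : R) f := L0_class (a *: L0_repr f).
Let joinL f g := L0_class (max_mfun (L0_repr f) (L0_repr g)).
Let leL (f g : L0) := `[< {ae mu, forall t, f t <= g t} >].

Let addE f g : {ae mu, forall t, addL f g t = f t + g t}.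
Proof. exact: L0_classE. Qed.
Let oppE f : {ae mu, forall t, oppL f t = - f t}.
Proof. exact: L0_classE. Qed.
Let zeroE : {ae mu, forall t, zeroL t = 0}.
Proof. exact: L0_classE. Qed.
Let scaleE a f : {ae mu, forall t, scaleL a f t = a * f t}.
Proof. exact: L0_classE. Qed.
Let joinE f g : {ae mu, forall t, joinL f g t = Num.max (f t) (g t)}.
Proof. exact: L0_classE. Qed.

Let addA : associative addL.
Proof.
move=> f g h; apply: L0P; near=> t.
have -> : addL f (addL g h) t = f t + addL g h t by near: t; exact: addE.
have -> : addL g h t = g t + h t by near: t; exact: addE.
have -> : addL (addL f g) h t = addL f g t + h t by near: t; exact: addE.
have -> : addL f g t = f t + g t by near: t; exact: addE.
exact: addrA.
Unshelve. all: by end_near. Qed.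

Let addC : commutative addL.
Proof. by move=> f g; rewrite /addL addrC. Qed.

Let add0 : left_id zeroL addL.
Proof.
move=> f; apply: L0P; near=> t.
have -> : addL zeroL f t = zeroL t + f t by near: t; exact: addE.
have -> : zeroL t = 0 by near: t; exact: zeroE.
exact: add0r.
Unshelve. all: by end_near. Qed.

Let addN : left_inverse zeroL oppL addL.
Proof.
move=> f; apply: L0P; near=> t.
have -> : addL (oppL f) f t = oppL f t + f t by near: t; exact: addE.
have -> : oppL f t = - f t by near: t; exact: oppE.
have -> : zeroL t = 0 by near: t; exact: zeroE.
exact: addNr.
Unshelve. all: by end_near. Qed.

HB.instance Definition _ := GRing.isZmodule.Build L0 addA addC add0 addN.

Lemma L0_addE (f g : L0) : {ae mu, forall t, (f + g : L0) t = f t + g t}.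
Proof. exact: addE. Qed.
Lemma L0_oppE (f : L0) : {ae mu, forall t, (- f : L0) t = - f t}.
Proof. exact: oppE. Qed.
Lemma L0_0E : {ae mu, forall t, (0 : L0) t = 0}.
Proof. exact: zeroE. Qed.

Let scaleA a b f : scaleL a (scaleL b f) = scaleL (a * b) f.
Proof.
apply: L0P; near=> t.
have -> : scaleL a (scaleL b f) t = a * scaleL b f t by near: t; exact: scaleE.
have -> : scaleL b f t = b * f t by near: t; exact: scaleE.
have -> : scaleL (a * b) f t = a * b * f t by near: t; exact: scaleE.
exact: mulrA.
Unshelve. all: by end_near. Qed.

Let scale1 : left_id 1 scaleL.
Proof.
by move=> f; apply: L0P; apply: filterS (scaleE 1 f) => t ->; rewrite mul1r.
Qed.

Let scaleDr : right_distributive scaleL +%R.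
Proof.
move=> a f g; apply: L0P; near=> t.
have -> : scaleL a (f + g : L0) t = a * (f + g : L0) t by near: t; exact: scaleE.
have -> : (f + g : L0) t = f t + g t by near: t; exact: L0_addE.
have -> : (scaleL a f + scaleL a g : L0) t = scaleL a f t + scaleL a g t.
  by near: t; exact: L0_addE.
have -> : scaleL a f t = a * f t by near: t; exact: scaleE.
have -> : scaleL a g t = a * g t by near: t; exact: scaleE.
exact: mulrDr.
Unshelve. all: by end_near. Qed.

Let scaleDl f : {morph scaleL^~ f : a b / a + b}.
Proof.
move=> a b; apply: L0P; near=> t.
have -> : scaleL (a + b) f t = (a + b) * f t by near: t; exact: scaleE.
have -> : (scaleL a f + scaleL b f : L0) t = scaleL a f t + scaleL b f t.
  by near: t; exact: L0_addE.
have -> : scaleL a f t = a * f t by near: t; exact: scaleE.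
have -> : scaleL b f t = b * f t by near: t; exact: scaleE.
exact: mulrDl.
Unshelve. all: by end_near. Qed.

HB.instance Definition _ :=
  GRing.Zmodule_isLmodule.Build R L0 scaleA scale1 scaleDr scaleDl.

Lemma L0_scaleE (a : R) (f : L0) : {ae mu, forall t, (a *: f : L0) t = a * f t}.
Proof. exact: scaleE. Qed.

Let leLP (f g : L0) : reflect {ae mu, forall t, f t <= g t} (leL f g).
Proof. exact: asboolP. Qed.

Let le_refl : reflexive leL.
Proof. by move=> f; apply/leLP/nearW. Qed.

Let le_anti : antisymmetric leL.
Proof.
move=> f g /andP[/leLP fg /leLP gf]; apply: L0P.
by apply: filterS2 fg gf => t fg gf; apply/eqP; rewrite eq_le fg gf.
Qed.

Let le_trans : transitive leL.
Proof.
move=> g f h /leLP fg /leLP gh; apply/leLP.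
by apply: filterS2 fg gh => t; exact: Order.POrderTheory.le_trans.
Qed.

HB.instance Definition _ :=
  Order.Le_isPOrder.Build ring_display L0 le_refl le_anti le_trans.

Lemma L0_leP (f g : L0) : reflect {ae mu, forall t, f t <= g t} (f <= g).
Proof. exact: asboolP. Qed.

Let joinP (f g h : L0) : (joinL f g <= h) = (f <= h) && (g <= h).
Proof.
apply/L0_leP/andP => [H|[/L0_leP fh /L0_leP gh]].
  by split; apply/L0_leP; apply: filterS2 H (joinE f g) => t + E;
    rewrite E ge_max => /andP[].
near=> t; have -> : joinL f g t = Num.max (f t) (g t) by near: t; exact: joinE.
by rewrite ge_max; apply/andP; split; near: t.
Unshelve. all: by end_near. Qed.

Let leD2r (h f g : L0) : f <= g -> f + h <= g + h.
Proof.
move=> /L0_leP fg; apply/L0_leP; near=> t.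
have -> : (f + h : L0) t = f t + h t by near: t; exact: L0_addE.
have -> : (g + h : L0) t = g t + h t by near: t; exact: L0_addE.
by rewrite lerD2r; near: t.
Unshelve. all: by end_near. Qed.

Let scale_ge0 (a : R) (f : L0) : 0 <= a -> 0 <= f -> 0 <= a *: f.
Proof.
move=> a0 /L0_leP f0; apply/L0_leP; near=> t.
have t0 : (0 : L0) t = 0 by near: t; exact: L0_0E.
have -> : (a *: f : L0) t = a * f t by near: t; exact: L0_scaleE.
by rewrite t0 mulr_ge0// -t0; near: t.
Unshelve. all: by end_near. Qed.

HB.instance Definition _ :=
  POrderedLmodule_isVectorLattice.Build R L0 joinP leD2r scale_ge0.

Lemma L0_joinE (f g : L0) :
  {ae mu, forall t, (vjoin f g : L0) t = Num.max (f t) (g t)}.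
Proof. exact: joinE. Qed.

(* The class of g, if g is a.e. equal to a measurable function (0 otherwise). *)
Definition L0_of (g : T -> R) : L0 :=
  xget 0 [set f : L0 | {ae mu, forall t, f t = g t}].

Lemma L0_ofE (h : {mfun T >-> R}) (g : T -> R) :
  {ae mu, forall t, h t = g t} -> {ae mu, forall t, L0_of g t = g t}.
Proof.
move=> hg; rewrite /L0_of; case: xgetP => [f -> //|/(_ (L0_class h))]; case.
by apply: filterS2 (L0_classE h) hg => t ->.
Qed.

End L0.

(* Lebesgue measure on (0, +oo), as a measure on the real line.               *)
Definition half_line_measure (R : realType) :
    {measure set (measurableTypeR R) -> \bar R} :=
  mrestr (@lebesgue_measure R) (measurable_itv `]0, +oo[).

Notation L0_half_line R := (L0 (half_line_measure R)).

Section half_line.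
Context (R : realType).

Lemma half_line_ae (P : R -> Prop) :
  (forall t, 0 < t -> P t) -> {ae half_line_measure R, forall t, P t}.
Proof.
move=> P0; exists [set` `]-oo, 0%R]].
split => [||t /= Pt]; first exact: measurable_itv.
  rewrite /= /mrestr (_ : _ `&` _ = set0) ?measure0//.
  rewrite -subset0 => t/=; rewrite !in_itv/= andbT => -[t0 /lt_le_trans].
  by move=> /(_ _ t0); rewrite ltxx.
rewrite in_itv/= leNgt; apply/negP => t0; exact: Pt (P0 t t0).
Qed.

Definition Linfty : qnspace (L0_half_line R) :=
  let N (f : L0_half_line R) :=
    Lnorm (half_line_measure R) +oo%E (fun t => (f t)%:E) in
  QNSpace (fun f => (N f < +oo)%E) (fun f => fine (N f)).

Definition Linfty_weighted : qnspace (L0_half_line R) :=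
  let N (f : L0_half_line R) :=
    Lnorm (half_line_measure R) +oo%E (fun t => (f t / t)%:E) in
  QNSpace (fun f => (N f < +oo)%E) (fun f => fine (N f)).

Definition qb_function_lattice (E : qnspace (L0_half_line R)) :=
  quasi_Banach_lattice E /\ solid E.

Definition K_space (W : vectorLatticeType R) (X0 X1 : qnspace W)
    (E : qnspace (L0_half_line R)) : qnspace W :=
  let K x : L0_half_line R := L0_of (half_line_measure R) (Kfun X0 X1 ^~ x) in
  QNSpace (fun x => Sigma X0 X1 x /\ E (K x)) (fun x => qnorm E (K x)).

(* The default value in L0_of plays no role in K_space.                       *)
Lemma K_spaceE (W : vectorLatticeType R) (X0 X1 : qnspace W) (x : W) :
  quasi_norm X0 -> quasi_norm X1 -> Sigma X0 X1 x ->
  {ae half_line_measure R,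
    forall t, L0_of (half_line_measure R) (Kfun X0 X1 ^~ x) t = Kfun X0 X1 t x}.
Proof.
move=> [N0 _ _ _] [N1 _ _ _] Sx.
pose K (t : R) := Kfun X0 X1 t x.
pose h (t : R) : R := if 0 < t then K t else 0.
have lbK t : 0 < t -> lbound
    [set qnorm X0 p.1 + t * qnorm X1 p.2 | p in decomposition X0 X1 x] 0.
  move=> t0 _ [p [p0 p1 _] <-].
  by rewrite addr_ge0 ?N0// mulr_ge0 ?N1// ltW.
have neK t :
    [set qnorm X0 p.1 + t * qnorm X1 p.2 | p in decomposition X0 X1 x] !=set0.
  by case: Sx => p xp; exists (qnorm X0 p.1 + t * qnorm X1 p.2), p.
have K_ge0 t : 0 < t -> 0 <= K t.
  by move=> t0; apply: lb_le_inf => //; exact: lbK.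
have h_nd : nondecreasing_fun h.
  move=> s t st; rewrite /h; case: ifPn => s0; last first.
    by case: ifPn => // /K_ge0.
  rewrite (lt_le_trans s0 st); apply: lb_le_inf => // _ [p xp <-].
  apply: (@Order.POrderTheory.le_trans _ _ (qnorm X0 p.1 + s * qnorm X1 p.2)).
    by apply: ge_inf; [exists 0; exact: lbK|exists p].
  by case: xp => _ p1 _; rewrite lerD2l ler_wpM2r// N1.
have mh : measurable_fun [set: measurableTypeR R] h by exact: nondecreasing_measurable.
pose H : {mfun measurableTypeR R >-> R} :=
  @mfun_Sub _ _ (measurableTypeR R) _ h (mem_set mh).
by apply: (@L0_ofE _ _ _ _ H); apply: half_line_ae => t t0; rewrite /= /h t0.
Qed.

End half_line.

(* Main.v *)
Require Import Defs.
From mathcomp Require Import all_boot all_order all_algebra.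
From mathcomp Require Import all_classical all_reals all_analysis.
From mathcomp Require Import ring lra.
From mathcomp Require Import measurable_realfun ess_sup_inf.

Set Implicit Arguments.
Unset Strict Implicit.
Unset Printing Implicit Defensive.

Import Order.TTheory GRing.Theory Num.Theory.
Import numFieldNormedType.Exports.

Local Open Scope classical_set_scope.
Local Open Scope ring_scope.

(** The parameter E is taken as large as possible. For a function f on the
    half-line let f^^ be its least concave majorant, the infimum of the affine
    functions a + b t (with a, b >= 0) that dominate |f| almost everywhere; up
    to constants f^^ is the K-functional of f for the couple of weighted L^oo
    spaces. Put f in E when every y >= 0 in X0 + X1 with K(t, y) <= f^^(t) for
    all t belongs to X, with a bound M on the norms of these y; the norm of f is
    the least M that works and dominates f^^(1).

    With this choice most of the theorem is formal. An operator bounded on both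
    endpoint spaces multiplies affine majorants by a constant, so it is bounded
    on E. If K(., x) belongs to E then x, being dominated by itself, belongs to
    X. Conversely, if x is in X then K-monotonicity puts in X all y dominated
    by K(., x); a gliding hump turns this into a norm estimate
    ([K_monotone_bounded]).

    What remains (the quasi-triangle inequality, completeness and L-convexity
    of E) rests on one statement, [K_divisibility]. Let K(t, y) <= phi(t) and
    let psi_i be finitely many quasiconcave functions such that at each t at
    least m of them dominate phi(t). Then y has parts 0 <= z_i <= y with
    K(t, z_i) <= B psi_i(t) and m y <= sum_i z_i, where B depends only on the
    quasi-triangle constants and not on the number of functions.
    For two functions and m = 1 this splits y along a sum f + g and gives the
    quasi-triangle inequality ([E_split]); iterating that splitting along a
    rapidly convergent series gives completeness ([E_bound_series]). For
    L-convexity, let 0 <= f_i <= f have average at least (1 - eps) f. At each t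
    most of the f_i^^(t) exceed half of f^^(t) by Markov's inequality, hence
    every y dominated by f^^ has parts z_i dominated by the f_i^^ whose average
    is at least (1 - 2 eps) y, and the L-convexity of X bounds y
    ([E_L_convex]).

    The proof of [K_divisibility] exploits the lattice structure. At t = 1,
    y = a + b with a in X0 and b in X1; the two halves are exchanged by
    t |-> 1/t, so take b. Split remainders greedily: c_0 = b, and
    c_k = y_k + c_(k+1) is a nearly optimal positive decomposition of c_k at
    t_(k+1), where phi grows by a fixed factor from t_k to t_(k+1). Give the
    piece y_k to those i with phi(t_k) <= psi_i(t_k). The pieces given to i are
    controlled at a scale t in two lumps: those with t_k <= t sum up to less than
    b - c_(l+1), for the last such l, whose X0-norm is of the order of phi(t_l);
    those with t_k > t sum up to less than c_u, for the first such u, whose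
    X1-norm is of the order of phi(t_u) / t_u. Both are controlled by psi_i(t)
    because psi_i is quasiconcave. *)

(** * Vector lattices *)

Section vector_lattice.
Context {R : realType} {V : vectorLatticeType R}.
Implicit Types (x y z u v : V) (a : R).

Lemma vleD x y z u : x <= y -> z <= u -> x + z <= y + u.
Proof.
move=> xy zu; apply: (le_trans (vl_leD2r z _ _ xy)).
by rewrite ![y + _]addrC; exact: vl_leD2r.
Qed.

Lemma vsubr_ge0 x y : (0 <= y - x) = (x <= y).
Proof.
apply/idP/idP => [/(vl_leD2r x _ _)|/(vl_leD2r (- x) _ _)].
  by rewrite subrK add0r.
by rewrite subrr.
Qed.

Lemma vlerBlDr x y z : (x - y <= z) = (x <= z + y).
Proof. by rewrite -(vsubr_ge0 (x - y)) opprB addrA -(vsubr_ge0 x). Qed.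

Lemma vlerN x y : (- x <= - y) = (y <= x).
Proof. by rewrite -(vsubr_ge0 (- x)) opprK addrC vsubr_ge0. Qed.

Lemma vaddr_ge0 x y : 0 <= x -> 0 <= y -> 0 <= x + y.
Proof. by move=> x0 y0; rewrite -[0]addr0; exact: vleD. Qed.

Lemma vlerDl x y : 0 <= y -> x <= x + y.
Proof. by move=> y0; rewrite -{1}[x]addr0; exact: vleD. Qed.

Lemma vlerBl x y : 0 <= y -> x - y <= x.
Proof. by move=> y0; rewrite vlerBlDr; exact: vlerDl. Qed.

Lemma vscale_le a x y : 0 <= a -> x <= y -> a *: x <= a *: y.
Proof.
by move=> a0 xy; rewrite -vsubr_ge0 -scalerBr vl_scale_ge0// vsubr_ge0.
Qed.

Lemma vscale_lel a b x : 0 <= x -> a <= b -> a *: x <= b *: x.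
Proof.
by move=> x0 ab; rewrite -vsubr_ge0 -scalerBl vl_scale_ge0// subr_ge0.
Qed.

Lemma vjoin_ub x y : x <= vjoin x y /\ y <= vjoin x y.
Proof. by have /esym := vjoin_leP x y (vjoin x y); rewrite lexx => /andP. Qed.

Lemma vjoin_lub x y z : x <= z -> y <= z -> vjoin x y <= z.
Proof. by move=> xz yz; rewrite vjoin_leP xz yz. Qed.

Lemma ler_vabs x : x <= vabs x.
Proof. by have [] := vjoin_ub x (- x). Qed.

Lemma lerN_vabs x : - x <= vabs x.
Proof. by have [] := vjoin_ub x (- x). Qed.

Lemma vabs_le x y : x <= y -> - x <= y -> vabs x <= y.
Proof. exact: vjoin_lub. Qed.

Lemma vabs_ge0 x : 0 <= vabs x.
Proof.
have : 0 <= vabs x + vabs x.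
  by rewrite -(subrr x); apply: vleD; [exact: ler_vabs|exact: lerN_vabs].
move=> x0; have -> : vabs x = 2^-1 *: (vabs x + vabs x).
  by rewrite -mulr2n -(scaler_nat 2 (vabs x)) scalerA mulVf ?pnatr_eq0//
    scale1r.
by apply: vl_scale_ge0 x0; rewrite invr_ge0.
Qed.

Lemma vabs_id x : 0 <= x -> vabs x = x.
Proof.
move=> x0; apply/eqP; rewrite eq_le ler_vabs andbT vabs_le//.
by apply: (le_trans _ x0); rewrite -[leRHS]oppr0 vlerN.
Qed.

Lemma vabs_vabs x : vabs (vabs x) = vabs x.
Proof. exact/vabs_id/vabs_ge0. Qed.

Lemma vabsD x y : vabs (x + y) <= vabs x + vabs y.
Proof.
apply: vabs_le; first by apply: vleD; exact: ler_vabs.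
by rewrite opprD; apply: vleD; exact: lerN_vabs.
Qed.

Lemma vabsN x : vabs (- x) = vabs x.
Proof.
apply/eqP; rewrite eq_le !vabs_le// ?opprK ?ler_vabs ?lerN_vabs//.
by rewrite -[leLHS]opprK lerN_vabs.
Qed.

(** The Riesz decomposition property: the positive part of [x - u] is what [x]
    must take from [v] when it is dominated by [u + v]. *)
Lemma riesz_decomposition x u v : 0 <= x -> 0 <= u -> 0 <= v -> x <= u + v ->
  exists x1 x2, [/\ 0 <= x1 <= u, 0 <= x2 <= v & x = x1 + x2].
Proof.
move=> x0 u0 v0 xuv; have [pu p0] := vjoin_ub (x - u) 0.
exists (x - vjoin (x - u) 0), (vjoin (x - u) 0); split.
- apply/andP; split; last by rewrite vlerBlDr addrC -vlerBlDr.
  by rewrite vsubr_ge0 vjoin_lub// vlerBl.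
- by rewrite p0 vjoin_lub// vlerBlDr addrC.
- by rewrite subrK.
Qed.

Lemma vabs_vpos x : x = vjoin x 0 - (vjoin x 0 - x).
Proof. by rewrite opprB addrC subrK. Qed.

Lemma vpos_ge0 x : 0 <= vjoin x 0.
Proof. by have [] := vjoin_ub x 0. Qed.

Lemma vpos_le_vabs x : vjoin x 0 <= vabs x.
Proof. by rewrite vjoin_lub ?ler_vabs ?vabs_ge0. Qed.

Lemma vneg_ge0 x : 0 <= vjoin x 0 - x.
Proof. by rewrite vsubr_ge0; have [] := vjoin_ub x 0. Qed.

Lemma vneg_le_vabs x : vjoin x 0 - x <= vabs x.
Proof.
rewrite vlerBlDr; apply: vjoin_lub.
  by rewrite addrC; exact/vlerDl/vabs_ge0.
by rewrite -[x in _ + x]opprK vsubr_ge0 lerN_vabs.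
Qed.

Lemma vsum_ge0 (I : Type) (r : seq I) (P : pred I) (F : I -> V) :
  (forall i, P i -> 0 <= F i) -> 0 <= \sum_(i <- r | P i) F i.
Proof. by move=> F0; elim/big_ind : _ => // x y; exact: vaddr_ge0. Qed.

Lemma vsum_le (I : Type) (r : seq I) (P : pred I) (F G : I -> V) :
  (forall i, P i -> F i <= G i) ->
  \sum_(i <- r | P i) F i <= \sum_(i <- r | P i) G i.
Proof.
move=> FG; elim/big_ind2 : _ => // x y z u; exact: vleD.
Qed.

End vector_lattice.

(** * Quasi-normed ideals and convergent series *)

Lemma geometric_small (R : realType) (a q e : R) :
  0 <= a -> 0 <= q < 1 -> 0 < e ->
  exists N, forall n, (N <= n)%N -> a * q ^+ n < e.
Proof.
move=> a0 /andP[q0 q1] e0; have a1 : 0 < a + 1 by rewrite ltr_wpDl.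
have nq1 : `|q| < 1 by rewrite ger0_norm.
have /cvgrPdist_lt /(_ _ (divr_gt0 e0 a1)) [N _ NP] := cvg_expr nq1.
exists N => n /NP/=; rewrite sub0r normrN ger0_norm ?exprn_ge0//.
rewrite ltr_pdivlMr// mulrC; apply: le_lt_trans.
by rewrite ler_wpM2r ?exprn_ge0// lerDl.
Qed.

Section ideals.
Context {R : realType} {V : vectorLatticeType R}.
Implicit Types (A : qnspace V) (x y z : V) (a C : R).

(** Completeness is left out so that the notion also covers X0 + X1 normed by
    K(t, .) at a fixed t. *)
Definition qn_ideal A := [/\ linear_sublattice A, quasi_norm A,
  (forall x y, A x -> A y -> vabs x <= vabs y -> qnorm A x <= qnorm A y)
  & interval_preserving A setT].

(** A common quasi-triangle constant can be chosen for several spaces, and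
    [1 <= C] lets it be raised to higher powers freely. *)
Definition qn_const A C := 1 <= C /\
  forall x y, A x -> A y -> qnorm A (x + y) <= C * (qnorm A x + qnorm A y).

Lemma qn_ideal_const A : qn_ideal A -> exists C, qn_const A C.
Proof.
case=> _ [N0 _ _ [C triC]] _ _; exists (Num.max 1 C); split.
  by rewrite le_max lexx.
move=> x y Ax Ay; apply: (le_trans (triC _ _ Ax Ay)).
by rewrite ler_wpM2r ?addr_ge0 ?N0// le_max lexx orbT.
Qed.

Lemma qn_const_le A C C' : quasi_norm A -> C <= C' -> qn_const A C ->
  qn_const A C'.
Proof.
move=> [N0 _ _ _] CC' [C1 triC]; split; first exact: le_trans CC'.
move=> x y Ax Ay; apply: (le_trans (triC _ _ Ax Ay)).
by rewrite ler_wpM2r ?addr_ge0 ?N0.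
Qed.

Context {A : qnspace V}.
Hypothesis idA : qn_ideal A.

Lemma ideal0 : A 0. Proof. by case: idA => -[]. Qed.

Lemma idealZ a x : A x -> A (a *: x).
Proof.
by case: idA => -[A0 AL _] _ _ _ Ax; rewrite -[_ *: _]addr0; exact: AL.
Qed.

Lemma idealD x y : A x -> A y -> A (x + y).
Proof.
by case: idA => -[_ AL _] _ _ _ Ax Ay; rewrite -[x]scale1r; exact: AL.
Qed.

Lemma idealN x : A x -> A (- x).
Proof. by rewrite -scaleN1r; exact: idealZ. Qed.

Lemma idealB x y : A x -> A y -> A (x - y).
Proof. by move=> Ax Ay; apply: idealD => //; exact: idealN. Qed.

Lemma ideal_abs x : A x -> A (vabs x).
Proof.
by case: idA => -[_ _ AJ] _ _ _ Ax; apply: AJ => //; exact: idealN.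
Qed.

Lemma ideal_le x y : 0 <= x -> x <= y -> A y -> A x.
Proof.
by case: idA => _ _ _ AI x0 xy Ay; apply: (AI y x) => //; rewrite x0 xy.
Qed.

Lemma ideal_solid x y : A y -> vabs x <= vabs y -> A x.
Proof.
move=> /ideal_abs Ay xy; rewrite (vabs_vpos x); apply: idealB.
  exact/(ideal_le (vpos_ge0 x) _ Ay)/(le_trans (vpos_le_vabs x)).
exact/(ideal_le (vneg_ge0 x) _ Ay)/(le_trans (vneg_le_vabs x)).
Qed.

Lemma ideal_sum (I : Type) (r : seq I) (P : pred I) (F : I -> V) :
  (forall i, P i -> A (F i)) -> A (\sum_(i <- r | P i) F i).
Proof.
move=> AF; elim/big_ind : _ => //; first exact: ideal0.
by move=> x y; exact: idealD.
Qed.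

Lemma qn_ge0 x : A x -> 0 <= qnorm A x.
Proof. by case: idA => _ [N0 _ _ _] _ _; exact: N0. Qed.

Lemma qn_eq0 x : A x -> qnorm A x = 0 -> x = 0.
Proof. by case: idA => _ [_ N0 _ _] _ _; exact: N0. Qed.

Lemma qnZ a x : A x -> qnorm A (a *: x) = `|a| * qnorm A x.
Proof. by case: idA => _ [_ _ NZ _] _ _; exact: NZ. Qed.

Lemma qn0 : qnorm A 0 = 0.
Proof. by have := qnZ 0 ideal0; rewrite scale0r normr0 mul0r. Qed.

Lemma qn_mono x y : A y -> vabs x <= vabs y -> qnorm A x <= qnorm A y.
Proof.
by move=> Ay xy; case: idA => _ _ NM _; apply: NM => //; exact: ideal_solid xy.
Qed.

Lemma qn_le x y : 0 <= x -> x <= y -> A y -> qnorm A x <= qnorm A y.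
Proof.
by move=> x0 xy Ay; apply: qn_mono => //; rewrite !vabs_id// (le_trans x0).
Qed.

Lemma qn_abs x : A x -> qnorm A (vabs x) = qnorm A x.
Proof.
move=> Ax; apply/eqP; rewrite eq_le !qn_mono ?vabs_vabs//; exact: ideal_abs.
Qed.

Lemma qnN x : A x -> qnorm A (- x) = qnorm A x.
Proof. by move=> Ax; rewrite -scaleN1r qnZ// normrN1 mul1r. Qed.

(** The order is closed for the quasi-norm: the positive part of [z] lies below
    each [vabs w], so its norm is as small as that of [w]. *)
Lemma le0_of_small z :
  (forall e : R, 0 < e -> exists w, [/\ A w, qnorm A w < e & z <= vabs w]) -> z
    <= 0.
Proof.
move=> small.
have pz w : z <= vabs w -> vjoin z 0 <= vabs w.
  by move=> zw; apply: vjoin_lub => //; exact: vabs_ge0.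
have Az : A (vjoin z 0).
  have [w [Aw _ /pz zw]] := small 1 ltr01.
  exact: (ideal_le (vpos_ge0 z) zw (ideal_abs Aw)).
have : qnorm A (vjoin z 0) = 0.
  apply/eqP; rewrite eq_le qn_ge0// andbT; apply/ler_addgt0Pl => e e0.
  have [w [Aw we /pz zw]] := small e e0; rewrite addr0.
  apply: le_trans (ltW we); apply: qn_mono => //.
  by rewrite (vabs_id (vpos_ge0 z)).
by move=> /(qn_eq0 Az) {1}<-; have [] := vjoin_ub z 0.
Qed.

Section series.
Context {C : R} (CA : qn_const A C).

Let C1 : 1 <= C. Proof. by case: CA. Qed.
Let C0 : 0 < C. Proof. exact: lt_le_trans C1. Qed.

Lemma qnD x y : A x -> A y -> qnorm A (x + y) <= C * (qnorm A x + qnorm A y).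
Proof. by case: CA => _; exact. Qed.

(** The factor C lost at each use of the quasi-triangle inequality is absorbed
    by the ratio 1 / (2 C): adding the terms starting from the last one, each
    partial tail is bounded by twice C times its first term. *)
Lemma qn_geometric_sum (y : nat -> V) (h : R) : (forall n, A (y n)) ->
  0 <= h -> (forall n, qnorm A (y n) <= h * (2 * C)^-1 ^+ n) ->
  forall m n, qnorm A (\sum_(n <= k < n + m) y k) <= 2 * C * h * (2 * C)^-1 ^+
    n.
Proof.
move=> Ay h0 yh; elim=> [|m IH] n.
  rewrite addn0 big_geq// qn0 !mulr_ge0// ?exprn_ge0// ?invr_ge0 ?mulr_ge0//;
  exact: ltW.
rewrite big_ltn ?addnS ?ltnS ?leq_addr// -addSn.
apply: le_trans (qnD (Ay _) (ideal_sum _ _)) _; first by move=> *; exact: Ay.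
apply: le_trans (ler_wpM2l (ltW C0) (lerD (yh n) (IH n.+1))) _.
rewrite exprS -subr_ge0; set q := _ ^+ n.
suff -> : 2 * C * h * q - C * (h * q + 2 * C * h * ((2 * C)^-1 * q)) = 0 by [].
by field; rewrite gt_eqF.
Qed.

(** A substitute for countable quasi-subadditivity: a positive series whose
    norms decay like (2 C)^-n has a sum, which dominates every term. *)
Lemma qn_series (cA : qn_complete A) (y : nat -> V) (h : R) :
  (forall n, A (y n)) -> (forall n, 0 <= y n) -> 0 < h ->
  (forall n, qnorm A (y n) <= h * (2 * C)^-1 ^+ n) ->
  exists Y, [/\ A Y, qnorm A Y <= 3 * C ^+ 2 * h,
    (forall n, \sum_(0 <= k < n) y k <= Y)
    & forall e : R, 0 < e -> exists N, forall n, (N <= n)%N ->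
        qnorm A (Y - \sum_(0 <= k < n) y k) < e].
Proof.
move=> Ay y0 h0 yh; pose S n := \sum_(0 <= k < n) y k.
have AS n : A (S n) by apply: ideal_sum => *; exact: Ay.
have SB m n : (n <= m)%N -> S m - S n = \sum_(n <= k < m) y k.
  by move=> nm; rewrite /S (big_cat_nat (leq0n n) nm)/= addrAC subrr add0r.
have Sle m n : (n <= m)%N -> S n <= S m.
  by move=> nm; rewrite -vsubr_ge0 SB//; exact: vsum_ge0.
have bnd m n : (n <= m)%N -> qnorm A (S m - S n) <= 2 * C * h * (2 * C)^-1 ^+ n.
  by move=> nm; rewrite SB// -(subnKC nm);
    exact: qn_geometric_sum (ltW h0) yh _ _.
have C20 : 0 < 2 * C * h by rewrite !mulr_gt0.
have smallq e : 0 < e -> exists N, forall n, (N <= n)%N ->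
    2 * C * h * (2 * C)^-1 ^+ n < e.
  move=> e0; apply: geometric_small => //; first exact: ltW.
  rewrite invr_ge0 mulr_ge0 ?(ltW C0)// invf_lt1 ?mulr_gt0//; have := C1; lra.
have cauchyS e : 0 < e -> exists N : nat, forall m n : nat, (N <= m)%N ->
    (N <= n)%N -> qnorm A (S m - S n) < e.
  move=> /smallq[N NP]; exists N => m n Nm Nn.
  have [nm|/ltnW mn] := leqP n m;
    first exact: le_lt_trans (bnd _ _ nm) (NP _ Nn).
  rewrite -qnN; last exact: idealB.
  by rewrite opprB; exact: le_lt_trans (bnd _ _ mn) (NP _ Nm).
have [Y AY SY] := cA S AS cauchyS.
have SYe e : 0 < e -> exists N, forall n, (N <= n)%N -> qnorm A (Y - S n) < e.
  move=> e0; move/cvgrPdist_lt/(_ e e0) : SY => [N _ NP]; exists N => n /NP/=.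
  rewrite sub0r normrN ger0_norm; last exact/qn_ge0/idealB.
  by rewrite -qnN ?opprB//; exact: idealB.
exists Y; split => //.
- apply/ler_addgt0Pr => e e0.
  have [N /(_ N (leqnn _)) NP] := SYe (e / C) (divr_gt0 e0 C0).
  have -> : Y = (Y - S N) + S N by rewrite subrK.
  apply: le_trans (qnD (idealB AY (AS N)) (AS N)) _.
  have := bnd N 0 (leq0n _); rewrite {2}/S big_geq// subr0 expr0 mulr1 => SN.
  apply: le_trans (ler_wpM2l (ltW C0) (lerD (ltW NP) SN)) _.
  by rewrite mulrDr mulrCA divff ?gt_eqF// mulr1 addrC lerD2r; nra.
- move=> n; rewrite -vsubr_ge0 -vlerN opprB oppr0; apply: le0_of_small => e e0.
  have [N NP] := SYe e e0; exists (Y - S (maxn N n)); split.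
  + exact: idealB.
  + by apply: NP; rewrite leq_maxl.
  + rewrite -vabsN opprB; apply: le_trans (ler_vabs _).
    by apply: vl_leD2r; apply: Sle; rewrite leq_maxr.
Qed.

End series.

End ideals.

(** * The K-functional of a couple of ideals *)

Section signed_riesz.
Context {R : realType} {V : vectorLatticeType R}.
Implicit Types x y u v : V.

(** A signed form of the Riesz decomposition in which the bounds on the two
    parts suffer no loss, so that K is exactly monotone in [vabs x]. *)
Lemma vabs_decomposition x u v : 0 <= u -> 0 <= v -> vabs x <= u + v ->
  exists x1 x2, [/\ vabs x1 <= u, vabs x2 <= v & x = x1 + x2].
Proof.
(* Shifting by u + v reduces to the decomposition of a positive vector. *)
move=> u0 v0 xuv.
have [p [q [/andP[p0 pu] /andP[q0 qv] pq]]] :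
    exists p q, [/\ 0 <= p <= u + u, 0 <= q <= v + v & x + (u + v) = p + q].
  apply: riesz_decomposition; [|exact: vaddr_ge0|exact: vaddr_ge0|].
    by rewrite -[x]opprK addrC vsubr_ge0; exact: le_trans (lerN_vabs _) xuv.
  by rewrite addrACA; apply: vl_leD2r; exact: le_trans (ler_vabs _) xuv.
have shift w z : 0 <= w -> w <= z + z -> vabs (w - z) <= z.
  move=> w0 wz; apply: vabs_le; first by rewrite vlerBlDr.
  by rewrite opprB; exact: vlerBl.
exists (p - u), (q - v); split; [exact: shift|exact: shift|].
by rewrite addrACA -opprD -pq addrK.
Qed.

End signed_riesz.

Section K_functional.
Context {R : realType} {V : vectorLatticeType R}.
Implicit Types (x y z : V) (t s a e : R).

Section one_couple.
Context {X0 X1 : qnspace V} (id0 : qn_ideal X0) (id1 : qn_ideal X1).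
Local Notation K := (Kfun X0 X1).
Local Notation Sg := (Sigma X0 X1).

Let K_lb t x : 0 < t -> lbound
  [set qnorm X0 p.1 + t * qnorm X1 p.2 | p in decomposition X0 X1 x] 0.
Proof.
move=> t0 _ [p [p0 p1 _] <-].
by rewrite addr_ge0 ?(qn_ge0 id0)// mulr_ge0 ?(qn_ge0 id1)// ltW.
Qed.

Let K_nonempty t x : Sg x ->
  [set qnorm X0 p.1 + t * qnorm X1 p.2 | p in decomposition X0 X1 x] !=set0.
Proof. by case=> p xp; exists (qnorm X0 p.1 + t * qnorm X1 p.2), p. Qed.

Lemma sigmaD x y : X0 x -> X1 y -> Sg (x + y).
Proof. by move=> x0 y1; exists (x, y). Qed.

Lemma sigma0 x : X0 x -> Sg x.
Proof. by move=> x0; rewrite -[x]addr0; apply: sigmaD x0 _; exact: ideal0. Qed.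

Lemma sigma1 x : X1 x -> Sg x.
Proof. by move=> x1; rewrite -[x]add0r; apply: sigmaD _ x1; exact: ideal0. Qed.

Lemma K_ge0 t x : 0 < t -> Sg x -> 0 <= K t x.
Proof. by move=> t0 Sx; apply: lb_le_inf; [exact: K_nonempty|exact: K_lb]. Qed.

Lemma K_le t x y : 0 < t -> X0 x -> X1 y ->
  K t (x + y) <= qnorm X0 x + t * qnorm X1 y.
Proof.
move=> t0 x0 y1; apply: ge_inf; first by exists 0; exact: K_lb.
by exists (x, y).
Qed.

Lemma K_le0 t x : 0 < t -> X0 x -> K t x <= qnorm X0 x.
Proof.
move=> t0 x0; have := K_le t0 x0 (ideal0 id1).
by rewrite (qn0 id1) mulr0 !addr0.
Qed.

Lemma K_le1 t x : 0 < t -> X1 x -> K t x <= t * qnorm X1 x.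
Proof.
move=> t0 x1; have := K_le t0 (ideal0 id0) x1.
by rewrite (qn0 id0) !add0r.
Qed.

Lemma K_approx t x e : 0 < t -> Sg x -> 0 < e -> exists x0 x1,
  [/\ X0 x0, X1 x1, x = x0 + x1 & qnorm X0 x0 + t * qnorm X1 x1 < K t x + e].
Proof.
move=> t0 Sx e0.
have hasinf : has_inf
    [set qnorm X0 p.1 + t * qnorm X1 p.2 | p in decomposition X0 X1 x].
  by split; [exact: K_nonempty Sx|exists 0; exact: K_lb].
have [_ [[x0 x1] [/= X0x X1x xE] <-] xe] := inf_adherent e0 hasinf.
by exists x0, x1.
Qed.

Lemma sigma_le t x x0 x1 : 0 < t -> X0 x0 -> X1 x1 ->
  vabs x <= vabs x0 + vabs x1 ->
  Sg x /\ K t x <= qnorm X0 x0 + t * qnorm X1 x1.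
Proof.
move=> t0 X0x X1x xx.
have [y0 [y1 [y0x y1x ->]]] :=
  vabs_decomposition (vabs_ge0 _) (vabs_ge0 _) xx.
have [Y0 Y1] := (ideal_solid id0 X0x y0x, ideal_solid id1 X1x y1x).
split; first exact: sigmaD.
apply: (le_trans (K_le t0 Y0 Y1)); apply: lerD;
  first exact: (qn_mono id0 X0x y0x).
by rewrite ler_wpM2l ?(ltW t0)//; exact: (qn_mono id1 X1x y1x).
Qed.

Lemma sigma_solid_K t x y : 0 < t -> Sg y -> vabs x <= vabs y ->
  Sg x /\ K t x <= K t y.
Proof.
move=> t0 Sy xy.
have key e : 0 < e -> Sg x /\ K t x <= K t y + e.
  move=> e0; have [y0 [y1 [Y0 Y1 yE ye]]] := K_approx t0 Sy e0.
  have [|Sx Kx] := @sigma_le t x y0 y1 t0 Y0 Y1.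
    by apply: (le_trans xy); rewrite yE; exact: vabsD.
  by split => //; exact: le_trans (ltW ye).
have [Sx _] := key 1 ltr01; split => //.
by apply/ler_addgt0Pr => e /key[].
Qed.

Lemma sigma_solid x y : Sg y -> vabs x <= vabs y -> Sg x.
Proof. by move=> Sy /(sigma_solid_K ltr01 Sy)[]. Qed.

Lemma K_mono t x y : 0 < t -> Sg y -> vabs x <= vabs y -> K t x <= K t y.
Proof. by move=> t0 Sy /(sigma_solid_K t0 Sy)[]. Qed.

Lemma sigma_pos_le x y : 0 <= x -> x <= y -> Sg y -> Sg x.
Proof.
move=> x0 xy Sy; apply: sigma_solid Sy _.
by rewrite !vabs_id// (le_trans x0).
Qed.

Lemma K_pos_le t x y : 0 < t -> 0 <= x -> x <= y -> Sg y -> K t x <= K t y.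
Proof.
by move=> t0 x0 xy Sy; apply: K_mono; rewrite ?vabs_id// (le_trans x0).
Qed.

Lemma K_abs t x : 0 < t -> Sg x -> K t (vabs x) = K t x.
Proof.
move=> t0 Sx; apply/eqP; rewrite eq_le !K_mono ?vabs_vabs//.
by apply: sigma_solid Sx _; rewrite vabs_vabs.
Qed.

(** By the Riesz decomposition property, positive elements have nearly optimal
    decompositions into positive parts. *)
Lemma K_split t x e : 0 < t -> 0 <= x -> Sg x -> 0 < e -> exists x0 x1,
  [/\ X0 x0, X1 x1, 0 <= x0 /\ 0 <= x1, x = x0 + x1
    & qnorm X0 x0 + t * qnorm X1 x1 < K t x + e].
Proof.
move=> t0 x_ge0 Sx e0; have [y0 [y1 [Y0 Y1 xE ye]]] := K_approx t0 Sx e0.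
have [|x0 [x1 [/andP[x00 x0y] /andP[x10 x1y] xx]]] :=
    riesz_decomposition x_ge0 (vabs_ge0 y0) (vabs_ge0 y1).
  by rewrite xE; apply: vleD; exact: ler_vabs.
have := (ideal_abs id0 Y0, ideal_abs id1 Y1) => -[AY0 AY1].
exists x0, x1; split => //.
- exact: ideal_le x0y AY0.
- exact: ideal_le x1y AY1.
- apply: le_lt_trans ye; rewrite -(qn_abs id0 Y0) -(qn_abs id1 Y1).
  by apply: lerD; [exact: qn_le|rewrite ler_wpM2l ?(ltW t0)//; exact: qn_le].
Qed.

Lemma K_zero t : 0 < t -> K t 0 = 0.
Proof.
move=> t0; apply/eqP; rewrite eq_le K_ge0 ?andbT//; last exact/sigma0/ideal0.
by rewrite -[leRHS](qn0 id0); exact/K_le0/ideal0.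
Qed.

Lemma sigmaZ a x : Sg x -> Sg (a *: x).
Proof.
case=> -[x0 x1] [/= X0x X1x ->]; rewrite scalerDr.
by apply: sigmaD; exact: idealZ.
Qed.

Lemma KZ_le t a x : 0 < t -> Sg x -> K t (a *: x) <= `|a| * K t x.
Proof.
move=> t0 Sx; have [->|a0] := eqVneq a 0.
  by rewrite scale0r normr0 mul0r K_zero.
rewrite mulrC -ler_pdivrMr ?normr_gt0//.
apply: lb_le_inf; first exact: K_nonempty.
move=> _ [[x0 x1] [/= X0x X1x ->] <-].
rewrite ler_pdivrMr ?normr_gt0// mulrDl scalerDr.
apply: (le_trans (K_le t0 (idealZ id0 _ X0x) (idealZ id1 _ X1x))).
rewrite (qnZ id0)// (qnZ id1)// le_eqVlt; apply/orP; left; apply/eqP; ring.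
Qed.

Lemma sigma_add x y : Sg x -> Sg y -> Sg (x + y).
Proof.
case=> -[x0 x1] [/= X0x X1x ->] [[y0 y1] [/= Y0 Y1 ->]].
by rewrite addrACA; apply: sigmaD; exact: idealD.
Qed.

Lemma sigma_sum (I : Type) (r : seq I) (P : pred I) (F : I -> V) :
  (forall i, P i -> Sg (F i)) -> Sg (\sum_(i <- r | P i) F i).
Proof.
move=> SF; elim/big_ind : _ => //; first exact/sigma0/ideal0.
by move=> x y; exact: sigma_add.
Qed.

Lemma K_nondecreasing s t x : 0 < s -> s <= t -> Sg x -> K s x <= K t x.
Proof.
move=> s0 st Sx; apply: lb_le_inf; first exact: K_nonempty.
move=> _ [[x0 x1] [/= X0x X1x ->] <-].
by apply: (le_trans (K_le s0 X0x X1x)); rewrite lerD2l ler_wpM2r// qn_ge0.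
Qed.

Lemma K_slope s t x : 0 < s -> s <= t -> Sg x -> s * K t x <= t * K s x.
Proof.
move=> s0 st Sx; have t0 := lt_le_trans s0 st.
rewrite [leRHS]mulrC -ler_pdivrMr//.
apply: lb_le_inf; first exact: K_nonempty.
move=> _ [[x0 x1] [/= X0x X1x ->] <-].
rewrite ler_pdivrMr// mulrDl.
apply: (le_trans (ler_wpM2l (ltW s0) (K_le t0 X0x X1x))).
rewrite mulrDr; apply: lerD; last by rewrite mulrA mulrAC.
by rewrite mulrC ler_wpM2l// qn_ge0.
Qed.

Lemma K_add C t x y : qn_const X0 C -> qn_const X1 C -> 0 < t ->
  Sg x -> Sg y -> K t (x + y) <= C * (K t x + K t y).
Proof.
move=> C0 C1 t0 Sx Sy; have C_gt0 : 0 < C by case: C0 => C_ge1 _;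
  exact: lt_le_trans ltr01 C_ge1.
apply/ler_addgt0Pr => e e0; pose d := e / (2 * C).
have d0 : 0 < d by rewrite divr_gt0// mulr_gt0.
have [x0 [x1 [X0x X1x -> xd]]] := K_approx t0 Sx d0.
have [y0 [y1 [X0y X1y -> yd]]] := K_approx t0 Sy d0.
rewrite (addrACA x0).
apply: (le_trans (K_le t0 (idealD id0 X0x X0y) (idealD id1 X1x X1y))).
have D0 := qnD C0 X0x X0y; have := ler_wpM2l (ltW t0) (qnD C1 X1x X1y).
have -> : e = C * (d + d) by rewrite /d; field; rewrite gt_eqF.
move: (Kfun X0 X1 t _) (Kfun X0 X1 t _) xd yd => Kx Ky xd yd D1.
apply: (le_trans (lerD D0 D1)).
rewrite [t * (C * _)]mulrCA -mulrDr -mulrDr ler_pM2l//; nra.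
Qed.

Lemma sigma_norm x : qnorm Sg x = K 1 x.
Proof.
by rewrite /= /Kfun; congr inf; apply: eq_imagel => p _; rewrite mul1r.
Qed.

Lemma KZ t a x : 0 < t -> Sg x -> K t (a *: x) = `|a| * K t x.
Proof.
move=> t0 Sx; apply/eqP; rewrite eq_le KZ_le//=.
have [->|a0] := eqVneq a 0.
  by rewrite normr0 mul0r K_ge0//; exact: sigmaZ.
rewrite -ler_pdivlMl ?normr_gt0// -normfV.
have -> : K t x = K t (a^-1 *: (a *: x)) by rewrite scalerA mulVf// scale1r.
by apply: KZ_le => //; exact: sigmaZ.
Qed.

(** For each t, K(t, .) is an equivalent quasi-norm on X0 + X1 with the same
    constant as X0 and X1; this lets the general facts on ideals be applied to
    K(t, .) without constants that depend on t. *)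
Definition Kspace t : qnspace V := QNSpace Sg (K t).

Lemma Kspace_const C t : qn_const X0 C -> qn_const X1 C -> 0 < t ->
  qn_const (Kspace t) C.
Proof.
by move=> C0 C1 t0; split => [|x y Sx Sy]; [case: C0|exact: K_add].
Qed.

Lemma Kspace_ideal t : (forall x, Sg x -> K 1 x = 0 -> x = 0) -> 0 < t ->
  qn_ideal (Kspace t).
Proof.
move=> K1_eq0 t0; split.
- split; first exact/sigma0/ideal0.
    by move=> a x y Sx Sy; apply: sigma_add => //; exact: sigmaZ.
  move=> x y Sx Sy; apply: (@sigma_solid _ (vabs x + vabs y)).
    by apply: sigma_add; [apply: sigma_solid Sx _|apply: sigma_solid Sy _];
      rewrite vabs_vabs.
  have xy0 : 0 <= vabs x + vabs y by rewrite vaddr_ge0// vabs_ge0.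
  rewrite (vabs_id xy0); apply: vabs_le.
    apply: vjoin_lub; first exact: le_trans (ler_vabs _) (vlerDl _ (vabs_ge0
      _)).
    by rewrite addrC; exact: le_trans (ler_vabs _) (vlerDl _ (vabs_ge0 _)).
  have [xj _] := vjoin_ub x y; rewrite -[leRHS]opprK vlerN.
  apply: le_trans xj; rewrite -[leRHS]opprK vlerN.
  exact: le_trans (lerN_vabs _) (vlerDl _ (vabs_ge0 _)).
- split.
  + by move=> x Sx; exact: K_ge0.
  + move=> x Sx /= Kt0; apply: K1_eq0 => //; apply/eqP.
    rewrite eq_le K_ge0// andbT; have [t1|/ltW t1] := leP 1 t.
      by rewrite -Kt0 K_nondecreasing.
    by have := K_slope t0 t1 Sx; rewrite Kt0 mulr0 pmulr_rle0.
  + by move=> a x Sx; exact: KZ.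
  + have [C CX0] := qn_ideal_const id0; have [D DX1] := qn_ideal_const id1.
    exists (Num.max C D) => x y Sx Sy.
    have [[_ N0 _ _] [_ N1 _ _]] := (id0, id1).
    apply: K_add => //.
      by apply: qn_const_le CX0 => //; rewrite le_max lexx.
    by apply: qn_const_le DX1 => //; rewrite le_max lexx orbT.
- by move=> x y Sx Sy xy; exact: K_mono.
- by move=> x y Sx _ /andP[y0 yx]; exact: sigma_pos_le yx Sx.
Qed.

End one_couple.

(** Exchanging the two spaces amounts to t |-> 1/t; it reduces the part of an
    element lying in X0 to the part lying in X1. *)
Lemma K_swap (X0 X1 : qnspace V) t x : 0 < t ->
  qn_ideal X0 -> qn_ideal X1 -> Sigma X0 X1 x ->
  Sigma X1 X0 x /\ Kfun X1 X0 t x = t * Kfun X0 X1 t^-1 x.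
Proof.
move=> t0 id0 id1 Sx; have tV0 : 0 < t^-1 by rewrite invr_gt0.
have swapS (Y0 Y1 : qnspace V) y : Sigma Y0 Y1 y -> Sigma Y1 Y0 y.
  by case=> -[y0 y1] [/= Y0y Y1y ->]; exists (y1, y0); split; rewrite // addrC.
have le (Y0 Y1 : qnspace V) s y : qn_ideal Y0 -> qn_ideal Y1 -> 0 < s ->
    Sigma Y0 Y1 y -> Kfun Y1 Y0 s y <= s * Kfun Y0 Y1 s^-1 y.
  move=> idY0 idY1 s0 Sy; apply/ler_addgt0Pr => e e0.
  have sV0 : 0 < s^-1 by rewrite invr_gt0.
  have [y0 [y1 [Y0y Y1y -> /ltW ye]]] :=
    K_approx idY0 idY1 sV0 Sy (divr_gt0 e0 s0).
  rewrite {1}addrC; apply: (le_trans (K_le idY1 idY0 s0 Y1y Y0y)).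
  have := ler_wpM2l (ltW s0) ye; rewrite !mulrDr mulrA mulfV ?gt_eqF// mul1r.
  by rewrite [s * (e / s)]mulrC divfK ?gt_eqF// addrC.
split; first exact: swapS.
apply/eqP; rewrite eq_le le//=.
have := le _ _ _ _ id1 id0 tV0 (swapS _ _ _ Sx); rewrite invrK => H.
have := ler_wpM2l (ltW t0) H.
by rewrite mulrA mulfV ?gt_eqF// mul1r.
Qed.

End K_functional.

(** * Quasiconcave functions and the greedy chain *)

Section quasiconcave.
Context {R : realType}.
Implicit Types (phi psi : R -> R) (s t : R).

Definition quasiconcave phi := forall s t, 0 < s -> s <= t ->
  [/\ 0 <= phi s, phi s <= phi t & s * phi t <= t * phi s].

Lemma quasiconcave_doubling phi t : quasiconcave phi -> 0 < t ->
  phi (2 * t) <= 2 * phi t.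
Proof.
move=> qc t0; have [|_ _ sl] := qc t (2 * t) t0; first by lra.
by rewrite -(ler_pM2l t0) (le_trans sl)// mulrCA mulrA.
Qed.

Lemma quasiconcave_min phi c : 0 <= c -> quasiconcave phi ->
  quasiconcave (fun t => Num.min (phi t) c).
Proof.
move=> c0 qc s t s0 st; have [ps0 pst sl] := qc s t s0 st.
have t0 := lt_le_trans s0 st; split.
- by rewrite le_min ps0.
- by rewrite le_min !ge_min pst lexx orbT.
- by rewrite !minr_pMr ?(ltW s0) ?(ltW t0)// le_min !ge_min sl ler_wpM2r ?orbT.
Qed.

(** The involution phi(t) |-> t phi(1/t) exchanges the two conditions of
    quasiconcavity, as exchanging the spaces of a couple does for the
    K-functional. *)
Lemma quasiconcave_swap phi : quasiconcave phi ->
  quasiconcave (fun t => t * phi t^-1).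
Proof.
move=> qc s t s0 st; have t0 := lt_le_trans s0 st.
have tV0 : 0 < t^-1 by rewrite invr_gt0.
have sV0 : 0 < s^-1 by rewrite invr_gt0.
have [p0 pst sl] : [/\ 0 <= phi t^-1, phi t^-1 <= phi s^-1 &
    t^-1 * phi s^-1 <= s^-1 * phi t^-1].
  by apply: qc => //; rewrite lef_pV2.
split.
- by rewrite mulr_ge0 ?(ltW s0)// (le_trans p0).
- by move: sl; rewrite ler_pdivrMl// mulrCA ler_pdivlMl.
- by rewrite mulrCA ler_wpM2l ?(ltW t0)// ler_wpM2l// ltW.
Qed.

End quasiconcave.

Section chain.
Context {R : realType} {V : vectorLatticeType R}.
Context {X0 X1 : qnspace V} (id0 : qn_ideal X0) (id1 : qn_ideal X1).
Context {C : R} (C0 : qn_const X0 C) (C1 : qn_const X1 C).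
Local Notation K := (Kfun X0 X1).
Local Notation Sg := (Sigma X0 X1).
Context {phi : R -> R} (qc : quasiconcave phi)
  (phi_gt0 : forall t : R, 0 < t -> 0 < phi t).
Context {b : V} (X1b : X1 b) (b_ge0 : 0 <= b) (b_norm : qnorm X1 b <= 2 * phi 1)
  (Kb : forall t, 1 <= t -> K t b <= phi t).

Let C_ge1 : 1 <= C. Proof. by case: C0. Qed.
Let C_gt0 : 0 < C. Proof. exact: lt_le_trans C_ge1. Qed.

(* A state (t, c) records a scale and what remains of b there. The last
   alternative describes the state reached once phi has stopped growing: the
   whole remainder has then been used up as one piece. *)
Let chain_inv (s : R * V) := [/\ 1 <= s.1, X1 s.2, 0 <= s.2 <= b,
  s.1 * qnorm X1 s.2 <= 2 * phi s.1
  & (X0 (b - s.2) /\ qnorm X0 (b - s.2) <= 4 * C * phi s.1) \/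
    (s.2 = 0 /\ forall t, s.1 <= t -> phi t <= 2 * C * phi s.1)].

(* The third clause is the only estimate on the removed part that is kept: it
   holds for the X0-norm while phi grows, and by K(t, b) <= phi(t) at the stop. *)
Let chain_rel (s s' : R * V) := [/\ s.1 <= s'.1, s'.2 <= s.2,
  (forall t, s.1 <= t -> K t (b - s'.2) <= 16 * C ^+ 2 * phi s.1)
  & s'.2 = 0 \/ 2 * phi s.1 <= phi s'.1].

(* Doubling t until phi has grown by 2 C overshoots by a factor 2 at most,
   since phi(2 t) <= 2 phi(t). *)
Let next_scale t u : 1 <= t -> t <= u -> 2 * C * phi t <= phi u ->
  exists t', [/\ t <= t', 2 * C * phi t <= phi t' & phi t' <= 4 * C * phi t].
Proof.
move=> t1 tu phiu; have t0 : 0 < t by exact: lt_le_trans t1.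
have p0 := phi_gt0 t0.
have ex : exists n, 2 * C * phi t <= phi (2 ^+ n * t).
  exists (Num.truncn u).+1; apply: (le_trans phiu).
  have u0 := lt_le_trans t0 tu.
  have un : u < (Num.truncn u).+1%:R by rewrite Num.Theory.truncnS_gt.
  have n2 : (Num.truncn u).+1%:R <= 2 ^+ (Num.truncn u).+1 :> R.
    by rewrite -natrX ler_nat ltnW// ltn_expl.
  have [] // := qc u0 (_ : u <= 2 ^+ (Num.truncn u).+1 * t).
  by apply: le_trans (ltW un) _; apply: le_trans n2 _;
    rewrite ler_peMr// exprn_ge0.
case: (ex_minnP ex) => -[|n] Pn minn.
  by move: Pn; rewrite expr0 mul1r; have := C_ge1; nra.
have n0 : 0 < 2 ^+ n * t by rewrite mulr_gt0// exprn_gt0.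
exists (2 ^+ n.+1 * t); split => //.
  by rewrite ler_peMl ?(ltW t0)// exprn_ege1// ler1n.
rewrite exprS -mulrA; apply: (le_trans (quasiconcave_doubling qc n0)).
have : ~~ (2 * C * phi t <= phi (2 ^+ n * t)).
  by apply/negP => /minn; rewrite ltnn.
rewrite -ltNge; lra.
Qed.

Let b_le (t : R) (x : V) : 0 < t -> 0 <= x -> x <= b -> K t x <= K t b.
Proof. by move=> t0 x0 xb; apply: (K_pos_le id0 id1) => //; exact: sigma1. Qed.

Let chain_next s : chain_inv s -> exists s', chain_inv s' /\ chain_rel s s'.
Proof.
move: s => [t c] [/= t1 X1c /andP[c0 cb] cn alt]; have t0 : 0 < t :=
  lt_le_trans ltr01 t1.
have pt := phi_gt0 t0; have CC := C_ge1.
have stop : (forall u, t <= u -> phi u <= 2 * C * phi t) ->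
    exists s', chain_inv s' /\ chain_rel (t, c) s'.
  move=> bd; exists (t, 0); split; split => //=.
  - exact: ideal0.
  - by rewrite lexx.
  - by rewrite (qn0 id1) mulr0; lra.
  - by right.
  - move=> u tu; rewrite subr0; apply: (le_trans (Kb (le_trans t1 tu))).
    by apply: (le_trans (bd _ tu)); rewrite ler_pM2r//; nra.
  - by left.
have [bd|nbd] := pselect (forall u, t <= u -> phi u <= 2 * C * phi t).
  exact: stop.
case: alt => [[X0bc bcn]|[_ /stop//]].
have [u [tu /ltW pu]] : exists u, t <= u /\ 2 * C * phi t < phi u.
  apply: contra_notP nbd => nex u tu; rewrite leNgt; apply/negP => pu.
  by apply: nex; exists u.
have [t' [tt' pt' pt'le]] := next_scale t1 tu pu.
have t'1 := le_trans t1 tt'; have t'0 : 0 < t' := lt_le_trans ltr01 t'1.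
have pt'0 := phi_gt0 t'0.
have Sc := sigma1 id0 X1c.
have [d [c' [X0d X1c' [d0 c'0] cE dn]]] := K_split id0 id1 t'0 c0 Sc pt'0.
have Kc : K t' c <= phi t' by apply: le_trans (b_le t'0 c0 cb) (Kb t'1).
have c'c : c' <= c by rewrite cE addrC; exact: vlerDl.
have bE : b - c' = (b - c) + d by rewrite cE opprD addrA addrAC subrK.
have X0bc' : X0 (b - c') by rewrite bE; exact: idealD.
have dn0 := qn_ge0 id0 X0d; have c'n0 := qn_ge0 id1 X1c'.
have bc'n : qnorm X0 (b - c') <= 4 * C * phi t'.
  rewrite bE; apply: (le_trans (qnD C0 X0bc X0d)).
  have -> : 4 * C * phi t' = C * (4 * phi t') by ring.
  rewrite ler_pM2l//; nra.
exists (t', c'); split; split => //=.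
- by rewrite c'0 (le_trans c'c).
- nra.
- by left.
- move=> v tv; have v0 := lt_le_trans t0 tv.
  apply: (le_trans (K_le0 id0 id1 v0 X0bc')); apply: (le_trans bc'n).
  have -> : 16 * C ^+ 2 * phi t = 4 * C * (4 * C * phi t) by ring.
  by rewrite ler_pM2l// mulr_gt0.
- by right; nra.
Qed.

(** The remainders [c k] of b at scales along which phi grows by the factor 2 C,
    which beats the constant of the quasi-triangle inequality and keeps the
    X0-norm of the removed part [b - c k] of the order of phi(t k). That the
    remainders tend to 0 in X1 needs phi(t) / t to come arbitrarily close
    to 0. *)
Lemma greedy_chain : (forall e :
  R, 0 < e -> exists2 T, 1 <= T & phi T < e * T) ->
  exists (t : nat -> R) (c : nat -> V), [/\ c 0%N = b,
    (forall k, [/\ 1 <= t k, t k <= t k.+1, X1 (c k) & 0 <= c k.+1 <= c k]),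
    (forall k, t k * qnorm X1 (c k) <= 2 * phi (t k)),
    (forall k u, t k <= u -> K u (b - c k.+1) <= 16 * C ^+ 2 * phi (t k))
    & forall e : R, 0 < e -> exists N, qnorm X1 (c N) < e].
Proof.
move=> slope0.
have inv0 : chain_inv (1, b).
  split => //=; first by rewrite b_ge0 lexx.
    by rewrite mul1r.
  left; rewrite subrr; split; first exact: ideal0.
  by rewrite (qn0 id0) !mulr_ge0// ?ltW ?phi_gt0.
pose S := {s | chain_inv s}.
have [f [f0 fS]] : exists f : nat -> S, sval (f 0%N) = (1, b) /\
    forall n, chain_rel (sval (f n)) (sval (f n.+1)).
  have nxt (s : S) : exists s' : S, chain_rel (sval s) (sval s').
    case: s => s si; have [s' [s'i ss']] := chain_next si.
    by exists (exist _ s' s'i).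
  have [f [f0 fS]] := dependent_choice (fun s => cid (nxt s)) (exist _ _ inv0).
  by exists f; rewrite f0.
pose t n := (sval (f n)).1; pose c n := (sval (f n)).2.
have fi n : chain_inv (sval (f n)) by exact: svalP.
exists t, c; split.
- by rewrite /c f0.
- move=> k; have [? ? _ _ _] := fi k; have [_ _ /andP[? _] _ _] := fi k.+1.
  by have [? ? _ _] := fS k; split => //; apply/andP.
- by move=> k; have [] := fi k.
- by move=> k u; have [_ _ + _] := fS k; exact.
move=> e e0; have [[N cN0]|ncN] := pselect (exists N, c N = 0).
  by exists N; rewrite cN0 (qn0 id1).
have grow n : 2 ^+ n * phi (t 0%N) <= phi (t n).
  elim: n => [|n IH]; first by rewrite expr0 mul1r.
  rewrite exprS -mulrA; have [_ _ _ [cn0|]] := fS n.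
    by case: ncN; exists n.+1.
  by apply: le_trans; rewrite ler_pM2l.
have [T T1 phiT] := slope0 (e / 2) (divr_gt0 e0 (ltr0Sn _ _)).
have T0 : 0 < T := lt_le_trans ltr01 T1.
have p0 : 0 < phi (t 0%N) by rewrite /t f0; exact: phi_gt0.
have [n nP] : exists n, phi T < 2 ^+ n * phi (t 0%N).
  exists (Num.truncn (phi T / phi (t 0%N))).+1; rewrite -ltr_pdivrMr//.
  apply: lt_le_trans (truncnS_gt _) _.
  by rewrite -natrX ler_nat ltnW// ltn_expl.
exists n; have [/= tn1 X1cn _ tcn _] := fi n.
have pTn := lt_le_trans nP (grow n).
have Ttn : T <= t n.
  rewrite leNgt; apply/negP => /ltW tnT.
  have [] := qc (lt_le_trans ltr01 tn1) tnT; rewrite -/(t n); lra.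
have tn0 := lt_le_trans T0 Ttn.
rewrite -(ltr_pM2l tn0); apply: (le_lt_trans tcn); rewrite -/(t n).
have [_ _ sl] := qc T0 Ttn; rewrite -(ltr_pM2l T0).
nra.
Qed.

End chain.

(** * Distributing the pieces of the chain *)

Section half_division.
Context {R : realType} {V : vectorLatticeType R}.
Context {X0 X1 : qnspace V} (id0 : qn_ideal X0) (id1 : qn_ideal X1).
Context (comp1 : qn_complete X1).
Context {C : R} (C0 : qn_const X0 C) (C1 : qn_const X1 C).
Local Notation K := (Kfun X0 X1).
Local Notation Sg := (Sigma X0 X1).
Context {phi : R -> R} (qc : quasiconcave phi)
  (phi_gt0 : forall t : R, 0 < t -> 0 < phi t).
Context {I : finType} {psi : I -> R -> R} {m : nat}
  (qc_psi : forall i, quasiconcave (psi i))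
  (cover : forall t : R, 0 < t -> (m <= #|[pred i | (phi t <= psi i t)%R]|)%N).

Let C_ge1 : 1 <= C. Proof. by case: C0. Qed.
Let C_gt0 : 0 < C. Proof. exact: lt_le_trans C_ge1. Qed.

Let psi_ge0 i t : 0 < t -> 0 <= psi i t.
Proof. by move=> t0; have [] := qc_psi i t0 (lexx t). Qed.

(** The piece [c k - c k.+1] goes to the indices [i] with
    phi(t k) <= psi i (t k), at least [m] in number, whence [m b <= sum y]. The
    sum received by [i] may be infinite; it converges in X1 because its tails
    lie below the remainders. *)
Lemma division_vanishing_slope (b : V) : X1 b -> 0 <= b ->
  qnorm X1 b <= 2 * phi 1 -> (forall t : R, 1 <= t -> K t b <= phi t) ->
  (forall e : R, 0 < e -> exists2 T, 1 <= T & phi T < e * T) ->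
  exists y : I -> V, [/\ (forall i, 0 <= y i <= b),
    (forall i (t : R), 0 < t -> K t (y i) <= 18 * C ^+ 4 * psi i t)
    & m%:R *: b <= \sum_i y i].
Proof.
move=> X1b b0 bn Kb slope0.
have [t [c [c0 tc tcn aK cN]]] :=
  greedy_chain id0 id1 C0 qc phi_gt0 X1b b0 bn Kb slope0.
have t0 k : 0 < t k by have [t1 _ _ _] := tc k; exact: lt_le_trans ltr01 t1.
have X1c k : X1 (c k) by have [] := tc k.
have cdec k : c k.+1 <= c k by have [_ _ _ /andP[]] := tc k.
have cge0 k : 0 <= c k.
  by case: k => [|k]; [rewrite c0|have [_ _ _ /andP[]] := tc k].
pose y k := c k - c k.+1.
have y0 k : 0 <= y k by rewrite vsubr_ge0.
have X1y k : X1 (y k) by exact: idealB.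
have sumy n p : (n <= p)%N -> \sum_(n <= k < p) y k = c n - c p.
  move=> np; rewrite -[c n - c p]opprB -(telescope_sumr c np) -sumrN.
  by apply: eq_bigr => k _; rewrite opprB.
pose good i k := phi (t k) <= psi i (t k).
pose S i n := \sum_(0 <= k < n | good i k) y k.
have subsum n p (P Q : pred nat) : (forall k, P k -> Q k) ->
    \sum_(n <= k < p | P k) y k <= \sum_(n <= k < p | Q k) y k.
  move=> PQ; rewrite [leRHS](bigID P)/=.
  rewrite (eq_bigl P) => [|k]; last by rewrite andbC;
    case: (P k) (PQ k) => // ->.
  by apply/vlerDl/vsum_ge0 => k _.
have subsumT n p (P : pred nat) : (n <= p)%N ->
    0 <= \sum_(n <= k < p | P k) y k <= c n - c p.
  by move=> np; rewrite vsum_ge0//= -sumy//; exact: (subsum n p P xpredT).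
have X1S n p P : X1 (\sum_(n <= k < p | P k) y k) by exact: ideal_sum.
have X1Si i n : X1 (S i n) by exact: X1S.
have SB i n p : (n <= p)%N -> 0 <= S i p - S i n <= c n.
  move=> np; rewrite /S (big_cat_nat (leq0n n) np)/= addrAC subrr add0r.
  have /andP[-> le] := subsumT n p (good i) np.
  by apply: le_trans le _; exact: vlerBl.
have Sb i n : 0 <= S i n <= b.
  have /andP[-> le] := subsumT 0%N n (good i) (leq0n n).
  by apply: le_trans le _; rewrite c0; exact: vlerBl.
have smallc e : (0 : R) < e -> exists N, forall n, (N <= n)%N -> qnorm X1 (c n)
  < e.
  move=> /cN[N cNe]; exists N; elim=> [|n IH].
    by rewrite leqn0 => /eqP <-.
  rewrite leq_eqVlt => /orP[/eqP <- //|/IH]; apply: le_lt_trans.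
  exact: qn_le.
have cauchyS i (e : R) : (0 : R) < e -> exists N : nat, forall p n :
  nat, (N <= p)%N ->
    (N <= n)%N -> qnorm X1 (S i p - S i n) < e.
  move=> /smallc[N cNe]; exists N => p n Np Nn.
  have [np|/ltnW pn] := leqP n p.
    apply: le_lt_trans (cNe n Nn); have /andP[? ?] := SB i n p np; exact: qn_le.
  rewrite -(qnN id1); last by apply: idealB.
  rewrite opprB; apply: le_lt_trans (cNe p Np).
  by have /andP[? ?] := SB i p n pn; exact: qn_le.
have /choice[Y YP] : forall i, exists Y, X1 Y /\ forall e : R, 0 < e ->
    exists N, forall n, (N <= n)%N -> qnorm X1 (Y - S i n) < e.
  move=> i; have [Y X1Y SY] := comp1 (fun n => X1S 0%N n (good i)) (@cauchyS i).
  exists Y; split => // e e0; move/cvgrPdist_lt/(_ e e0) : SY => [N _ NP].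
  exists N => n /NP/=; rewrite sub0r normrN ger0_norm; last exact/qn_ge0/idealB.
  by rewrite -(qnN id1) ?opprB//; apply: idealB.
have X1Y i : X1 (Y i) by case: (YP i).
have limY i e : (0 : R) < e -> exists N, forall n, (N <= n)%N -> qnorm X1 (Y i
  - S i n) < e.
  by case: (YP i) => _; exact.
have SY i n : S i n <= Y i.
  rewrite -vsubr_ge0 -vlerN opprB oppr0; apply: (le0_of_small id1) => e e0.
  have [N NP] := limY i e e0; exists (Y i - S i (maxn N n)); split.
  - exact: idealB.
  - by apply: NP; rewrite leq_maxl.
  - rewrite -vabsN opprB; apply: le_trans (ler_vabs _).
    by apply: vl_leD2r; rewrite -vsubr_ge0; have /andP[] :=
      SB i n _ (leq_maxr N n).
have Yb i : Y i <= b.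
  rewrite -vsubr_ge0 -vlerN opprB oppr0; apply: (le0_of_small id1) => e e0.
  have [N NP] := limY i e e0; exists (Y i - S i N); split.
  - exact: idealB.
  - exact: NP.
  - apply: le_trans (ler_vabs _); apply: vleD => //.
    by rewrite vlerN; have /andP[] := Sb i N.
have SgX1 x : X1 x -> Sg x by exact: sigma1.
(* Pieces at scales up to s: the last one in the sum is the (n+1)-st step of the
   chain, so the whole sum lies below b - c n.+1. *)
have below i s n : 0 < s ->
    K s (\sum_(0 <= k < n | good i k && (t k <= s)) y k) <= 16 * C ^+ 2 * psi i
      s.
  move=> s0; have C2 : 0 < 16 * C ^+ 2 by rewrite mulr_gt0// exprn_gt0.
  elim: n => [|n IH].
    by rewrite big_geq// (K_zero id0 id1 s0) mulr_ge0 ?psi_ge0// ltW.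
  rewrite big_mkcond big_nat_recr//= -big_mkcond/=.
  case: ifPn => [/andP[gn tn]|_]; last by rewrite addr0.
  apply: (@le_trans _ _ (K s (b - c n.+1))).
    apply: (K_pos_le id0 id1 s0).
    - by rewrite vaddr_ge0//; apply: vsum_ge0.
    - by rewrite -c0 -sumy// big_nat_recr//=; apply: vl_leD2r; exact: subsum.
    - by apply/SgX1/idealB.
  apply: (le_trans (aK _ _ tn)); rewrite ler_pM2l//; apply: le_trans gn _.
  by have [] := qc_psi i (t0 n) tn.
(* Pieces at scales beyond s: if the first one in the sum is the n-th, the whole
   sum lies below the remainder c n. *)
have above i s p n : 0 < s ->
    K s (\sum_(n <= k < n + p | good i k && (s < t k)) y k) <= 2 * psi i s.
  move=> s0; elim: p n => [|p IH] n.
    by rewrite addn0 big_geq// (K_zero id0 id1 s0) mulr_ge0 ?psi_ge0.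
  rewrite big_ltn_cond ?addnS ?ltnS ?leq_addr// -addSn.
  case: ifPn => [/andP[gn tn]|_]; last exact: IH.
  apply: (@le_trans _ _ (K s (c n))).
    apply: (K_pos_le id0 id1 s0); last exact: SgX1.
      by rewrite vaddr_ge0//; apply: vsum_ge0.
    have /andP[_] := subsumT n.+1 (n.+1 + p)%N (fun k =>
      good i k && (s < t k)) (leq_addr _ _).
    move=> /(vleD (lexx (y n))) /le_trans; apply.
    by rewrite /y addrA subrK; exact: vlerBl.
  apply: (le_trans (K_le1 id0 id1 s0 (X1c n))).
  have [_ _ sl] := qc_psi i s0 (ltW tn).
  have cpsi : t n * qnorm X1 (c n) <= 2 * psi i (t n).
    by apply: (le_trans (tcn n)); rewrite ler_pM2l.
  rewrite -(ler_pM2l (t0 n)); have := ler_wpM2l (ltW s0) cpsi; lra.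
have KS i s n : 0 < s -> K s (S i n) <= 18 * C ^+ 3 * psi i s.
  move=> s0; rewrite /S (bigID (fun k => t k <= s))/=.
  apply: (le_trans (K_add id0 id1 C0 C1 s0 _ _)); [exact: SgX1|exact: SgX1|].
  have B := below i s n s0.
  have A := above i s n 0%N s0; rewrite add0n in A.
  under [X in C * (_ + K s X)]eq_bigl => k do rewrite -ltNge.
  have p0 := psi_ge0 i s0; have CC := C_ge1.
  have -> : 18 * C ^+ 3 * psi i s = C * (18 * C ^+ 2 * psi i s) by ring.
  rewrite ler_pM2l//; apply: le_trans (lerD B A) _.
  have C2 : 1 <= C ^+ 2 by rewrite exprn_ege1.
  have := ler_wpM2r p0 C2; lra.
exists Y; split.
- by move=> i; rewrite Yb andbT; apply: le_trans (SY i 0%N); rewrite /S big_geq.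
- move=> i s s0; have p0 := psi_ge0 i s0; have CC := C_ge1.
  apply/ler_addgt0Pr => e e0.
  have [N /(_ N (leqnn N)) NP] :=
    limY i (e / (C * s)) (divr_gt0 e0 (mulr_gt0 C_gt0 s0)).
  have -> : Y i = S i N + (Y i - S i N) by rewrite addrC subrK.
  apply: (le_trans (K_add id0 id1 C0 C1 s0 _ _)); [exact/SgX1/X1S| |].
    by apply/SgX1/idealB.
  have K1 : K s (Y i - S i N) <= e / C.
    apply: (le_trans (K_le1 id0 id1 s0 (idealB id1 (X1Y i) (X1S _ _ _)))).
    rewrite -ler_pdivlMl//; apply: (le_trans (ltW NP)).
    by rewrite invfM mulrA mulrC.
  apply: le_trans (ler_wpM2l (ltW C_gt0) (lerD (KS i s N s0) K1)) _.
  rewrite mulrDr [C * (e / C)]mulrC divfK ?gt_eqF// lerD2r.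
  have := mulr_ge0 (exprn_ge0 4 (ltW C_gt0)) p0; lra.
- rewrite -vsubr_ge0 -vlerN opprB oppr0; apply: (le0_of_small id1) => e e0.
  have m0 : 0 < m%:R + 1 :> R by rewrite ltr_wpDl.
  have [N cNe] := cN (e / (m%:R + 1)) (divr_gt0 e0 m0).
  exists (m%:R *: c N); split.
  + exact: idealZ.
  + rewrite (qnZ id1)// ger0_norm//; rewrite ltr_pdivlMr// in cNe.
    have := qn_ge0 id1 (X1c N); have : 0 <= m%:R :> R by []; nra.
  + apply: le_trans (ler_vabs _); rewrite vlerBlDr addrC -vlerBlDr -scalerBr.
    apply: (@le_trans _ _ (\sum_i S i N)); last exact: vsum_le.
    rewrite -c0 -sumy// /S.
    under [leRHS]eq_bigr do rewrite big_mkcond.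
    rewrite exchange_big/= scaler_sumr; apply: vsum_le => k _.
    rewrite -big_mkcond sumr_const -[leRHS]scaler_nat.
    by apply: vscale_lel => //; rewrite ler_nat; exact: cover.
Qed.

End half_division.

(** * K-divisibility in lattice couples *)

Section divisibility.
Context {R : realType} {V : vectorLatticeType R}.

(** If phi(t) / t decreases to a limit d > 0, the greedy chain leaves a remainder
    of X1-norm about d that belongs to no finite scale. It is split off first, at
    a scale where phi(t) / t <= 2 d, and given to the indices that dominate phi
    at arbitrarily large scales. By finiteness of [I] there are at least [m] of
    these, and psi i (t) >= d t for each of them. What is left is dominated by the
    truncation of phi, whose slope vanishes at infinity. *)
Lemma division_in_X1 (X0 X1 : qnspace V) (C : R) (phi : R -> R)
    (I : finType) (psi : I -> R -> R) (m : nat) (b : V) :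
  qn_ideal X0 -> qn_ideal X1 -> qn_complete X1 -> qn_const X0 C ->
  qn_const X1 C -> quasiconcave phi -> (forall t : R, 0 < t -> 0 < phi t) ->
  (forall i, quasiconcave (psi i)) ->
  (forall t : R, 0 < t -> (m <= #|[pred i | (phi t <= psi i t)%R]|)%N) ->
  X1 b -> 0 <= b -> qnorm X1 b <= 2 * phi 1 ->
  (forall t : R, 1 <= t -> Kfun X0 X1 t b <= phi t) ->
  exists y : I -> V, [/\ (forall i, 0 <= y i <= b),
    (forall i (t : R), 0 < t -> Kfun X0 X1 t (y i) <= 22 * C ^+ 5 * psi i t)
    & m%:R *: b <= \sum_i y i].
Proof.
move=> id0 id1 comp1 C0 C1 qc phi_gt0 qc_psi cover X1b b0 bn Kb.
have C_ge1 : 1 <= C by case: C0.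
have C_gt0 : 0 < C := lt_le_trans ltr01 C_ge1.
have psi_ge0 i (t : R) : 0 < t -> 0 <= psi i t.
  by move=> t0; have [] := qc_psi i _ _ t0 (lexx t).
have C4_ge1 : 1 <= C ^+ 4 by rewrite exprn_ege1.
have [slope0|slope] :=
    pselect (forall e : R, 0 < e -> exists2 T, 1 <= T & phi T < e * T).
  have [y [y0 Ky my]] := division_vanishing_slope id0 id1 comp1 C0 C1 qc
    phi_gt0 qc_psi cover X1b b0 bn Kb slope0.
  exists y; split => // i t t0; apply: (le_trans (Ky i t t0)).
  rewrite ler_wpM2r ?psi_ge0// exprS; nra.
have [c c0 cP] : exists2 c, 0 < c & forall T, 1 <= T -> c * T <= phi T.
  apply: contra_notP slope => nc e e0; apply: contra_notP nc => nT.
  exists e => // T T1; rewrite leNgt; apply/negP => lt; apply: nT.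
  by exists T.
pose D := [set phi T / T | T in [set T | 1 <= T]].
have Dlb : lbound D c.
  move=> _ [T /= T1 <-]; rewrite ler_pdivlMr ?cP//; exact: lt_le_trans T1.
have D0 : D !=set0 by exists (phi 1 / 1), 1 => /=.
pose d := inf D; have cd : c <= d by exact: lb_le_inf.
have d0 : 0 < d := lt_le_trans c0 cd.
have dP T : 1 <= T -> d * T <= phi T.
  move=> T1; rewrite -ler_pdivlMr ?(lt_le_trans ltr01 T1)//.
  by apply: ge_inf; [exists c|exists T].
have [_ [T /= T1 <-] Td] := inf_adherent d0 (conj D0 (ex_intro _ c Dlb)).
have T0 : 0 < T := lt_le_trans ltr01 T1.
move: Td; rewrite -/d ltr_pdivrMr// => Td.
have pT0 := phi_gt0 T T0.
have [b' [b'' [X0b' X1b'' [b'0 b''0] bE b'n]]] :=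
  K_split id0 id1 T0 b0 (sigma1 id0 X1b) pT0.
have KTb := Kb T T1.
have b'n0 := qn_ge0 id0 X0b'; have b''n0 := qn_ge0 id1 X1b''.
have b'b : b' <= b by rewrite bE; exact: vlerDl.
have X1b' : X1 b' by exact: ideal_le b'b X1b.
pose phi' t := Num.min (phi t) (2 * phi T).
have qc' : quasiconcave phi' by apply: quasiconcave_min => //; lra.
have phi'_gt0 (t : R) : 0 < t -> 0 < phi' t.
  by move=> t0; rewrite lt_min phi_gt0//; lra.
have cover' (t : R) : 0 < t -> (m <= #|[pred i | (phi' t <= psi i t)%R]|)%N.
  move=> t0; apply: leq_trans (cover t t0) _; apply: subset_leq_card.
  by apply/fintype.subsetP => i; rewrite !inE ge_min => ->.
have b'n' : qnorm X1 b' <= 2 * phi' 1.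
  apply: (le_trans (qn_le id1 b'0 b'b X1b)); apply: (le_trans bn).
  rewrite ler_pM2l// le_min lexx/=.
  have [_ p1T _] := qc 1 T ltr01 T1; lra.
have Kb' (t : R) : 1 <= t -> Kfun X0 X1 t b' <= phi' t.
  move=> t1; have t0 : 0 < t := lt_le_trans ltr01 t1.
  rewrite le_min; apply/andP; split.
    by apply: le_trans (Kb t t1); exact: (K_pos_le id0 id1 t0 b'0 b'b (sigma1
      id0 X1b)).
  by apply: (le_trans (K_le0 id0 id1 t0 X0b')); nra.
have slope0 (e : R) : 0 < e -> exists2 S, 1 <= S & phi' S < e * S.
  move=> e0; exists (Num.max 1 (2 * phi T / e + 1));
    first by rewrite le_max lexx.
  rewrite gt_min; apply/orP; right.
  apply: (@lt_le_trans _ _ (e * (2 * phi T / e + 1))).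
    by rewrite mulrDr mulr1 [e * (_ / e)]mulrC divfK ?gt_eqF//; lra.
  by rewrite ler_pM2l// le_max lexx orbT.
have [y [yb Ky my]] := division_vanishing_slope id0 id1 comp1 C0 C1 qc'
  phi'_gt0 qc_psi cover' X1b' b'0 b'n' Kb' slope0.
pose frequent i := `[< forall s : R, exists2 t, s <= t & phi t <= psi i t >].
(* Beyond the largest of the last scales s i of the other indices, only frequent
   indices dominate phi. *)
have card_frequent : (m <= #|[pred i | frequent i]|)%N.
  have /choice[s sP] i : exists s : R, ~~ frequent i ->
      forall t, s <= t -> psi i t < phi t.
    have [fi|/asboolPn nfi] := boolP (frequent i); first by exists 0.
    have [s sP] : exists s : R, forall t, s <= t -> psi i t < phi t.
      apply: contra_notP nfi => ns s; apply: contra_notP ns => nt.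
      exists s => t st; rewrite ltNge; apply/negP => le; apply: nt.
      by exists t.
    by exists s.
  pose s1 := \big[Num.max/1]_i s i.
  have s10 : 0 < s1.
    by apply: (@lt_le_trans _ _ 1) => //; exact: bigmax_ge_id.
  apply: leq_trans (cover s1 s10) _; apply: subset_leq_card.
  apply/fintype.subsetP => i; rewrite !inE => pi; have [fi|/sP lt] :=
    boolP (frequent i); first by move/asboolP: fi.
  by have := lt s1 (le_bigmax _ _ i); rewrite ltNge pi.
pose z i := if frequent i then b'' else 0.
have zb i : 0 <= z i <= b'' by rewrite /z; case: ifP; rewrite ?lexx ?b''0.
have Kz i (t : R) : 0 < t -> Kfun X0 X1 t (z i) <= 4 * psi i t.
  move=> t0; rewrite /z; case: ifPn => [/asboolP fi|_]; last first.
    by rewrite (K_zero id0 id1 t0) mulr_ge0 ?psi_ge0.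
  apply: (le_trans (K_le1 id0 id1 t0 X1b'')).
  have [u tu pu] := fi (Num.max t 1).
  have [ut u1] : t <= u /\ 1 <= u.
    by split; apply: le_trans tu; rewrite le_max lexx ?orbT.
  have u0 := lt_le_trans t0 ut; have [_ _ sl] := qc_psi i t u t0 ut.
  have bd : qnorm X1 b'' <= 4 * d by rewrite -(ler_pM2l T0); nra.
  have dpsi : d * t <= psi i t.
    rewrite -(ler_pM2l u0); have := dP u u1 => H1.
    have : t * (d * u) <= t * psi i u by rewrite ler_pM2l// (le_trans H1).
    lra.
  apply: (@le_trans _ _ (t * (4 * d))); first by rewrite ler_pM2l.
  lra.
have sy i : Sigma X0 X1 (y i).
  have /andP[? ?] := yb i; apply: (sigma1 id0); exact: ideal_le X1b'.
have sz i : Sigma X0 X1 (z i).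
  have /andP[? ?] := zb i; apply: (sigma1 id0); exact: ideal_le X1b''.
exists (fun i => y i + z i); split.
- move=> i; have /andP[? ?] := yb i; have /andP[? ?] := zb i.
  by rewrite vaddr_ge0//= bE; exact: vleD.
- move=> i t t0; apply: (le_trans (K_add id0 id1 C0 C1 t0 (sy i) (sz i))).
  have p0 := psi_ge0 i t t0.
  have := ler_wpM2l (ltW C_gt0) (lerD (Ky i t t0) (Kz i t t0)).
  move=> /le_trans; apply.
  have -> : 22 * C ^+ 5 * psi i t = C * (22 * C ^+ 4 * psi i t) by ring.
  rewrite ler_pM2l//; have := ler_wpM2r p0 C4_ge1; lra.
- rewrite bE scalerDr big_split/=; apply: vleD => //.
  rewrite /z -big_mkcond/= sumr_const -[leRHS]scaler_nat.
  by apply: vscale_lel => //; rewrite ler_nat.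
Qed.

(** The X1-part of y is divided directly and the X0-part through the exchanged
    couple, for which the functions become t |-> t phi(1/t). *)
Theorem K_divisibility (X0 X1 : qnspace V) (C : R) (phi : R -> R)
    (I : finType) (psi : I -> R -> R) (m : nat) (y : V) :
  qn_ideal X0 -> qn_ideal X1 -> qn_complete X0 -> qn_complete X1 ->
  qn_const X0 C -> qn_const X1 C ->
  (forall x, Sigma X0 X1 x -> Kfun X0 X1 1 x = 0 -> x = 0) ->
  quasiconcave phi -> (forall i, quasiconcave (psi i)) ->
  (forall t : R, 0 < t -> (m <= #|[pred i | (phi t <= psi i t)%R]|)%N) ->
  Sigma X0 X1 y -> 0 <= y -> (forall t : R, 0 < t -> Kfun X0 X1 t y <= phi t) ->
  exists z : I -> V, [/\ (forall i, 0 <= z i <= y),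
    (forall i (t : R), 0 < t -> Kfun X0 X1 t (z i) <= 44 * C ^+ 6 * psi i t)
    & m%:R *: y <= \sum_i z i].
Proof.
move=> id0 id1 comp0 comp1 C0 C1 K1_eq0 qc qc_psi cover Sy y0 Ky.
have C_ge1 : 1 <= C by case: C0.
have C_gt0 : 0 < C := lt_le_trans ltr01 C_ge1.
have psi_ge0 i (t : R) : 0 < t -> 0 <= psi i t.
  by move=> t0; have [] := qc_psi i _ _ t0 (lexx t).
have [[t t0 pt]|phi_pos] := pselect (exists2 t, 0 < t & phi t <= 0).
  have Kt0 : Kfun X0 X1 t y <= 0 := le_trans (Ky t t0) pt.
  have -> : y = 0.
    apply: K1_eq0 => //; apply/eqP; rewrite eq_le K_ge0// andbT.
    have [t1|t1] := leP 1 t.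
      exact: le_trans (K_nondecreasing id0 id1 ltr01 t1 Sy) Kt0.
    have := K_slope id0 id1 t0 (ltW t1) Sy; rewrite mul1r => /le_trans/(_ Kt0).
    by rewrite pmulr_rle0.
  exists (fun=> 0); split; first by rewrite lexx.
    move=> i s s0; rewrite (K_zero id0 id1 s0) mulr_ge0 ?psi_ge0//.
    by rewrite mulr_ge0// exprn_ge0// ltW.
  by rewrite scaler0 big1.
have phi_gt0 (t : R) : 0 < t -> 0 < phi t.
  by move=> t0; rewrite ltNge; apply/negP => pt; apply: phi_pos; exists t.
have p1 := phi_gt0 1 ltr01.
have [a [b [X0a X1b [a0 b0] yE ab]]] := K_split id0 id1 ltr01 y0 Sy p1.
have an := qn_ge0 id0 X0a; have bn := qn_ge0 id1 X1b; have Ky1 := Ky 1 ltr01.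
rewrite mul1r in ab.
have ay : a <= y by rewrite yE; exact: vlerDl.
have by_ : b <= y by rewrite yE addrC; exact: vlerDl.
have [u [ub Ku mu]] : exists u : I -> V, [/\ (forall i, 0 <= u i <= b),
    (forall i (t : R), 0 < t -> Kfun X0 X1 t (u i) <= 22 * C ^+ 5 * psi i t)
    & m%:R *: b <= \sum_i u i].
  apply: (division_in_X1 id0 id1 comp1 C0 C1 qc phi_gt0 qc_psi cover X1b b0).
    lra.
  move=> t t1; have t0 : 0 < t := lt_le_trans ltr01 t1.
  exact: le_trans (K_pos_le id0 id1 t0 b0 by_ Sy) (Ky t t0).
pose phi' t := t * phi t^-1; pose psi' i t := t * psi i t^-1.
have [w [wb Kw mw]] : exists w : I -> V, [/\ (forall i, 0 <= w i <= a),
    (forall i (t : R), 0 < t -> Kfun X1 X0 t (w i) <= 22 * C ^+ 5 * psi' i t)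
    & m%:R *: a <= \sum_i w i].
  apply: (division_in_X1 id1 id0 comp0 C1 C0 (phi := phi')) => //.
  - exact: quasiconcave_swap.
  - by move=> t t0; rewrite mulr_gt0// phi_gt0// invr_gt0.
  - by move=> i; exact: quasiconcave_swap.
  - move=> t t0; apply: leq_trans (cover t^-1 _) _; first by rewrite invr_gt0.
    apply: subset_leq_card; apply/fintype.subsetP => i; rewrite !inE.
    by rewrite /phi' /psi' ler_pM2l.
  - by rewrite /phi' invr1 mul1r; lra.
  - move=> t t1; have t0 : 0 < t := lt_le_trans ltr01 t1.
    have [_ ->] := K_swap t0 id0 id1 (sigma0 id1 X0a).
    rewrite ler_pM2l//; have tV0 : 0 < t^-1 by rewrite invr_gt0.
    exact: le_trans (K_pos_le id0 id1 tV0 a0 ay Sy) (Ky _ tV0).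
have su i : Sigma X0 X1 (u i).
  have /andP[? ?] := ub i; apply: (sigma1 id0); exact: ideal_le X1b.
have sw i : Sigma X0 X1 (w i).
  have /andP[? ?] := wb i; apply: (sigma0 id1); exact: ideal_le X0a.
exists (fun i => w i + u i); split.
- move=> i; have /andP[? ?] := ub i; have /andP[? ?] := wb i.
  by rewrite vaddr_ge0//= yE; exact: vleD.
- move=> i t t0; have tV0 : 0 < t^-1 by rewrite invr_gt0.
  have := Kw i _ tV0; have [_ ->] := K_swap tV0 id0 id1 (sw i).
  rewrite /psi' invrK mulrCA ler_pM2l// => Kwt.
  apply: (le_trans (K_add id0 id1 C0 C1 t0 (sw i) (su i))).
  have := ler_wpM2l (ltW C_gt0) (lerD Kwt (Ku i t t0)).
  move=> /le_trans; apply; rewrite le_eqVlt; apply/orP; left; apply/eqP; ring.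
- by rewrite yE scalerDr big_split/=; exact: vleD.
Qed.

End divisibility.

(** * Functions on the half-line and their concave majorants *)

Section half_line_ae.
Context {R : realType}.
Implicit Types P Q S : R -> Prop.

(** The almost everywhere quantifier over (0, +oo); the combination rules below
    make the positivity of t available, as it always holds almost everywhere. *)
Definition hae P := {ae half_line_measure R, forall t, P t}.

Lemma hae_pos P : (forall t, 0 < t -> P t) -> hae P.
Proof. exact: half_line_ae. Qed.

Lemma hae2 P Q S : hae P -> hae Q ->
  (forall t, 0 < t -> P t -> Q t -> S t) -> hae S.
Proof.
move=> hP hQ PQS; have hT := @hae_pos (fun t => 0 < t) (fun t => id).
have F : Filter (almost_everywhere (half_line_measure R)).
  exact: ae_filter_ringOfSetsType.
exact: (@filterS3 _ _ F _ _ _ _ PQS hT hP hQ).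
Qed.

Lemma hae1 P Q : hae P -> (forall t, 0 < t -> P t -> Q t) -> hae Q.
Proof. by move=> hP PQ; apply: (hae2 hP hP) => t t0 Pt _; exact: PQ. Qed.

Lemma hae3 P Q S T : hae P -> hae Q -> hae S ->
  (forall t, 0 < t -> P t -> Q t -> S t -> T t) -> hae T.
Proof.
move=> hP hQ hS H; have PQ : hae (fun t => P t /\ Q t) by exact: hae2 hP hQ _.
by apply: (hae2 PQ hS) => t t0 [Pt Qt]; exact: H.
Qed.

Lemma hae_forall (P : nat -> R -> Prop) : (forall n, hae (P n)) ->
  hae (fun t => forall n, P n t).
Proof. exact: ae_foralln. Qed.

End half_line_ae.

Notation "{ 'hae' t , P }" := (hae (fun t => P))
  (at level 0, t name, P at level 200, format "{ 'hae'  t ,  P }").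

Section half_line_facts.
Context {R : realType}.
Local Notation mu := (half_line_measure R).
Local Notation L := (L0_half_line R).
Implicit Types (f g h : L) (a b s t : R).

(** Turns almost everywhere statements about quasiconcave functions into
    pointwise ones, up to the factor 2. *)
Lemma half_line_meets (P : R -> Prop) s : 0 < s ->
  {hae t, P t} -> exists t, s <= t <= 2 * s /\ P t.
Proof.
move=> s0 [N [mN muN NP]]; apply: contrapT => nP.
pose J := `[s, 2 * s]%classic; have sub : J `<=` N `&` `]0, +oo[%classic.
  move=> t; rewrite /J set_itvE/= => /andP[st t2s]; split.
    by apply: NP => /= Pt; apply: nP; exists t; rewrite st t2s.
  by rewrite /= in_itv/= andbT (lt_le_trans s0 st).
have : (@lebesgue_measure R J <= 0)%E.
  have muN' : lebesgue_measure (N `&` `]0, +oo[%classic) = 0%E := muN.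
  rewrite -muN'; apply: (le_measure (@lebesgue_measure R) _ _ sub); rewrite inE.
    exact: measurable_itv.
  by apply: measurableI => //; exact: measurable_itv.
rewrite /J lebesgue_measure_itv/= lte_fin ltr_pMl// ltr1n -EFinD lee_fin.
lra.
Qed.

Lemma half_line_measure_gt0 : (0 < mu setT)%E.
Proof.
rewrite lt0e measure_ge0 andbT; apply/eqP => mu0.
have [|t [_ []]] := @half_line_meets (fun=> False) 1 ltr01.
by exists setT; split => //.
Qed.

Lemma L0_exists (g : R -> R) : measurable_fun [set: measurableTypeR R] g ->
  exists f : L, {hae t, f t = g t}.
Proof.
move=> mg; pose G : {mfun measurableTypeR R >-> R} :=
  @mfun_Sub _ _ (measurableTypeR R) _ g (mem_set mg).
by exists (L0_class mu G); exact: (L0_classE mu G).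
Qed.

Lemma L0_measurable f : measurable_fun [set: measurableTypeR R] (f : R -> R).
Proof. exact: (measurable_funP (L0_repr f)). Qed.

Lemma L0_ext f g : {hae t, f t = g t} -> f = g.
Proof. exact: L0P. Qed.

Lemma hae_0 : {hae t, (0 : L) t = 0}.
Proof. exact: (L0_0E mu). Qed.

Lemma hae_join f g : {hae t, (vjoin f g : L) t = Num.max (f t) (g t)}.
Proof. exact: L0_joinE. Qed.

Lemma hae_opp f : {hae t, (- f : L) t = - f t}.
Proof. exact: L0_oppE. Qed.

Lemma hae_add f g : {hae t, (f + g : L) t = f t + g t}.
Proof. exact: L0_addE. Qed.

Lemma hae_scale a f : {hae t, (a *: f : L) t = a * f t}.
Proof. exact: L0_scaleE. Qed.

Lemma hae_le f g : f <= g <-> {hae t, f t <= g t}.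
Proof. by split => [/L0_leP|H]; [exact|apply/L0_leP]. Qed.

Lemma L0_eq0 f : {hae t, f t = 0} -> f = 0.
Proof.
move=> f0; apply: L0_ext; apply: (hae2 f0 hae_0) => t _ -> ->//.
Qed.

Lemma hae_vabs f : {hae t, (vabs f : L) t = `|f t|}.
Proof.
apply: (hae2 (hae_join f (- f)) (hae_opp f)) => t _ + Nf.
by rewrite Nf => ->; rewrite maxrN.
Qed.

Lemma L0_vabs_le f g : vabs f <= vabs g <-> {hae t, `|f t| <= `|g t|}.
Proof.
split=> [/hae_le H|H]; last apply/hae_le.
  by apply: (hae3 H (hae_vabs f) (hae_vabs g)) => t _ le <- <-.
by apply: (hae3 H (hae_vabs f) (hae_vabs g)) => t _ le E1 E2;
  rewrite -E1 -E2 in le.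
Qed.

Lemma hae_sub f g : {hae t, (f - g : L) t = f t - g t}.
Proof.
by apply: (hae2 (hae_add f (- g)) (hae_opp g)) => t _ -> ->.
Qed.

Let Lnorm_le (F : R -> R) a : 0 <= a -> {hae t, `|F t| <= a} ->
  (Lnorm mu +oo%E (fun t => (F t)%:E) <= a%:E)%E.
Proof.
move=> a0 Fa; rewrite unlock /Lnorm half_line_measure_gt0.
by apply/ess_supP; apply: (hae1 Fa) => t _; rewrite /= lee_fin.
Qed.

Let Lnorm_ae (F : R -> R) : (Lnorm mu +oo%E (fun t => (F t)%:E) < +oo)%E ->
  0 <= fine (Lnorm mu +oo%E (fun t => (F t)%:E)) /\
  {hae t, `|F t| <= fine (Lnorm mu +oo%E (fun t => (F t)%:E))}.
Proof.
move=> fin; have n0 := Lnorm_ge0 mu +oo%E (fun t => (F t)%:E).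
split; first exact: fine_ge0.
have H : {hae t, ((`|F t|)%:E <= Lnorm mu +oo%E (fun t => (F t)%:E))%E}.
  rewrite unlock /Lnorm half_line_measure_gt0.
  exact: (ess_sup_ge mu (abse \o (fun t => (F t)%:E))).
by apply: (hae1 H) => t _; rewrite -lee_fin fineK// ge0_fin_numE.
Qed.

Lemma Linfty_le f a : 0 <= a -> {hae t, `|f t| <= a} ->
  Linfty R f /\ qnorm (Linfty R) f <= a.
Proof.
move=> a0 /(Lnorm_le a0) le; split; first exact: le_lt_trans le (ltry _).
rewrite -lee_fin [leLHS]fineK// ge0_fin_numE ?Lnorm_ge0//.
exact: le_lt_trans le (ltry _).
Qed.

Lemma Linfty_ae f : Linfty R f -> 0 <= qnorm (Linfty R) f /\
  {hae t, `|f t| <= qnorm (Linfty R) f}.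
Proof. exact: Lnorm_ae. Qed.

Lemma Linfty_weighted_le f b : 0 <= b -> {hae t, `|f t| <= b * t} ->
  Linfty_weighted R f /\ qnorm (Linfty_weighted R) f <= b.
Proof.
move=> b0 fb; have fb' : {hae t, `|f t / t| <= b}.
  apply: (hae1 fb) => t t0 ft.
  by rewrite normrM normfV (gtr0_norm t0) ler_pdivrMr.
have le := Lnorm_le b0 fb'; split; first exact: le_lt_trans le (ltry _).
rewrite -lee_fin [leLHS]fineK// ge0_fin_numE ?Lnorm_ge0//.
exact: le_lt_trans le (ltry _).
Qed.

Lemma Linfty_weighted_ae f : Linfty_weighted R f ->
  0 <= qnorm (Linfty_weighted R) f /\
  {hae t, `|f t| <= qnorm (Linfty_weighted R) f * t}.
Proof.
move=> /Lnorm_ae[n0 H]; split => //.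
apply: (hae1 H) => t t0 +.
by rewrite normrM normfV (gtr0_norm t0) ler_pdivrMr.
Qed.

End half_line_facts.

Section affine_majorants.
Context {R : realType}.
Local Notation mu := (half_line_measure R).
Local Notation L := (L0_half_line R).
Implicit Types (f g h : L) (a b s t : R).

Definition affine_majorant f a b :=
  [/\ 0 <= a, 0 <= b & {hae s, `|f s| <= a + b * s}].

Definition affinely_bounded f := exists a b, affine_majorant f a b.

(** Taking the infimum of affine majorants, instead of a pointwise construction,
    yields at once a function that is defined everywhere, depends only on the
    class of f and is sublinear in f. *)
Definition concave_majorant f t :=
  inf [set p.1 + p.2 * t | p in [set p | affine_majorant f p.1 p.2]].

Local Notation "f ^^" := (concave_majorant f) (at level 2, format "f ^^").

Let lb f t : 0 < t -> lbound
  [set p.1 + p.2 * t | p in [set p | affine_majorant f p.1 p.2]] 0.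
Proof.
by move=> t0 _ [[a b] [/= a0 b0 _] <-]; rewrite addr_ge0// mulr_ge0// ltW.
Qed.

Let nonempty f t : affinely_bounded f ->
  [set p.1 + p.2 * t | p in [set p | affine_majorant f p.1 p.2]] !=set0.
Proof. by case=> a [b ab]; exists (a + b * t), (a, b). Qed.

Lemma concave_majorant_le f a b t : 0 < t -> affine_majorant f a b ->
  f^^ t <= a + b * t.
Proof.
move=> t0 ab; apply: ge_inf; first by exists 0; exact: lb.
by exists (a, b).
Qed.

Lemma le_concave_majorant f t c : affinely_bounded f ->
  (forall a b, affine_majorant f a b -> c <= a + b * t) -> c <= f^^ t.
Proof.
move=> bf H; apply: lb_le_inf; first exact: nonempty.
by move=> _ [[a b] /= ab <-]; exact: H.
Qed.

Lemma concave_majorant_ge0 f t : affinely_bounded f -> 0 < t -> 0 <= f^^ t.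
Proof.
move=> bf t0; apply: le_concave_majorant => // a b [a0 b0 _].
by rewrite addr_ge0// mulr_ge0// ltW.
Qed.

Lemma concave_majorant_approx f t e : affinely_bounded f -> 0 < t -> 0 < e ->
  exists a b, affine_majorant f a b /\ a + b * t < f^^ t + e.
Proof.
move=> bf t0 e0; have hi : has_inf
    [set p.1 + p.2 * t | p in [set p | affine_majorant f p.1 p.2]].
  by split; [exact: nonempty|exists 0; exact: lb].
by have [_ [[a b] /= ab <-] lt] := inf_adherent e0 hi; exists a, b.
Qed.

Lemma concave_majorant_qc f : affinely_bounded f -> quasiconcave f^^.
Proof.
move=> bf s t s0 st; have t0 := lt_le_trans s0 st; split.
- exact: concave_majorant_ge0.
- apply: le_concave_majorant => // a b ab; have [_ b0 _] := ab.
  by apply: le_trans (concave_majorant_le s0 ab) _; rewrite lerD2l ler_wpM2l.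
- rewrite -ler_pdivrMl//; apply: le_concave_majorant => // a b ab.
  have [a0 b0 _] := ab; rewrite ler_pdivrMl//.
  apply: (le_trans (ler_wpM2l (ltW s0) (concave_majorant_le t0 ab))); nra.
Qed.

Lemma affine_majorant_comp f g c a b : 0 <= c ->
  {hae s, `|g s| <= c * `|f s|} -> affine_majorant f a b ->
  affine_majorant g (c * a) (c * b).
Proof.
move=> c0 gf [a0 b0 fab]; split; rewrite ?mulr_ge0//.
apply: (hae2 gf fab) => s _ gfs fs; apply: (le_trans gfs).
by rewrite -mulrA -mulrDr ler_wpM2l.
Qed.

Lemma concave_majorant_comp f g c : 0 <= c -> affinely_bounded f ->
  {hae s, `|g s| <= c * `|f s|} ->
  affinely_bounded g /\ forall t, 0 < t -> g^^ t <= c * f^^ t.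
Proof.
move=> c0 bf gf; split.
  by have [a [b ab]] := bf; exists (c * a), (c * b);
    exact: affine_majorant_comp ab.
move=> t t0; apply/ler_addgt0Pr => e e0.
have [a [b [ab /ltW abe]]] :=
  concave_majorant_approx bf t0 (divr_gt0 e0 (ltr_wpDl c0 ltr01)).
apply: (le_trans (concave_majorant_le t0 (affine_majorant_comp c0 gf ab))).
have -> : c * a + c * b * t = c * (a + b * t) by ring.
apply: (le_trans (ler_wpM2l c0 abe)); rewrite mulrDr lerD2l.
rewrite mulrA ler_pdivrMr ?ltr_wpDl//; nra.
Qed.

Lemma concave_majorant_mono f g : affinely_bounded f ->
  {hae s, `|g s| <= `|f s|} ->
  affinely_bounded g /\ forall t, 0 < t -> g^^ t <= f^^ t.
Proof.
move=> bf gf; have [|bg le] := concave_majorant_comp ler01 bf (g := g).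
  by apply: (hae1 gf) => s _; rewrite mul1r.
by split => // t t0; rewrite -[leRHS]mul1r; exact: le.
Qed.

Lemma concave_majorantD f g h : affinely_bounded f -> affinely_bounded g ->
  {hae s, `|h s| <= `|f s| + `|g s|} ->
  affinely_bounded h /\ forall t, 0 < t -> h^^ t <= f^^ t + g^^ t.
Proof.
move=> bf bg hfg.
have key a b a' b' : affine_majorant f a b -> affine_majorant g a' b' ->
    affine_majorant h (a + a') (b + b').
  move=> [a0 b0 fab] [a'0 b'0 gab]; split; rewrite ?addr_ge0//.
  apply: (hae3 hfg fab gab) => s _ hs fs gs; apply: (le_trans hs).
  by apply: le_trans (lerD fs gs) _; rewrite mulrDl addrACA.
split.
  have [[a [b ab]] [a' [b' ab']]] := (bf, bg).
  by exists (a + a'), (b + b'); exact: key.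
move=> t t0; apply/ler_addgt0Pr => e e0.
have e20 : 0 < e / 2 by rewrite divr_gt0.
have [a [b [ab abe]]] := concave_majorant_approx bf t0 e20.
have [a' [b' [ab' abe']]] := concave_majorant_approx bg t0 e20.
apply: (le_trans (concave_majorant_le t0 (key _ _ _ _ ab ab'))); lra.
Qed.

Lemma concave_majorant_sum (n : nat) (s : 'I_n -> L) h :
  (forall i, affinely_bounded (s i)) -> {hae t, `|h t| <= \sum_i `|s i t|} ->
  forall t, 0 < t -> h^^ t <= \sum_i (s i)^^ t.
Proof.
elim: n s h => [|n IH] s h bs hs t t0.
  rewrite big_ord0; have m0 : affine_majorant h 0 0.
    by split => //; apply: (hae1 hs) => u _; rewrite big_ord0 mul0r addr0.
  by have := concave_majorant_le t0 m0; rewrite mul0r addr0.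
have [g gE] : exists g : L, {hae u, g u = \sum_(i < n) `|s (widen_ord (leqnSn
  n) i) u|}.
  apply: L0_exists; apply: measurable_sum => i.
  by apply: measurableT_comp => //; exact: L0_measurable.
have bg : affinely_bounded g.
  have : forall i : 'I_n, exists p, affine_majorant (s (widen_ord (leqnSn n)
    i)) p.1 p.2.
    by move=> i; have [a [b ab]] := bs (widen_ord (leqnSn n) i); exists (a, b).
  move=> /choice[p pP]; exists (\sum_i (p i).1), (\sum_i (p i).2); split.
  - by apply: sumr_ge0 => i _; have [] := pP i.
  - by apply: sumr_ge0 => i _; have [] := pP i.
  - have H : {hae u, forall i, `|s (widen_ord (leqnSn n) i) u| <= (p i).1 + (p
    i).2 * u}.
      by apply: filter_forall => i; have [_ _] := pP i.
    apply: (hae2 gE H) => u _ -> Hu; rewrite ger0_norm ?sumr_ge0//.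
    by rewrite mulr_suml -big_split/=; apply: ler_sum => i _; exact: Hu.
have [|_ hle] := concave_majorantD bg (bs ord_max) (h := h).
  apply: (hae2 hs gE) => u _ + ->; rewrite big_ord_recr/= => hu.
  by rewrite [`|\sum_(i < n) _|]ger0_norm ?sumr_ge0.
apply: (le_trans (hle t t0)); rewrite big_ord_recr/= lerD2r.
apply: IH => //; apply: (hae1 gE) => u _ ->.
by rewrite ger0_norm ?sumr_ge0.
Qed.

(** A small value at t = 1 bounds both coefficients of some affine majorant. *)
Lemma concave_majorant_eq0 f : affinely_bounded f -> f^^ 1 = 0 -> f = 0.
Proof.
move=> bf f0; apply: L0_eq0.
have small e : 0 < e -> {hae s, `|f s| <= e * (1 + s)}.
  move=> e0; have [a [b [[a0 b0 ab] abe]]] :=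
    concave_majorant_approx bf ltr01 e0.
  apply: (hae1 ab) => s s0 fs; rewrite f0 add0r mulr1 in abe.
  by apply: (le_trans fs); rewrite mulrDr mulr1; nra.
have H : {hae s, forall n : nat, `|f s| <= n.+1%:R^-1 * (1 + s)}.
  by apply: hae_forall => n; apply: small; rewrite invr_gt0.
apply: (hae1 H) => s s0 Hs.
apply/eqP; rewrite -normr_le0; apply/ler_addgt0Pl => e e0; rewrite addr0.
have s1 : 0 < 1 + s by rewrite addr_gt0.
apply: (le_trans (Hs (Num.truncn ((1 + s) / e)))).
have /ltW := truncnS_gt ((1 + s) / e).
rewrite ler_pdivrMr// => le; rewrite ler_pdivrMl//.
Qed.

End affine_majorants.

(** * Quantitative K-monotonicity *)

Section K_monotone_bounded.
Context {R : realType} {W : vectorLatticeType R}.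
Context {X0 X1 X : qnspace W}.
Context (id0 : qn_ideal X0) (id1 : qn_ideal X1) (idX : qn_ideal X).
Context (comp0 : qn_complete X0) (comp1 : qn_complete X1) (compX :
  qn_complete X).
Context {C : R} (C0 : qn_const X0 C) (C1 : qn_const X1 C) (CX : qn_const X C).
Local Notation K := (Kfun X0 X1).
Local Notation Sg := (Sigma X0 X1).
Context (K1_eq0 : forall x, Sg x -> K 1 x = 0 -> x = 0).
Context (XS : forall x, X x -> Sg x).
Context (XK : exists D, forall x, X x -> K 1 x <= D * qnorm X x).
Context (Xmono : forall x y, X x -> Sg y ->
  (forall t : R, 0 < t -> K t y <= K t x) -> X y).

(** A gliding hump. If no constant worked there would be u_n, v_n >= 0 with
    K(., v_n) <= K(., u_n), the u_n tiny and the v_n of norm at least n. Then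
    U = sum of the (2 C)^(n+1) u_n exists in X, v = sum of the v_n exists in
    X0 + X1, and K(t, v) <= C K(t, U): the weights pay for the quasi-triangle
    inequality of K(t, .). Hence v is in X, though v >= v_n for all n. *)
Lemma K_monotone_bounded : exists2 M, 0 < M & forall x y, X x -> Sg y ->
  (forall t : R, 0 < t -> K t y <= K t x) -> X y /\ qnorm X y <= M * qnorm X x.
Proof.
have C_ge1 : 1 <= C by case: C0.
have C_gt0 : 0 < C := lt_le_trans ltr01 C_ge1.
apply: contrapT => nM; set q := (2 * C)^-1.
have q0 : 0 < q by rewrite invr_gt0 mulr_gt0.
have hump n : exists xy : W * W, [/\ X xy.1, Sg xy.2, 0 <= xy.1 /\ 0 <= xy.2,
    (forall t : R, 0 < t -> K t xy.2 <= K t xy.1)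
    & qnorm X xy.1 <= q ^+ n * q ^+ n /\ n%:R <= qnorm X xy.2].
  apply: contrapT => nxy; apply: nM.
  exists (n.+1%:R * (q ^+ n * q ^+ n)^-1).
    by rewrite mulr_gt0// invr_gt0 mulr_gt0// exprn_gt0.
  move=> x y Xx Sy yx; have Xy := Xmono Xx Sy yx; split => //.
  rewrite leNgt; apply/negP => lt; apply: nxy.
  have x_gt0 : 0 < qnorm X x.
    rewrite lt0r qn_ge0// andbT; apply/eqP => /(qn_eq0 idX Xx) x0.
    have y0 : y = 0.
      apply: K1_eq0 => //; apply/eqP; rewrite eq_le K_ge0// andbT.
      by apply: (le_trans (yx 1 ltr01)); rewrite x0 K_zero.
    by move: lt; rewrite x0 y0 (qn0 idX) mulr0 ltxx.
  pose l := q ^+ n * q ^+ n / qnorm X x.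
  have l0 : 0 < l by rewrite divr_gt0// mulr_gt0// exprn_gt0.
  have Sax : Sg (vabs x) by exact/XS/ideal_abs.
  have Say : Sg (vabs y) by exact/XS/ideal_abs.
  exists (l *: vabs x, l *: vabs y); split => /=.
  - exact/idealZ/ideal_abs.
  - exact: sigmaZ.
  - by rewrite !vl_scale_ge0 ?vabs_ge0// ltW.
  - move=> t t0; rewrite !(KZ id0 id1)// !(K_abs id0 id1)//; last exact: XS.
    by rewrite ler_wpM2l// yx.
  - rewrite !(qnZ idX)//; [|exact: ideal_abs..].
    rewrite !(qn_abs idX)// gtr0_norm// /l divfK ?gt_eqF//; split => //.
    have a0 : 0 < q ^+ n * q ^+ n by rewrite mulr_gt0// exprn_gt0.
    rewrite mulrAC ler_pdivlMr// (le_trans _ (_ : n.+1%:R * qnorm X x <= _))//.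
      by rewrite ler_pM2r// ler_nat.
    by rewrite -ler_pdivrMl// mulrA [_^-1 * _]mulrC ltW.
have [f fP] := choice hump; pose u n := (f n).1; pose v n := (f n).2.
have Xu n : X (u n) by have [] := fP n.
have Sv n : Sg (v n) by have [] := fP n.
have u0 n : 0 <= u n by have [_ _ []] := fP n.
have v0 n : 0 <= v n by have [_ _ []] := fP n.
have vu n (t : R) : 0 < t -> K t (v n) <= K t (u n) by have [_ _ _ H _] :=
  fP n; exact: H.
have un n : qnorm X (u n) <= q ^+ n * q ^+ n by have [_ _ _ _ []] := fP n.
have vn n : n%:R <= qnorm X (v n) by have [_ _ _ _ []] := fP n.
have qC n : (2 * C) ^+ n * q ^+ n = 1.
  by rewrite -exprMn /q divff ?expr1n// gt_eqF// mulr_gt0.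
have C2_gt0 : 0 < 2 * C by rewrite mulr_gt0.
have [U [XU _ Ule _]] : exists U, [/\ X U, qnorm X U <= 3 * C ^+ 2 * (2 * C),
    (forall n, \sum_(0 <= k < n) ((2 * C) ^+ k.+1 *: u k) <= U)
    & forall e : R, 0 < e -> exists N, forall n, (N <= n)%N ->
        qnorm X (U - \sum_(0 <= k < n) ((2 * C) ^+ k.+1 *: u k)) < e].
  apply: (qn_series idX CX compX (y := fun k => (2 * C) ^+ k.+1 *: u k)) => //.
  - by move=> n; exact: idealZ.
  - by move=> n; rewrite vl_scale_ge0// exprn_ge0// ltW.
  - move=> n; rewrite (qnZ idX)// ger0_norm ?exprn_ge0 ?(ltW C2_gt0)//.
    rewrite [leLHS](_ : _ = 2 * C * ((2 * C) ^+ n * qnorm X (u n))); last first.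
      by rewrite exprS mulrA.
    rewrite ler_pM2l//; apply: (le_trans (ler_wpM2l (exprn_ge0 _ (ltW C2_gt0))
      (un n))).
    by rewrite mulrA qC mul1r.
have uU n : (2 * C) ^+ n.+1 *: u n <= U.
  apply: le_trans (Ule n.+1); rewrite big_nat_recr//= addrC; apply: vlerDl.
  by apply: vsum_ge0 => k _; rewrite vl_scale_ge0// exprn_ge0// ltW.
have [D DP] := XK; pose D' := Num.max D 0 + 1.
have D'0 : 0 < D' by rewrite ltr_wpDl// le_max lexx orbT.
have /choice[ab abP] n : exists ab : W * W, [/\ X0 ab.1, X1 ab.2,
    0 <= ab.1 /\ 0 <= ab.2, v n = ab.1 + ab.2
    & qnorm X0 ab.1 <= D' * q ^+ n /\ qnorm X1 ab.2 <= D' * q ^+ n].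
  have qn0 : 0 < q ^+ n by rewrite exprn_gt0.
  have [a [b [X0a X1b ab0 vE abn]]] := K_split id0 id1 ltr01 (v0 n) (Sv n) qn0.
  exists (a, b); split => //=; rewrite mul1r in abn.
  have an := qn_ge0 id0 X0a; have bn := qn_ge0 id1 X1b.
  suff : K 1 (v n) <= Num.max D 0 * q ^+ n by rewrite /D' mulrDl mul1r; lra.
  apply: (le_trans (vu n 1 ltr01)); apply: (le_trans (DP _ (Xu n))).
  have Dmax : D <= Num.max D 0 by rewrite le_max lexx.
  apply: (le_trans (ler_wpM2r (qn_ge0 idX (Xu n)) Dmax)).
  rewrite ler_wpM2l ?le_max ?lexx ?orbT//; apply: (le_trans (un n)).
  rewrite ler_piMl ?(ltW qn0)// exprn_ile1 ?(ltW q0)// invf_le1//; lra.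
have [A [X0A _ Ale Alim]] : exists A, [/\ X0 A, qnorm X0 A <= 3 * C ^+ 2 * D',
    (forall n, \sum_(0 <= k < n) (ab k).1 <= A)
    & forall e : R, 0 < e -> exists N, forall n, (N <= n)%N ->
        qnorm X0 (A - \sum_(0 <= k < n) (ab k).1) < e].
  apply: (qn_series id0 C0 comp0 (y := fun k => (ab k).1)) => //.
  - by move=> n; have [] := abP n.
  - by move=> n; have [_ _ []] := abP n.
  - by move=> n; have [_ _ _ _ []] := abP n.
have [B [X1B _ Ble Blim]] : exists B, [/\ X1 B, qnorm X1 B <= 3 * C ^+ 2 * D',
    (forall n, \sum_(0 <= k < n) (ab k).2 <= B)
    & forall e : R, 0 < e -> exists N, forall n, (N <= n)%N ->
        qnorm X1 (B - \sum_(0 <= k < n) (ab k).2) < e].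
  apply: (qn_series id1 C1 comp1 (y := fun k => (ab k).2)) => //.
  - by move=> n; have [] := abP n.
  - by move=> n; have [_ _ []] := abP n.
  - by move=> n; have [_ _ _ _ []] := abP n.
have SAB : Sg (A + B) by exact: sigmaD.
have vAB n : v n <= A + B.
  have [_ _ [a0 b0] -> _] := abP n; apply: vleD.
    apply: le_trans (Ale n.+1); rewrite big_nat_recr//= addrC; apply: vlerDl.
    by apply: vsum_ge0 => k _; have [_ _ []] := abP k.
  apply: le_trans (Ble n.+1); rewrite big_nat_recr//= addrC; apply: vlerDl.
  by apply: vsum_ge0 => k _; have [_ _ []] := abP k.
have SU : Sg U by exact: XS.
have sumK n (t : R) : 0 < t -> K t (\sum_(0 <= k < n) v k) <= K t U.
  move=> t0; have idK := Kspace_ideal id0 id1 K1_eq0 t0.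
  have CK := Kspace_const id0 id1 C0 C1 t0.
  have := qn_geometric_sum idK CK Sv (h := K t U / (2 * C)) _ _ n 0%N.
  rewrite add0n expr0 mulr1 [2 * C * _]mulrC divfK ?gt_eqF//; apply.
    by rewrite divr_ge0 ?K_ge0// ltW.
  move=> k /=; apply: (le_trans (vu k t t0)).
  have -> : u k = q ^+ k.+1 *: ((2 * C) ^+ k.+1 *: u k).
    by rewrite scalerA mulrC qC scale1r.
  rewrite (KZ id0 id1)//; last exact/sigmaZ/XS.
  have qk0 : 0 <= q ^+ k.+1 by rewrite exprn_ge0// ltW.
  rewrite (ger0_norm qk0) [leRHS](_ : _ = q ^+ k.+1 * K t U).
    rewrite ler_wpM2l// (K_pos_le id0 id1)//.
    by rewrite vl_scale_ge0// exprn_ge0// ltW.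
  by rewrite exprS -/q [RHS]mulrC mulrA.
(* The remainder of the series is small in K(t, .) for each t separately. *)
have ABU (t : R) : 0 < t -> K t (A + B) <= C * K t U.
  move=> t0; apply/ler_addgt0Pr => e e0; pose d := e / (C * (1 + t)).
  have t1 : 0 < 1 + t by rewrite addr_gt0.
  have d0 : 0 < d by rewrite divr_gt0// mulr_gt0.
  have [[N NP] [M MP]] := (Alim d d0, Blim d d0); pose J := maxn N M.
  have -> : A + B = \sum_(0 <= k < J) v k +
      ((A - \sum_(0 <= k < J) (ab k).1) + (B - \sum_(0 <= k < J) (ab k).2)).
    have -> : \sum_(0 <= k < J) v k =
        \sum_(0 <= k < J) (ab k).1 + \sum_(0 <= k < J) (ab k).2.
      by rewrite -big_split; apply: eq_bigr => k _; have [] := abP k.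
    by rewrite addrACA ![_ + (_ - _)]addrC !subrK.
  have X0AJ : X0 (A - \sum_(0 <= k < J) (ab k).1).
    by apply: idealB => //; apply: ideal_sum => // k _; have [] := abP k.
  have X1BJ : X1 (B - \sum_(0 <= k < J) (ab k).2).
    by apply: idealB => //; apply: ideal_sum => // k _; have [] := abP k.
  apply: (le_trans (K_add id0 id1 C0 C1 t0 _ (sigmaD X0AJ X1BJ))).
    by apply: (sigma_sum id0 id1) => k _.
  rewrite mulrDr; apply: lerD; first by rewrite ler_pM2l// sumK.
  rewrite -ler_pdivlMl//; apply: (le_trans (K_le id0 id1 t0 X0AJ X1BJ)).
  have nA := NP J (leq_maxl _ _); have nB := MP J (leq_maxr _ _).
  have -> : C^-1 * e = d * (1 + t).
    by rewrite /d; field; rewrite !gt_eqF.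
  rewrite mulrDr mulr1 [d * t]mulrC; apply: lerD; first exact: ltW.
  by rewrite ler_pM2l// ltW.
have XAB : X (A + B).
  apply: (Xmono (idealZ idX C XU) SAB) => t t0.
  by rewrite (KZ id0 id1)// gtr0_norm// ABU.
pose n := (Num.truncn (qnorm X (A + B))).+1.
have := truncnS_gt (qnorm X (A + B)); rewrite ltNge => /negP; apply.
by apply: (le_trans (vn n)); exact: qn_le.
Qed.

End K_monotone_bounded.

(** * The parameter space *)

Section parameter_lattice.
Context {R : realType} {W : vectorLatticeType R}.
Context {X0 X1 X : qnspace W}.
Local Notation K := (Kfun X0 X1).
Local Notation Sg := (Sigma X0 X1).
Local Notation L := (L0_half_line R).
Implicit Types (f g h : L) (M : R).
Local Notation "f ^^" := (concave_majorant f) (at level 2, format "f ^^").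

(** The bound on f^^(1) makes the quasi-norm definite even if no y other than 0 is
    dominated by f^^, and it embeds the space into the sum of the endpoint
    spaces. *)
Definition E_bound f M := [/\ affinely_bounded f, 0 <= M, f^^ 1 <= M
  & forall y, 0 <= y -> Sg y -> (forall t : R, 0 < t -> K t y <= f^^ t) ->
      X y /\ qnorm X y <= M].

Definition E_space : qnspace L :=
  QNSpace (fun f => exists M, E_bound f M) (fun f => inf [set M | E_bound f M]).

Context (id0 : qn_ideal X0) (id1 : qn_ideal X1) (idX : qn_ideal X).
Context (comp0 : qn_complete X0) (comp1 : qn_complete X1) (compX :
  qn_complete X).
Context {C : R} (C0 : qn_const X0 C) (C1 : qn_const X1 C) (CX : qn_const X C).
Context (K1_eq0 : forall x, Sg x -> K 1 x = 0 -> x = 0).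

Let C_ge1 : 1 <= C. Proof. by case: C0. Qed.
Let C_gt0 : 0 < C. Proof. exact: lt_le_trans C_ge1. Qed.

(** The infimum that defines the quasi-norm is attained, as all the conditions on
    [M] are closed. *)
Lemma E_normP f : E_space f -> E_bound f (qnorm E_space f).
Proof.
case=> M0 bM0; have ne : [set M | E_bound f M] !=set0 by exists M0.
have [bf _ _ _] := bM0; split => //.
- by apply: lb_le_inf => // M [].
- by apply: lb_le_inf => // M [].
- move=> y y0 Sy Ky; split; first by have [_ _ _ /(_ y y0 Sy Ky)[]] := bM0.
  by apply: lb_le_inf => // M [_ _ _ /(_ y y0 Sy Ky)[]].
Qed.

Lemma E_le f M : E_bound f M -> E_space f /\ qnorm E_space f <= M.
Proof.
move=> bM; split; first by exists M.
by apply: ge_inf => //; exists 0 => N [].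
Qed.

Lemma E_norm_ge0 f : E_space f -> 0 <= qnorm E_space f.
Proof. by case/E_normP. Qed.

Lemma E_bound_scaled f M c z : E_bound f M -> 0 < c -> 0 <= z -> Sg z ->
  (forall t : R, 0 < t -> K t z <= c * f^^ t) -> X z /\ qnorm X z <= c * M.
Proof.
move=> [_ _ _ fM] c0 z0 Sz Kz; have cV0 : 0 < c^-1 by rewrite invr_gt0.
have [] := fM (c^-1 *: z).
- by rewrite vl_scale_ge0// ltW.
- exact: sigmaZ.
- by move=> t t0; rewrite (KZ id0 id1)// gtr0_norm// ler_pdivrMl// Kz.
move=> Xcz; have zE : z = c *: (c^-1 *: z) by rewrite scalerA divff ?gt_eqF//
  scale1r.
move=> nz; split; first by rewrite zE; exact: idealZ.
by rewrite zE (qnZ idX)// gtr0_norm// ler_pM2l.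
Qed.

Lemma E_bound_majorant f g M c : 0 <= c -> affinely_bounded g ->
  (forall t : R, 0 < t -> g^^ t <= c * f^^ t) ->
  E_bound f M -> E_bound g (c * M).
Proof.
move=> c0 bg gle bM; have [bf M0 f1 _] := bM; split => //.
- exact: mulr_ge0.
- by apply: (le_trans (gle 1 ltr01)); rewrite ler_wpM2l.
move=> y y0 Sy Ky; have Kyc t : 0 < t -> K t y <= c * f^^ t.
  by move=> t0; apply: (le_trans (Ky t t0)); exact: gle.
move: c0; rewrite le_eqVlt => /orP[/eqP c0|c0];
  last exact: E_bound_scaled bM _ _ _ _.
have -> : y = 0.
  apply: K1_eq0 => //; apply/eqP; rewrite eq_le K_ge0// andbT.
  by apply: (le_trans (Kyc 1 ltr01)); rewrite -c0 mul0r.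
by rewrite (qn0 idX) -c0 mul0r; split => //; exact: ideal0.
Qed.

Lemma E_bound_comp f g M c : 0 <= c -> {hae s, `|g s| <= c * `|f s|} ->
  E_bound f M -> E_bound g (c * M).
Proof.
move=> c0 gf bM; have [bf _ _ _] := bM.
have [bg gle] := concave_majorant_comp c0 bf gf.
exact: (E_bound_majorant c0 bg gle bM).
Qed.

(** K-divisibility for the two functions 2 c f^^ and 2 c g^^: at each t the larger
    of them dominates c h^^(t), since h^^ <= f^^ + g^^. *)
Lemma E_split f g h : affinely_bounded f -> affinely_bounded g ->
  {hae s, `|h s| <= `|f s| + `|g s|} ->
  forall y (c : R), 0 < c -> 0 <= y -> Sg y ->
  (forall t : R, 0 < t -> K t y <= c * h^^ t) ->
  exists z1 z2, [/\ 0 <= z1 <= y, 0 <= z2 <= y, y <= z1 + z2,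
    (forall t : R, 0 < t -> K t z1 <= 88 * C ^+ 6 * c * f^^ t)
    & (forall t : R, 0 < t -> K t z2 <= 88 * C ^+ 6 * c * g^^ t)].
Proof.
move=> bf bg hfg y c c0 y0 Sy Ky.
have [bh hle] := concave_majorantD bf bg hfg.
have qcZ (d : R) (phi : R -> R) : 0 <= d -> quasiconcave phi ->
    quasiconcave (fun t => d * phi t).
  move=> d0 qc s t s0 st; have [p0 pst sl] := qc s t s0 st; split.
  - exact: mulr_ge0.
  - exact: ler_wpM2l.
  - by rewrite mulrCA [leRHS]mulrCA ler_wpM2l.
pose psi (i : bool) (t : R) := 2 * c * (if i then f^^ t else g^^ t).
have c20 : 0 <= 2 * c by rewrite mulr_ge0// ltW.
have qpsi i : quasiconcave (psi i).
  by case: i; apply: qcZ => //; exact: concave_majorant_qc.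
have [|z [zy Kz yz]] := K_divisibility id0 id1 comp0 comp1 C0 C1 K1_eq0
    (qcZ c _ (ltW c0) (concave_majorant_qc bh)) qpsi (m := 1) _ Sy y0 Ky.
  move=> t t0; have := hle t t0 => hfgt.
  have [fg|/ltW gf] := leP (g^^ t) (f^^ t).
    by rewrite (cardD1 true) inE /psi; case: leP => //; nra.
  by rewrite (cardD1 false) inE /psi; case: leP => //; nra.
exists (z true), (z false); split => //.
- by move: yz; rewrite scale1r (bigD1 true)//= (bigD1 false)//= big_pred0
  ?addr0// => -[].
- move=> t t0; apply: (le_trans (Kz true t t0)); rewrite le_eqVlt /psi.
  by apply/orP; left; apply/eqP; ring.
- move=> t t0; apply: (le_trans (Kz false t t0)); rewrite le_eqVlt /psi.
  by apply/orP; left; apply/eqP; ring.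
Qed.

Let C7_ge1 : 1 <= C ^+ 7. Proof. by rewrite exprn_ege1. Qed.

Lemma E_bound_add f g h M M' : E_bound f M -> E_bound g M' ->
  {hae s, `|h s| <= `|f s| + `|g s|} -> E_bound h (88 * C ^+ 7 * (M + M')).
Proof.
move=> bM bM' hfg; have [[bf M0 fM _] [bg M'0 gM _]] := (bM, bM').
have [bh hle] := concave_majorantD bf bg hfg; split => //.
- by rewrite mulr_ge0 ?addr_ge0// mulr_ge0// exprn_ge0// ltW.
- apply: (le_trans (hle 1 ltr01)); apply: (le_trans (lerD fM gM)).
  rewrite ler_peMl ?addr_ge0//; have := C7_ge1; lra.
move=> y y0 Sy Ky.
have [|z1 [z2 [/andP[z10 z1y] /andP[z20 z2y] yz Kz1 Kz2]]] :=
    E_split bf bg hfg ltr01 y0 Sy (c := 1).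
  by move=> t t0; rewrite mul1r; exact: Ky.
have c0 : 0 < 88 * C ^+ 6 * 1 by rewrite mulr1 mulr_gt0// exprn_gt0.
have [Xz1 nz1] := E_bound_scaled bM c0 z10 (sigma_pos_le id0 id1 z10 z1y Sy)
  Kz1.
have [Xz2 nz2] := E_bound_scaled bM' c0 z20 (sigma_pos_le id0 id1 z20 z2y Sy)
  Kz2.
have Xz := idealD idX Xz1 Xz2.
split; first exact: ideal_le yz Xz.
apply: (le_trans (qn_le idX y0 yz Xz)); apply: (le_trans (qnD CX Xz1 Xz2)).
apply: (le_trans (ler_wpM2l (ltW C_gt0) (lerD nz1 nz2))).
by rewrite le_eqVlt; apply/orP; left; apply/eqP; ring.
Qed.

Lemma E_solid f g : {hae s, `|g s| <= `|f s|} -> E_space f ->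
  E_space g /\ qnorm E_space g <= qnorm E_space f.
Proof.
move=> gf /E_normP bf; apply: E_le; rewrite -[qnorm _ _]mul1r.
by apply: E_bound_comp bf => //; apply: (hae1 gf) => s _; rewrite mul1r.
Qed.

Lemma E_bound0 : E_bound 0 0.
Proof.
have m0 : affine_majorant (0 : L) 0 0.
  by split => //; apply: (hae1 hae_0) => s _ ->; rewrite normr0 mul0r addr0.
have le0 t : 0 < t -> (0 : L)^^ t <= 0.
  by move=> t0; have := concave_majorant_le t0 m0; rewrite mul0r addr0.
split => //; [by exists 0, 0|exact: le0|].
move=> y y0 Sy Ky; have -> : y = 0.
  apply: K1_eq0 => //; apply/eqP; rewrite eq_le K_ge0// andbT.
  exact: le_trans (Ky 1 ltr01) (le0 1 ltr01).
by rewrite (qn0 idX); split => //; exact: ideal0.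
Qed.

Lemma E_add f g h : E_space f -> E_space g ->
  {hae s, `|h s| <= `|f s| + `|g s|} ->
  E_space h /\ qnorm E_space h <= 88 * C ^+ 7 * (qnorm E_space f + qnorm
    E_space g).
Proof.
by move=> /E_normP bf /E_normP bg hfg; apply: E_le; exact: E_bound_add hfg.
Qed.

Lemma E_scale (a : R) f : E_space f ->
  E_space (a *: f) /\ qnorm E_space (a *: f) = `|a| * qnorm E_space f.
Proof.
move=> Ef; have sc b g : E_space g ->
    E_space (b *: g) /\ qnorm E_space (b *: g) <= `|b| * qnorm E_space g.
  move=> /E_normP bg; apply: E_le; apply: E_bound_comp bg => //.
  by apply: (hae1 (hae_scale b g)) => s _ ->; rewrite normrM.
have [Eaf le] := sc a f Ef; split => //; apply/eqP; rewrite eq_le le/=.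
have [->|a0] := eqVneq a 0.
  by rewrite normr0 mul0r scale0r E_norm_ge0//; exists 0; exact: E_bound0.
rewrite -ler_pdivlMl ?normr_gt0// -normfV.
by have [_] := sc a^-1 _ Eaf; rewrite scalerA mulVf// scale1r.
Qed.

Lemma E_solid_lattice f g : E_space g -> vabs f <= vabs g ->
  E_space f /\ qnorm E_space f <= qnorm E_space g.
Proof. by move=> Eg /L0_vabs_le; move/E_solid; exact. Qed.

Lemma E_const : qn_const E_space (88 * C ^+ 7).
Proof.
split; first by have := C7_ge1; lra.
move=> f g Ef Eg; have [|] // := @E_add f g (f + g) Ef Eg.
by apply: (hae1 (hae_add f g)) => s _ ->; exact: ler_normD.
Qed.

Lemma E_ideal : qn_ideal E_space.
Proof.
split.
- split; first by exists 0; exact: E_bound0.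
    move=> a f g Ef Eg; have [Eaf _] := E_scale a Ef.
    have [|] // := @E_add (a *: f) g (a *: f + g) Eaf Eg.
    by apply: (hae1 (hae_add (a *: f) g)) => s _ ->; exact: ler_normD.
  move=> f g Ef Eg; have [|] // := @E_add f g (vjoin f g) Ef Eg.
  apply: (hae1 (hae_join f g)) => s _ ->.
  by rewrite /Order.max; case: ifP => _; rewrite ?lerDl ?lerDr.
- split; first exact: E_norm_ge0.
  + move=> f /E_normP[bf _ f1 _] n0; apply: concave_majorant_eq0 => //.
    by apply/eqP; rewrite eq_le concave_majorant_ge0// andbT -n0.
  + by move=> a f /(E_scale a)[].
  + by exists (88 * C ^+ 7); case: E_const.
- by move=> f g _ Eg fg; have [] := E_solid_lattice Eg fg.
- move=> f g Ef _ /andP[g0 gf]; have [] // := @E_solid_lattice g f Ef.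
  by rewrite !vabs_id// (le_trans g0).
Qed.

End parameter_lattice.

(** * Completeness of the parameter space *)

Section parameter_complete.
Context {R : realType} {W : vectorLatticeType R}.
Context {X0 X1 X : qnspace W}.
Local Notation K := (Kfun X0 X1).
Local Notation Sg := (Sigma X0 X1).
Local Notation L := (L0_half_line R).
Implicit Types (f g h : L) (M : R).
Local Notation "f ^^" := (concave_majorant f) (at level 2, format "f ^^").
Local Notation E := (E_space (X0 := X0) (X1 := X1) (X := X)).
Local Notation E_bound := (E_bound (X0 := X0) (X1 := X1) (X := X)).

Context (id0 : qn_ideal X0) (id1 : qn_ideal X1) (idX : qn_ideal X).
Context (comp0 : qn_complete X0) (comp1 : qn_complete X1) (compX :
  qn_complete X).
Context {C : R} (C0 : qn_const X0 C) (C1 : qn_const X1 C) (CX : qn_const X C).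
Context (K1_eq0 : forall x, Sg x -> K 1 x = 0 -> x = 0).

Let C_ge1 : 1 <= C. Proof. by case: C0. Qed.
Let C_gt0 : 0 < C. Proof. exact: lt_le_trans C_ge1. Qed.
(* The constant lost in one application of E_split. *)
Let c : R := 88 * C ^+ 6.
Let c_ge1 : 1 <= c.
Proof. by have : 1 <= C ^+ 6 by [rewrite exprn_ege1]; rewrite /c; lra. Qed.
Let c_gt0 : 0 < c. Proof. exact: lt_le_trans c_ge1. Qed.
(* Dividing by c compensates for the iterated splitting, dividing by 2 C makes
   the resulting series summable in X. *)
Let p : R := (2 * C * c)^-1.
Let p_gt0 : 0 < p. Proof. by rewrite invr_gt0 !mulr_gt0. Qed.

Let pc n : c ^+ n * p ^+ n = (2 * C)^-1 ^+ n.
Proof.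
rewrite -exprMn; congr (_ ^+ _).
by rewrite /p [in LHS]invfM mulrCA divff ?mulr1// gt_eqF.
Qed.

(** Here r k is the tail of the series of the g j, j >= k. An element y dominated
    by the majorant of r 0 is split again and again: y <= w_0 + ... + w_(n-1) +
    z_n, with w_k dominated by c^(k+1) times the majorant of g k and z_n by c^n
    times that of r n. The w_k are summable in X and K(1, z_n) tends to 0,
    whence y <= sum w_k. *)
Lemma E_bound_series (g r : nat -> L) (a b : R) : 0 < a -> 0 <= b ->
  (forall k, E_bound (g k) (a * p ^+ k)) ->
  (forall k, affinely_bounded (r k)) -> (forall k, (r k)^^ 1 <= b * p ^+ k) ->
  (forall k, {hae s, `|r k s| <= `|g k s| + `|r k.+1 s|}) ->
  E_bound (r 0%N) (Num.max b (3 * C ^+ 2 * (c * a))).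
Proof.
move=> a0 b0 bg br r1 rg; split => //.
- by rewrite le_max b0.
- by have := r1 0%N; rewrite expr0 mulr1 le_max => ->.
move=> y y0 Sy Ky.
pose inv n z := [/\ 0 <= z, Sg z & forall t :
  R, 0 < t -> K t z <= c ^+ n * (r n)^^ t].
have /choice[F FP] : forall nz : nat * W, exists zz : W * W, inv nz.1 nz.2 ->
    [/\ inv nz.1.+1 zz.2, 0 <= zz.1, Sg zz.1, nz.2 <= zz.1 + zz.2 &
      forall t : R, 0 < t -> K t zz.1 <= c ^+ nz.1.+1 * (g nz.1)^^ t].
  move=> [n z] /=; have [[z0 Sz Kz]|ninv] := pselect (inv n z);
    last by exists (0, 0).
  have bgn : affinely_bounded (g n) by have [] := bg n.
  have [z1 [z2 [/andP[z10 z1z] /andP[z20 z2z] zz Kz1 Kz2]]] :=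
    E_split id0 id1 comp0 comp1 C0 C1 K1_eq0 bgn (br n.+1) (rg n)
      (exprn_gt0 n c_gt0) z0 Sz Kz.
  exists (z1, z2) => _; split => //=.
  - split => //; first exact: (sigma_pos_le id0 id1 z20 z2z).
    by move=> t t0; rewrite exprS; exact: Kz2.
  - exact: (sigma_pos_le id0 id1 z10 z1z).
  - by move=> t t0; rewrite exprS; exact: Kz1.
pose z := nat_rect (fun=> W) y (fun n zn => (F (n, zn)).2).
have zP n : inv n (z n).
  elim: n => [|n IH] /=; last by have [] := FP (n, z n) IH.
  by split => // t t0; rewrite expr0 mul1r; exact: Ky.
pose w n := (F (n, z n)).1.
have wP n : [/\ 0 <= w n, X (w n) & qnorm X (w n) <= c * a * (2 * C)^-1 ^+ n].
  have /= [_ w0 Sw _ Kw] := FP (n, z n) (zP n).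
  have [Xw nw] := E_bound_scaled id0 id1 idX (bg n) (exprn_gt0 n.+1 c_gt0) w0
    Sw Kw.
  split => //; apply: (le_trans nw); rewrite le_eqVlt; apply/orP; left;
    apply/eqP.
  by rewrite exprS -pc; ring.
have [Y [XY nY wY _]] : exists Y, [/\ X Y, qnorm X Y <= 3 * C ^+ 2 * (c * a),
    (forall n, \sum_(0 <= k < n) w k <= Y)
    & forall e : R, 0 < e -> exists N, forall n, (N <= n)%N ->
        qnorm X (Y - \sum_(0 <= k < n) w k) < e].
  apply: (qn_series idX CX compX) => //; first by move=> n; have [] := wP n.
  - by move=> n; have [] := wP n.
  - exact: mulr_gt0.
  - by move=> n; have [] := wP n.
have yw n : y <= \sum_(0 <= k < n) w k + z n.
  elim: n => [|n IH]; first by rewrite big_geq//= add0r.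
  rewrite big_nat_recr//= -addrA; apply: (le_trans IH); apply: vleD => //.
  by have [_ _ _ + _] := FP (n, z n) (zP n).
have yY : y <= Y.
  rewrite -vsubr_ge0 -vlerN opprB oppr0.
  apply: (le0_of_small (Kspace_ideal id0 id1 K1_eq0 ltr01)) => e e0.
  have q1 : 0 <= (2 * C)^-1 < 1.
    rewrite invr_ge0 mulr_ge0 ?(ltW C_gt0)// invf_lt1 ?mulr_gt0//; have :=
      C_ge1; lra.
  have [N /(_ N (leqnn N)) NP] := geometric_small b0 q1 e0.
  have [zN0 SzN KzN] := zP N; exists (z N); split => //=.
    apply: le_lt_trans NP; apply: (le_trans (KzN 1 ltr01)).
    apply: (le_trans (ler_wpM2l (exprn_ge0 _ (ltW c_gt0)) (r1 N))).
    rewrite le_eqVlt; apply/orP; left; apply/eqP.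
    by rewrite -pc; ring.
  rewrite vabs_id// vlerBlDr addrC; apply: le_trans (yw N) _.
  by apply: vl_leD2r.
split; first exact: ideal_le yY XY.
apply: (le_trans (qn_le idX y0 yY XY)); apply: (le_trans nY).
by rewrite le_max lexx orbT.
Qed.

Let p_half : p <= 2^-1.
Proof.
have cC : 1 <= C * c by rewrite mulr_ege1.
by rewrite lef_pV2 ?posrE ?mulr_gt0// -mulrA; lra.
Qed.

(** Bracketing by v k -+ 2 A p^k, which are monotone, yields the limit together
    with its rate. *)
Lemma geometric_limit (v : nat -> R) (A : R) : 0 <= A ->
  (forall k, `|v k.+1 - v k| <= A * p ^+ k) ->
  exists l, forall k, `|l - v k| <= 2 * A * p ^+ k.
Proof.
move=> A0 vA; pose lo k := v k - 2 * A * p ^+ k; pose hi k :=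
  v k + 2 * A * p ^+ k.
have pk k : 0 <= A * p ^+ k by rewrite mulr_ge0// exprn_ge0// ltW.
have pS k : 2 * A * p ^+ k.+1 <= A * p ^+ k.
  by rewrite exprS; have := ler_wpM2r (pk k) p_half; lra.
have lo_nd : {homo lo : m n / (m <= n)%N >-> m <= n}.
  apply: homo_leq => //; first exact: le_trans.
  move=> k; rewrite /lo; have := vA k; rewrite ler_norml => /andP[+ _].
  have := pS k; lra.
have hi_ni : {homo hi : m n / (m <= n)%N >-> n <= m}.
  apply: homo_leq => //; first by move=> y x z yx zy; exact: le_trans zy yx.
  move=> k; rewrite /hi; have := vA k; rewrite ler_norml => /andP[_ +].
  have := pS k; lra.
have lohi m n : lo m <= hi n.
  apply: (le_trans (lo_nd _ _ (leq_maxl m n))).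
  apply: le_trans (hi_ni _ _ (leq_maxr m n)); rewrite /lo /hi.
  have := pk (maxn m n); lra.
exists (sup (range lo)) => k; rewrite ler_norml; apply/andP; split.
  rewrite lerBrDl; apply: ub_le_sup; last by exists k.
  by exists (hi 0%N) => _ [m _ <-].
rewrite lerBlDl; apply: ge_sup; first by exists (lo 0%N), 0%N.
by move=> _ [m _ <-]; exact: lohi.
Qed.

Lemma E_complete : qn_complete E.
Proof.
move=> u Eu cauchy.
have idE := E_ideal id0 id1 idX comp0 comp1 C0 C1 CX K1_eq0.
have CE := E_const id0 id1 idX comp0 comp1 C0 C1 CX K1_eq0.
have /choice[N NP] k : exists N : nat, forall m n :
  nat, (N <= m)%N -> (N <= n)%N ->
    qnorm E (u m - u n) < p ^+ k by apply: cauchy; rewrite exprn_gt0.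
pose n k := \max_(j < k.+1) N j.
have nN k : (N k <= n k)%N by rewrite /n;
  exact: (leq_bigmax (ord_max : 'I_k.+1)).
have n_nd k : (n k <= n k.+1)%N.
  rewrite /n [leqRHS]big_ord_recr/=; exact: leq_maxl.
pose g k : L := u (n k.+1) - u (n k).
have Eg k : E (g k) by exact: idealB.
have ng k : qnorm E (g k) <= p ^+ k.
  by apply/ltW/NP; [exact: leq_trans (nN k) (n_nd k)|exact: nN].
have bgk k : E_bound (g k) (p ^+ k).
  have [bf M0 f1 fM] := E_normP (Eg k); split => //.
  - by rewrite exprn_ge0// ltW.
  - exact: le_trans f1 (ng k).
  - by move=> y y0 Sy Ky; have [? le] := fM y y0 Sy Ky; split => //;
    exact: le_trans le (ng k).
have gae k : {hae s, `|g k s| <= 2 * p ^+ k * (1 + s)}.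
  have pk : 0 < p ^+ k by rewrite exprn_gt0.
  have [bf _ f1 _] := bgk k.
  have [a [b [[a0 b0 ab] abe]]] := concave_majorant_approx bf ltr01 pk.
  apply: (hae1 ab) => s s0 le; apply: (le_trans le).
  by rewrite mulr1 in abe; rewrite mulrDr mulr1; apply: lerD;
    [lra|rewrite ler_pM2r//; lra].
(* The increments are truncated at their almost everywhere bounds, so that the
   limit exists at every point and is measurable. *)
pose clamp (A x : R) := Num.max (Num.min x A) (- A).
have clamp_le A x : 0 <= A -> `|clamp A x| <= A.
  move=> A0; rewrite ler_norml /clamp le_max lexx orbT/= ge_max ge_min lexx
    orbT/=.
  by lra.
have clamp_id A x : `|x| <= A -> clamp A x = x.
  rewrite ler_norml => /andP[Ax xA]; rewrite /clamp (min_idPl xA).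
  exact/max_idPl.
pose v k (s : R) : R := (u (n 0%N) : L) s +
  \sum_(0 <= j < k) clamp (2 * p ^+ j * (1 + `|s|)) (g j s).
have s1 (s : R) : 0 <= 1 + `|s| by rewrite addr_ge0.
have vS k s : `|v k.+1 s - v k s| <= 2 * (1 + `|s|) * p ^+ k.
  rewrite /v big_nat_recr//= opprD addrACA subrr add0r addrAC subrr add0r
    mulrAC.
  by apply: clamp_le; rewrite !mulr_ge0// exprn_ge0// ltW.
have /choice[l lP] s := geometric_limit (mulr_ge0 (ler0n _ 2) (s1 s)) (vS ^~ s).
have ml : measurable_fun [set: measurableTypeR R] l.
  apply: (@measurable_fun_cvg _ _ _ _ v) => [k|s _].
    apply: measurable_funD; first exact: L0_measurable.
    apply: measurable_sum => j; apply: measurable_maxr.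
      apply: measurable_minr; first exact: L0_measurable.
      by apply: measurable_funM => //; apply: measurable_funD.
    apply: measurableT_comp => //; apply: measurable_funM => //.
    exact: measurable_funD.
  apply/cvgrPdist_lt => e e0.
  have p1 : 0 <= p < 1 by rewrite ltW//=; have := p_half; lra.
  have A0 : 0 <= 2 * (2 * (1 + `|s|)) by rewrite !mulr_ge0.
  have [M MP] := geometric_small A0 p1 e0.
  by exists M => // k /= Mk; exact: le_lt_trans (lP s k) (MP k Mk).
have [f fE] := L0_exists ml.
pose r k : L := f - u (n k).
have vu : {hae s, forall k, v k s = (u (n k) : L) s}.
  have H1 : {hae s, forall k, g k s = (u (n k.+1) : L) s - (u (n k) : L) s}.
    by apply: hae_forall => k; exact: hae_sub.
  have H2 := hae_forall gae.
  apply: (hae2 H1 H2) => s s0 gE gle; elim=> [|k IH].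
    by rewrite /v big_geq// addr0.
  rewrite /v big_nat_recr//= addrA -/(v k s) IH clamp_id.
    by rewrite gE addrC subrK.
  by rewrite (gtr0_norm s0).
have rmaj k : affine_majorant (r k) (4 * p ^+ k) (4 * p ^+ k).
  have pk : 0 <= 4 * p ^+ k by rewrite mulr_ge0// exprn_ge0// ltW.
  split => //; apply: (hae3 fE vu (hae_sub f (u (n k)))) => s s0 Ef vk ->.
  rewrite Ef -vk; apply: (le_trans (lP s k)); rewrite (gtr0_norm s0); lra.
have br k : affinely_bounded (r k) by exists (4 * p ^+ k), (4 * p ^+ k).
have r1 k : (r k)^^ 1 <= 8 * p ^+ k.
  by apply: (le_trans (concave_majorant_le ltr01 (rmaj k))); lra.
have rg k : {hae s, `|r k s| <= `|g k s| + `|r k.+1 s|}.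
  have -> : r k = g k + r k.+1.
    by rewrite /r /g [RHS]addrC addrA subrK.
  by apply: (hae1 (hae_add (g k) (r k.+1))) => s _ ->; exact: ler_normD.
pose M0 := Num.max 8 (3 * C ^+ 2 * c).
have rM k : E (r k) /\ qnorm E (r k) <= M0 * p ^+ k.
  apply: E_le; have := @E_bound_series (fun j => g (k + j)%N) (fun j =>
    r (k + j)%N)
    (p ^+ k) (8 * p ^+ k) (exprn_gt0 _ p_gt0).
  rewrite addn0 maxr_pMl ?exprn_ge0 ?(ltW p_gt0)// -!mulrA; apply => //.
  - by rewrite mulr_ge0// exprn_ge0// ltW.
  - by move=> j; rewrite -exprD.
  - by move=> j; rewrite -mulrA -exprD.
  - by move=> j; rewrite addnS; exact: rg.
have Ef : E f.
  have -> : f = r 0%N + u (n 0%N) by rewrite subrK.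
  by apply: (idealD idE) => //; have [] := rM 0%N.
exists f => //; apply/cvgrPdist_lt => e e0.
have M0_ge0 : 0 <= M0 by rewrite le_max ler0n.
have BE0 : 0 < 88 * C ^+ 7 by rewrite mulr_gt0// exprn_gt0.
have p1 : 0 <= p < 1 by rewrite ltW//=; have := p_half; lra.
have A0 : 0 <= 88 * C ^+ 7 * (1 + M0) by rewrite mulr_ge0 ?(ltW BE0)// addr_ge0.
have [k0 /(_ k0 (leqnn _)) kP] := geometric_small A0 p1 e0.
exists (n k0) => // m /= km; rewrite sub0r normrN ger0_norm; last first.
  by apply: (qn_ge0 idE); exact: idealB.
apply: le_lt_trans kP.
have -> : u m - f = (u m - u (n k0)) + (- r k0).
  by rewrite /r opprB addrA subrK.
have [Er nr] := rM k0.
apply: (le_trans (qnD CE (idealB idE (Eu m) (Eu _)) (idealN idE Er))).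
rewrite (qnN idE)// -[leRHS]mulrA ler_pM2l// mulrDl mul1r lerD//.
by apply/ltW/NP; rewrite ?nN// (leq_trans (nN k0)).
Qed.

End parameter_complete.

(** * L-convexity of the parameter space *)

Section parameter_L_convex.
Context {R : realType} {W : vectorLatticeType R}.
Context {X0 X1 X : qnspace W}.
Local Notation K := (Kfun X0 X1).
Local Notation Sg := (Sigma X0 X1).
Local Notation L := (L0_half_line R).
Local Notation "f ^^" := (concave_majorant f) (at level 2, format "f ^^").
Local Notation E := (E_space (X0 := X0) (X1 := X1) (X := X)).
Local Notation E_bound := (E_bound (X0 := X0) (X1 := X1) (X := X)).

Context (id0 : qn_ideal X0) (id1 : qn_ideal X1) (idX : qn_ideal X).
Context (comp0 : qn_complete X0) (comp1 : qn_complete X1).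
Context {C : R} (C0 : qn_const X0 C) (C1 : qn_const X1 C).
Context (K1_eq0 : forall x, Sg x -> K 1 x = 0 -> x = 0).

Lemma hae_sum (n : nat) (s : 'I_n -> L) :
  {hae t, (\sum_i s i : L) t = \sum_i s i t}.
Proof.
elim: n s => [|n IH] s.
  by rewrite big_ord0; apply: (hae1 hae_0) => t _ ->; rewrite big_ord0.
rewrite big_ord_recr/=.
have := hae_add (\sum_(i < n) s (widen_ord (leqnSn n) i)) (s ord_max).
move=> /hae2 /(_ (IH (fun i => s (widen_ord (leqnSn n) i)))); apply=> t _ -> ->.
by rewrite big_ord_recr.
Qed.

(** Markov's inequality for the uniform probability on n + 1 points. *)
Lemma card_half_max (n : nat) (eps M : R) (a : 'I_n.+1 -> R) :
  0 <= eps -> 0 <= M ->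
  (forall i, a i <= M) -> (1 - eps) * n.+1%:R * M <= \sum_i a i ->
  (n.+1 - Num.truncn (2 * eps * n.+1%:R) <= #|[pred i | (M <= 2 * a i)%R]|)%N.
Proof.
move=> eps0 M0 aM Ma; set good := [pred i | (M <= 2 * a i)%R].
have [M_gt0|] := ltP 0 M; last first.
  move=> M_le0; apply: leq_trans (leq_subr _ _) _.
  have M00 : M = 0 by apply/eqP; rewrite eq_le M_le0.
  have sum0 : \sum_i (M - a i) <= 0.
    rewrite sumrB sumr_const card_ord subr_le0; apply: le_trans Ma.
    by rewrite M00 mulr0 mul0rn.
  have ai i : a i = M.
    have pos : forall j, 0 <= M - a j by move=> j; rewrite subr_ge0.
    apply/eqP; rewrite eq_le aM/= -subr_le0; apply: le_trans sum0.
    by rewrite (bigD1 i)//= lerDl sumr_ge0.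
  rewrite -[leqLHS]card_ord; apply: subset_leq_card;
    apply/fintype.subsetP => i _.
  by rewrite inE ai M00 mulr0.
have bad : #|[predC good]|%:R * M <= 2 * eps * n.+1%:R * M.
  have : \sum_i a i <= \sum_i (M - (if i \in [predC good] then M / 2 else 0)).
    apply: ler_sum => i _; case: ifPn => [|_]; last by rewrite subr0 aM.
    rewrite !inE -ltNge => lt; lra.
  rewrite sumrB sumr_const card_ord -big_mkcond/= sumr_const => /(le_trans Ma).
  rewrite -[M *+ _]mulr_natl -[(M / 2) *+ _]mulr_natl.
  by move: #|_|%:R n.+1%:R => k N {Ma} le; lra.
rewrite ler_pM2r// in bad.
have badN : (#|[predC good]| <= Num.truncn (2 * eps * n.+1%:R))%N.
  by rewrite Num.Theory.truncn_ge_nat// mulr_ge0// mulr_ge0.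
have cardE : (#|good| + #|predC good| = n.+1)%N by rewrite cardC card_ord.
by rewrite leq_subLR -[leqLHS]cardE addnC leq_add2r.
Qed.

(** The constant 88 C^6 is the one of K-divisibility applied with the functions
    2 (s i)^^. If all the s i had norm less than eps, the parts z i of an element
    y dominated by f^^ would be so small that, by the L-convexity of X, their
    average could dominate (1 - 2 eps) y only if y had norm at most 1/2; then f
    itself would have norm at most 1/2. *)
Lemma E_L_convex : L_convex X -> L_convex E.
Proof.
move=> [ex /andP[ex0 ex1] LX].
have C_ge1 : 1 <= C by case: C0.
have C6 : 1 <= C ^+ 6 by rewrite exprn_ege1.
pose c := 88 * C ^+ 6; have c88 : 88 <= c by rewrite /c; lra.
have c0 : 0 < c by lra.
pose eps := Num.min 4^-1 (ex / (2 * c)).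
have eps0 : 0 < eps by rewrite lt_min invr_gt0 ltr0n divr_gt0// mulr_gt0.
have eps4 : eps <= 4^-1 by rewrite ge_min lexx.
have epsc : eps * (2 * c) <= ex.
  have c20 : 0 < 2 * c by rewrite mulr_gt0.
  by rewrite -(ler_pdivlMr _ _ c20) ge_min lexx orbT.
have d0 : 0 < 1 - eps by lra.
have e2 : 0 < 1 - 2 * eps by lra.
have eps_half : 2 * eps <= 2^-1 by lra.
have ex_eps : 1 - ex <= 1 - 2 * eps by nra.
have half1 : 2^-1 < 1 :> R by lra.
exists eps; first by rewrite eps0/=; lra.
move=> n f s Ef f0 nf sP avg; apply: contrapT => nex.
have ns i : qnorm E (s i) < eps.
  by rewrite ltNge; apply/negP => le; apply: nex; exists i.
have bs i := E_normP (proj1 (sP i)); have bf := E_normP Ef.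
have bsi i : affinely_bounded (s i) by have [] := bs i.
have bff : affinely_bounded f by have [] := bf.
have n1 : 0 < n.+1%:R :> R by [].
have sf i : {hae t, `|(s i : L) t| <= `|(f : L) t|}.
  have [_ /andP[s0 sf]] := sP i; apply/L0_vabs_le.
  by rewrite !vabs_id// (le_trans s0).
have sf_maj i t : 0 < t -> (s i)^^ t <= f^^ t.
  by move=> t0; have [_] := concave_majorant_mono bff (sf i); exact.
have avg_maj t : 0 < t -> (1 - eps) * n.+1%:R * f^^ t <= \sum_i (s i)^^ t.
  move=> t0; pose h : L := ((1 - eps) * n.+1%:R) *: f.
  have hs : {hae t, `|h t| <= \sum_i `|(s i : L) t|}.
    have le : h <= \sum_i s i.
      have := vscale_le (ltW n1) avg; rewrite !scalerA mulfV ?gt_eqF// scale1r.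
      by rewrite mulrC.
    have h0 : 0 <= h by rewrite vl_scale_ge0// mulr_ge0// ltW.
    have {}le := (hae_le h (\sum_i s i)).1 le.
    have {}h0 := (hae_le 0 h).1 h0.
    have h0' : {hae t, 0 <= h t} by apply: (hae2 h0 hae_0) => u _ hu E0;
      exact: (eq_ind _ (fun x => x <= h u) hu _ E0).
    apply: (hae3 h0' le (hae_sum s)) => u _ hu0 hu E1.
    rewrite (ger0_norm hu0); apply: (le_trans hu);
      apply: (eq_ind_r (fun x => x <= _) _ E1).
    by apply: ler_sum => i _; exact: ler_norm.
  have sum := concave_majorant_sum bsi hs t0.
  have k0 : 0 < (1 - eps) * n.+1%:R by rewrite mulr_gt0.
  have hE := hae_scale ((1 - eps) * n.+1%:R) f.
  have [bh _] : affinely_bounded h /\ forall u, 0 < u ->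
      h^^ u <= (1 - eps) * n.+1%:R * f^^ u.
    apply: concave_majorant_comp (ltW k0) bff _; apply: (hae1 hE) => u _ E1.
    by rewrite /h E1 normrM (gtr0_norm k0).
  have [_ fh] : affinely_bounded f /\ forall u, 0 < u ->
      f^^ u <= ((1 - eps) * n.+1%:R)^-1 * h^^ u.
    apply: (concave_majorant_comp _ bh); first by rewrite invr_ge0 ltW.
    apply: (hae1 hE) => u _ E1.
    by rewrite /h E1 normrM (gtr0_norm k0) mulrA mulVf ?mul1r// gt_eqF.
  by apply: le_trans sum; rewrite -ler_pdivlMl// fh.
clear avg f0.
have f1 : f^^ 1 <= 2 * eps.
  have := avg_maj 1 ltr01.
  have : \sum_i (s i)^^ 1 <= n.+1%:R * eps.
    rewrite -[n.+1 in leRHS]card_ord mulr_natl -sumr_const;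
      apply: ler_sum => i _.
    by have [_ _ le _] := bs i; exact: le_trans le (ltW (ns i)).
  move=> H1 H2; have := le_trans H2 H1;
    rewrite [_ * n.+1%:R]mulrC -mulrA ler_pM2l//.
  have := concave_majorant_ge0 bff ltr01; nra.
suff : E_bound f 2^-1.
  by move=> /E_le[_]; rewrite nf => /le_lt_trans/(_ half1); rewrite ltxx.
split => //; first exact: le_trans f1 eps_half.
move=> y y0 Sy Ky.
pose m := (n.+1 - Num.truncn (2 * eps * n.+1%:R))%N.
have qcZ phi : quasiconcave phi -> quasiconcave (fun t : R => 2 * phi t).
  move=> qc t u t0 tu; have [p0 ptu sl] := qc t u t0 tu; split;
    rewrite ?mulr_ge0 ?ler_pM2l//.
  by rewrite mulrCA [leRHS]mulrCA ler_pM2l.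
have [|z [zy Kz mz]] := K_divisibility id0 id1 comp0 comp1 C0 C1 K1_eq0
    (concave_majorant_qc bff) (fun i =>
      qcZ _ (concave_majorant_qc (bsi i))) (m := m)
    _ Sy y0 Ky.
  move=> t t0; apply: (card_half_max (a := fun i => (s i)^^ t)).
  - exact: ltW.
  - exact: concave_majorant_ge0.
  - by move=> i; exact: sf_maj.
  - exact: avg_maj.
have z0 i : 0 <= z i by have /andP[] := zy i.
have zle i : z i <= y by have /andP[] := zy i.
have Xz i : X (z i) /\ qnorm X (z i) <= c * eps.
  have [] := E_bound_scaled id0 id1 idX (bs i) c0 (z0 i)
    (sigma_pos_le id0 id1 (z0 i) (zle i) Sy).
    move=> t t0; apply: (le_trans (Kz i t t0)); rewrite le_eqVlt.
    by apply/orP; left; apply/eqP; rewrite /c; ring.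
  by move=> Xzi le; split => //; apply: (le_trans le); rewrite ler_pM2l// ltW.
have avgz : (1 - 2 * eps) *: y <= n.+1%:R^-1 *: \sum_i z i.
  have mr : (1 - 2 * eps) * n.+1%:R <= m%:R.
    rewrite /m; set k := Num.truncn _.
    have kle : k%:R <= 2 * eps * n.+1%:R.
      by rewrite Num.Theory.truncn_le// !mulr_ge0// ltW.
    have : n.+1%:R <= (n.+1 - k)%N%:R + k%:R :> R by rewrite -natrD ler_nat
      addnC -leq_subLR.
    by move: kle; move: (k%:R) (n.+1%:R) ((_ - k)%N%:R) => kr nr mr; lra.
  have le := le_trans (vscale_lel y0 mr) mz.
  have nV0 : 0 <= n.+1%:R^-1 :> R by rewrite invr_ge0.
  by have := vscale_le nV0 le; rewrite scalerA mulrCA mulVf ?gt_eqF// mulr1.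
have Xy : X y.
  have Xey : X ((1 - 2 * eps) *: y).
    apply: (ideal_le idX _ avgz); first by rewrite vl_scale_ge0// ltW.
    by apply: idealZ => //; apply: ideal_sum => // i _; case: (Xz i).
  rewrite -[y]scale1r -(mulVf (_ : 1 - 2 * eps != 0)) ?gt_eqF// -scalerA.
  exact: idealZ.
split => //.
have [y_gt0|y_le0] := ltP 0 (qnorm X y); last by apply: (le_trans y_le0);
  rewrite invr_ge0.
have yV0 : 0 < (qnorm X y)^-1 by rewrite invr_gt0.
have Xy' := idealZ idX (qnorm X y)^-1 Xy.
have y'0 : 0 <= (qnorm X y)^-1 *: y by rewrite vl_scale_ge0// ltW.
have ny' : qnorm X ((qnorm X y)^-1 *: y) = 1.
  by rewrite (qnZ idX)// gtr0_norm// mulVf// gt_eqF.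
have z'P i : X ((qnorm X y)^-1 *: z i) /\
    0 <= (qnorm X y)^-1 *: z i <= (qnorm X y)^-1 *: y.
  have [Xzi _] := Xz i; split; first exact: idealZ.
  by rewrite vl_scale_ge0 ?(ltW yV0)//= vscale_le// ltW.
have avgz' : (1 - ex) *: ((qnorm X y)^-1 *: y) <=
    n.+1%:R^-1 *: \sum_i ((qnorm X y)^-1 *: z i).
  rewrite -scaler_sumr !scalerA mulrC [n.+1%:R^-1 * _]mulrC -!scalerA.
  apply: vscale_le; first exact: ltW.
  by apply: le_trans avgz; apply: vscale_lel.
have [i] := LX n _ _ Xy' y'0 ny' z'P avgz'.
rewrite (qnZ idX)//; last by case: (Xz i).
rewrite (gtr0_norm yV0) ler_pdivlMl// => le.
have [_ nz] := Xz i; have {nz}le := le_trans le nz.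
rewrite -(ler_pM2l ex0) [ex * _]mulrC; apply: (le_trans le).
by rewrite mulrC; lra.
Qed.

End parameter_L_convex.

(** * Interpolation and the representation of X *)

Section endpoint_splitting.
Context {R : realType}.
Local Notation L := (L0_half_line R).

Lemma affine_majorant_split (f : L) (a b : R) : affine_majorant f a b ->
  exists g h : L, [/\ f = g + h, {hae t, `|g t| <= a} & {hae t, `|h t| <= b *
    t}].
Proof.
move=> [a0 b0 fab].
have mclamp : measurable_fun [set: measurableTypeR R]
    (fun t => Num.max (Num.min (f t) a) (- a)).
  by apply: measurable_maxr => //; apply: measurable_minr => //;
    exact: L0_measurable.
have [g gE] := L0_exists mclamp; exists g, (f - g); split.
- by rewrite addrC subrK.
- apply: (hae1 gE) => t _ ->; rewrite ler_norml le_max lexx orbT/= ge_max.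
  by rewrite ge_min lexx orbT/=; lra.
- apply: (hae3 gE fab (hae_sub f g)) => t t0 Eg + ->; rewrite Eg.
  have bt : 0 <= b * t by rewrite mulr_ge0// ltW.
  rewrite !ler_norml => /andP[lo hi].
  have [fa|fa] := leP (f t) a; have [fa'|fa'] := leP (- a) _ => //.
  all: lra.
Qed.

End endpoint_splitting.

Section representation.
Context {R : realType} {W : vectorLatticeType R}.
Context {X0 X1 X : qnspace W}.
Local Notation K := (Kfun X0 X1).
Local Notation Sg := (Sigma X0 X1).
Local Notation L := (L0_half_line R).
Local Notation "f ^^" := (concave_majorant f) (at level 2, format "f ^^").
Local Notation E := (E_space (X0 := X0) (X1 := X1) (X := X)).
Local Notation E_bound := (E_bound (X0 := X0) (X1 := X1) (X := X)).
Local Notation KL x := (L0_of (half_line_measure R) (Kfun X0 X1 ^~ x) : L).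

Context (id0 : qn_ideal X0) (id1 : qn_ideal X1) (idX : qn_ideal X).
Context (comp0 : qn_complete X0) (comp1 : qn_complete X1) (compX :
  qn_complete X).
Context {C : R} (C0 : qn_const X0 C) (C1 : qn_const X1 C) (CX : qn_const X C).
Context (K1_eq0 : forall x, Sg x -> K 1 x = 0 -> x = 0).
Context (XS : forall x, X x -> Sg x).
Context (XK : exists D, forall x, X x -> K 1 x <= D * qnorm X x).
Context (Xmono : forall x y, X x -> Sg y ->
  (forall t : R, 0 < t -> K t y <= K t x) -> X y).
Context (DX : forall x, X0 x -> X1 x -> X x).

Lemma hae_KL x : Sg x -> {hae t, (KL x) t = K t x}.
Proof. by have [[_ N0 _ _] [_ N1 _ _]] := (id0, id1); exact: K_spaceE. Qed.

Lemma KL_majorant x : Sg x ->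
  affinely_bounded (KL x) /\ forall t, 0 < t -> (KL x)^^ t <= K t x.
Proof.
move=> Sx; have maj x0 x1 : X0 x0 -> X1 x1 -> x = x0 + x1 ->
    affine_majorant (KL x) (qnorm X0 x0) (qnorm X1 x1).
  move=> X0x X1x xE; split; [exact: qn_ge0|exact: qn_ge0|].
  apply: (hae1 (hae_KL Sx)) => t t0 ->; rewrite ger0_norm ?K_ge0//.
  by rewrite mulrC {1}xE; exact: K_le.
split.
  have [x0 [x1 [X0x X1x xE _]]] := K_approx id0 id1 ltr01 Sx ltr01.
  by exists (qnorm X0 x0), (qnorm X1 x1); exact: maj.
move=> t t0; apply/ler_addgt0Pr => e e0.
have [x0 [x1 [X0x X1x xE /ltW le]]] := K_approx id0 id1 t0 Sx e0.
apply: le_trans (concave_majorant_le t0 (maj _ _ X0x X1x xE)) _.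
by rewrite mulrC.
Qed.

(** An affine majorant of K(., x) is one only almost everywhere; moving t by a
    factor of at most 2 costs the constant. *)
Lemma K_le_KL_majorant x t : Sg x -> 0 < t -> K t x <= 2 * (KL x)^^ t.
Proof.
move=> Sx t0; have [bK _] := KL_majorant Sx.
rewrite -ler_pdivrMl//; apply: le_concave_majorant => // a b [a0 b0 ab].
have H : {hae s, K s x <= a + b * s}.
  by apply: (hae2 ab (hae_KL Sx)) => s _ + E1;
    rewrite E1 => /(le_trans (ler_norm _)).
have [s [/andP[ts s2t] Ks]] := half_line_meets t0 H.
rewrite ler_pdivrMl//; apply: (le_trans (K_nondecreasing id0 id1 t0 ts Sx)).
by apply: (le_trans Ks); nra.
Qed.

Lemma K_space_equiv : qn_equiv X (K_space X0 X1 E).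
Proof.
have [M M0 MP] := K_monotone_bounded id0 id1 idX comp0 comp1 compX C0 C1 CX
  K1_eq0 XS XK Xmono.
have [D DP] := XK; pose B := Num.max D M.
have B0 : 0 < B by rewrite lt_max M0 orbT.
have direct x : X x -> E (KL x) /\ qnorm E (KL x) <= B * qnorm X x.
  move=> Xx; have Sx := XS Xx; have [bK KLle] := KL_majorant Sx.
  have nx := qn_ge0 idX Xx.
  apply: E_le; split => //.
  - by rewrite mulr_ge0// ltW.
  - apply: (le_trans (KLle 1 ltr01)); apply: (le_trans (DP x Xx)).
    by rewrite ler_wpM2r// le_max lexx.
  - move=> y y0 Sy Ky; have [|Xy le] := MP x y Xx Sy.
      by move=> t t0; apply: (le_trans (Ky t t0)); exact: KLle.
    by split => //; apply: (le_trans le); rewrite ler_wpM2r// le_max lexx orbT.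
have converse x : Sg x -> E (KL x) -> X x /\ qnorm X x <= 2 * qnorm E (KL x).
  move=> Sx /E_normP bK.
  have Sax : Sg (vabs x) by apply: (sigma_solid id0 id1 Sx); rewrite vabs_vabs.
  have [|Xax nax] := E_bound_scaled id0 id1 idX bK (ltr0n _ 2) (vabs_ge0 x) Sax.
    by move=> t t0; rewrite (K_abs id0 id1)//; exact: K_le_KL_majorant.
  have Xx : X x by apply: (ideal_solid idX Xax); rewrite vabs_vabs.
  by split => //; rewrite -(qn_abs idX Xx).
split.
  move=> x; split => [Xx|[Sx EK]]; first by split; [exact: XS|have [] :=
    direct x Xx].
  by have [] := converse x Sx EK.
exists B^-1, 2; split; rewrite ?invr_gt0// => x Xx.
have [EK le] := direct x Xx; have [_ le'] := converse x (XS Xx) EK.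
by rewrite ler_pdivrMl// le.
Qed.

Lemma E_function_lattice : qb_function_lattice E.
Proof.
have [lin qn mono int] := E_ideal id0 id1 idX comp0 comp1 C0 C1 CX K1_eq0.
split.
  by split => //; exact: (E_complete id0 id1 idX comp0 comp1 compX C0 C1 CX
    K1_eq0).
by move=> f g Eg fg; have [] := E_solid_lattice id0 id1 idX K1_eq0 Eg fg.
Qed.

(** Elements y with K(t, y) <= M min(1, t), as they arise from functions in the
    intersection of the endpoint spaces. If X has an element x <> 0 then
    K(t, x) >= K(1, x) min(1, t) and K-monotonicity applies. If X = 0 then the
    intersection of X0 and X1 is 0, decompositions are unique, so K(t, y) is
    affine in t and the bound forces y = 0. *)
Lemma small_K_bound : exists2 D, 1 <= D & forall y M, 0 <= M -> 0 <= y -> Sg y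
  ->
  (forall t : R, 0 < t -> K t y <= M /\ K t y <= M * t) ->
  X y /\ qnorm X y <= D * M.
Proof.
have [[x [Xx x_neq0]]|X_eq0] := pselect (exists x, X x /\ x != 0).
  have [M M0 MP] := K_monotone_bounded id0 id1 idX comp0 comp1 compX C0 C1 CX
    K1_eq0 XS XK Xmono.
  have Sx := XS Xx; have k0 : 0 < K 1 x.
    rewrite lt0r K_ge0// andbT; apply: contra_neq x_neq0; exact: K1_eq0.
  exists (Num.max 1 (M * qnorm X x / K 1 x)); first by rewrite le_max lexx.
  move=> y N N0 y0 Sy Ky.
  have dom t : 0 < t -> K t y <= K t (N / K 1 x *: x).
    move=> t0; have [KN KNt] := Ky t t0.
    have c0 : 0 <= N / K 1 x by rewrite divr_ge0// ltW.
    rewrite (KZ id0 id1)// ger0_norm// mulrAC ler_pdivlMr//.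
    have [t1|/ltW t1] := leP t 1.
      by have := K_slope id0 id1 t0 t1 Sx; rewrite mul1r; nra.
    by have := K_nondecreasing id0 id1 ltr01 t1 Sx; nra.
  have [Xy le] := MP _ _ (idealZ idX (N / K 1 x) Xx) Sy dom.
  split => //; apply: (le_trans le);
    rewrite (qnZ idX)// ger0_norm ?divr_ge0 ?(ltW k0)//.
  have -> : M * (N / K 1 x * qnorm X x) = M * qnorm X x / K 1 x * N.
    by field; rewrite gt_eqF.
  by rewrite ler_wpM2r// le_max lexx orbT.
have X0E x : X x -> x = 0.
  by move=> Xx; apply/eqP; apply: contra_notT X_eq0 => x0; exists x.
exists 1 => // y M M0 y0 Sy Ky; have [a [b [X0a X1b [a0 b0] yE _]]] :=
  K_split id0 id1 ltr01 y0 Sy ltr01.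
have uniq t : 0 < t -> qnorm X0 a + t * qnorm X1 b <= K t y.
  move=> t0; apply/ler_addgt0Pr => e e0.
  have [a' [b' [X0a' X1b' _ yE' /ltW le]]] := K_split id0 id1 t0 y0 Sy e0.
  have dE : a - a' = b' - b.
    apply/eqP; rewrite subr_eq addrC addrA -subr_eq opprK -yE' yE.
    by [].
  have d0 : a - a' = 0.
    apply: X0E; apply: DX; first exact: idealB.
    by rewrite dE; exact: idealB.
  have aE : a = a' by apply/eqP; rewrite -subr_eq0 d0.
  have bE : b = b' by apply/eqP; rewrite eq_sym -subr_eq0 -dE d0.
  by rewrite aE bE.
have na := qn_ge0 id0 X0a; have nb := qn_ge0 id1 X1b.
have a_eq0 : a = 0.
  apply: (qn_eq0 id0 X0a); apply/eqP; rewrite eq_le na andbT.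
  apply/ler_addgt0Pl => e e0; rewrite addr0.
  have M1 : 0 < M + 1 by rewrite ltr_wpDl.
  have t0 : 0 < e / (M + 1) by rewrite divr_gt0.
  have [_ le] := Ky _ t0; have := le_trans (uniq _ t0) le.
  have : M * (e / (M + 1)) <= e by rewrite mulrA ler_pdivrMr//; nra.
  have := mulr_ge0 (ltW t0) nb; lra.
have b_eq0 : b = 0.
  apply: (qn_eq0 id1 X1b); apply/eqP; rewrite eq_le nb andbT.
  apply/ler_addgt0Pl => e e0; rewrite addr0.
  have M1 : 0 < M + 1 by rewrite ltr_wpDl.
  have t0 : 0 < (M + 1) / e by rewrite divr_gt0.
  have [le _] := Ky _ t0; have := le_trans (uniq _ t0) le.
  rewrite mulrAC => H; have : (M + 1) * qnorm X1 b <= M * e.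
    by rewrite -ler_pdivrMr//; lra.
  nra.
by rewrite yE a_eq0 b_eq0 addr0 (qn0 idX) mul1r; split => //; exact: ideal0.
Qed.

Lemma E_intermediate : intermediate (Linfty R) (Linfty_weighted R) E.
Proof.
have [qbE _] := E_function_lattice; split => //.
- have [D D1 DP] := small_K_bound.
  have key f : Linfty R f -> Linfty_weighted R f -> E f /\ qnorm E f <=
      D * Num.max (qnorm (Linfty R) f) (qnorm (Linfty_weighted R) f).
    move=> /Linfty_ae[A0 fA] /Linfty_weighted_ae[B0 fB].
    set M := Num.max _ _.
    have MA : qnorm (Linfty R) f <= M by rewrite le_max lexx.
    have MB : qnorm (Linfty_weighted R) f <= M by rewrite le_max lexx orbT.
    have M0 : 0 <= M := le_trans A0 MA.
    have majA : affine_majorant f M 0.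
      by split => //; apply: (hae1 fA) => t _ le;
        rewrite mul0r addr0 (le_trans le).
    have majB : affine_majorant f 0 M.
      split => //; apply: (hae1 fB) => t t0 le; rewrite add0r (le_trans le)//.
      by rewrite ler_pM2r.
    have fM t : 0 < t -> f^^ t <= M.
      by move=> t0; have := concave_majorant_le t0 majA; rewrite mul0r addr0.
    apply: E_le; split.
    + by exists M, 0.
    + by rewrite mulr_ge0// (le_trans ler01).
    + by apply: (le_trans (fM 1 ltr01)); rewrite ler_peMl.
    + move=> y y0 Sy Ky; apply: DP => // t t0; split.
        exact: le_trans (Ky t t0) (fM t t0).
      apply: (le_trans (Ky t t0)).
      by have := concave_majorant_le t0 majB; rewrite add0r.
  split.
  + by move=> f [f0 f1]; have [] := key f f0 f1.
  + move=> f g [/Linfty_ae[A0 fA] /Linfty_weighted_ae[B0 fB]] _ /andP[g0 gf].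
    have gf' : {hae t, `|(g : L) t| <= `|(f : L) t|}.
      by apply/L0_vabs_le; rewrite !vabs_id// (le_trans g0).
    split.
      have [] // := Linfty_le A0 (f := g).
      by apply: (hae2 fA gf') => t _ le le'; exact: le_trans le' le.
    have [] // := Linfty_weighted_le B0 (f := g).
    by apply: (hae2 fB gf') => t _ le le'; exact: le_trans le' le.
  + by exists D => f [f0 f1]; have [] := key f f0 f1.
- have key f a b : affine_majorant f a b ->
      Sigma (Linfty R) (Linfty_weighted R) f /\
      qnorm (Sigma (Linfty R) (Linfty_weighted R)) f <= a + b.
    move=> fab; have [a0 b0 _] := fab.
    have [g [h [fE ga hb]]] := affine_majorant_split fab.
    have [Lg ng] := Linfty_le a0 ga; have [Lh nh] := Linfty_weighted_le b0 hb.
    split; first by exists (g, h).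
    apply: le_trans (lerD ng nh); apply: ge_inf; last by exists (g, h).
    exists 0 => _ [[g' h'] [/= /Linfty_ae[? _] /Linfty_weighted_ae[? _] _] <-].
    exact: addr_ge0.
  split.
  + move=> f /E_normP[[a [b fab]] _ _ _]; by have [] := key f a b fab.
  + move=> f g Ef _ /andP[g0 gf].
    have [] // := @E_solid_lattice R W X0 X1 X id0 id1 idX K1_eq0 g f Ef.
    by rewrite !vabs_id// (le_trans g0).
  + exists 1 => f /E_normP[bf _ f1 _]; rewrite mul1r; apply: le_trans f1.
    apply/ler_addgt0Pr => e e0.
    have [a [b [fab /ltW le]]] := concave_majorant_approx bf ltr01 e0.
    by rewrite mulr1 in le; have [_ le'] := key f a b fab;
      exact: le_trans le' le.
Qed.

(** An operator that is bounded by c on both endpoint spaces maps functions with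
    majorant a + b t to functions with majorant c a + c b t. *)
Lemma E_interpolation : Int (Linfty R) (Linfty_weighted R) E.
Proof.
split; first exact: E_intermediate.
move=> T [_ Tlin] [c0 T0] [c1 T1]; pose c := Num.max 0 (Num.max c0 c1).
have c_ge0 : 0 <= c by rewrite le_max lexx.
have c0c : c0 <= c by rewrite !le_max lexx orbT.
have c1c : c1 <= c by rewrite !le_max lexx !orbT.
have zero0 : Linfty R 0.
  have [] // := @Linfty_le R 0 0 (lexx 0).
  by apply: (hae1 hae_0) => t _ ->; rewrite normr0.
have zero1 : Linfty_weighted R 0.
  have [] // := @Linfty_weighted_le R 0 0 (lexx 0).
  by apply: (hae1 hae_0) => t _ ->; rewrite normr0 mul0r.
have Tmaj f a b : affine_majorant f a b -> affine_majorant (T f) (c * a) (c *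
  b).
  move=> fab; have [a0 b0 _] := fab; split; [exact: mulr_ge0|exact: mulr_ge0|].
  have [g [h [fE ga hb]]] := affine_majorant_split fab.
  have [Lg ng] := Linfty_le a0 ga; have [Lh nh] := Linfty_weighted_le b0 hb.
  have [LTg nTg] := T0 g Lg; have [LTh nTh] := T1 h Lh.
  have [_ Tga] := Linfty_ae LTg; have [_ Thb] := Linfty_weighted_ae LTh.
  have [ng0 _] := Linfty_ae Lg; have [nh0 _] := Linfty_weighted_ae Lh.
  have TE : T f = T g + T h.
    rewrite fE -{1}[g]scale1r Tlin ?scale1r//.
      by exists (g, 0); split => //=; rewrite addr0.
    by exists (0, h); split => //=; rewrite add0r.
  rewrite TE; apply: (hae3 Tga Thb (hae_add (T g) (T h))) => t t0 le1 le2 E1.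
  rewrite [X in `|X|]E1; apply: (le_trans (ler_normD _ _)); apply: lerD.
    apply: (le_trans le1); apply: (le_trans nTg).
    by apply: (le_trans (ler_wpM2r ng0 c0c)); exact: ler_wpM2l.
  apply: (le_trans le2); rewrite ler_pM2r//; apply: (le_trans nTh).
  by apply: (le_trans (ler_wpM2r nh0 c1c)); exact: ler_wpM2l.
exists c => f /E_normP bf; have [bff _ _ _] := bf.
apply: E_le; apply: (E_bound_majorant id0 id1 idX K1_eq0 c_ge0 _ _ bf).
  by have [a [b fab]] := bff; exists (c * a), (c * b); exact: Tmaj.
move=> t t0; apply/ler_addgt0Pr => e e0.
have cp : 0 < c + 1 by rewrite ltr_wpDl.
have [a [b [fab /ltW le]]] := concave_majorant_approx bff t0 (divr_gt0 e0 cp).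
apply: (le_trans (concave_majorant_le t0 (Tmaj _ _ _ fab))).
have -> : c * a + c * b * t = c * (a + b * t) by ring.
apply: (le_trans (ler_wpM2l c_ge0 le)); rewrite mulrDr lerD2l.
by rewrite mulrA ler_pdivrMr//; nra.
Qed.

End representation.

(** Both parts of a nearly optimal decomposition of x at t = 1 are close to 0 in
    the ambient Hausdorff space, so x belongs to every neighbourhood of 0. *)
Lemma sigma_definite (R : realType) (W : topVectorLatticeType R)
    (X0 X1 : qnspace W) : qb_lattice_couple X0 X1 ->
  qn_ideal X0 -> qn_ideal X1 ->
  forall x, Sigma X0 X1 x -> Kfun X0 X1 1 x = 0 -> x = 0.
Proof.
move=> [haus [_ [_ cont0]] [_ [_ cont1]]] id0 id1 x Sx K0.
apply/esym/haus => A B A0 Bx; exists x; split; last exact: nbhs_singleton.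
have : nbhs ((0 : W) + 0) A by rewrite addr0.
move=> /(add_continuous (0, 0))/=[[U V] [/= U0 V0] UV].
have [d0 d00 Ud] := cont0 U U0; have [d1 d10 Vd] := cont1 V V0.
have d_gt0 : 0 < Num.min d0 d1 by rewrite lt_min d00.
have [x0 [x1 [X0x X1x xE le]]] := K_approx id0 id1 ltr01 Sx d_gt0.
rewrite K0 add0r mul1r lt_min in le; case/andP: le => le0 le1.
have n0 := qn_ge0 id0 X0x; have n1 := qn_ge0 id1 X1x.
by rewrite xE; apply: (UV (x0, x1)); split => /=; [apply: Ud => //;
  lra|apply: Vd => //; lra].
Qed.

(** * The representation theorem *)

Theorem corollary7p10 (R : realType) (W : topVectorLatticeType R)
    (X0 X1 : qnspace W) :
  qb_lattice_couple X0 X1 -> L_convex X0 -> L_convex X1 ->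
  forall X : qnspace W,
    quasi_Banach_lattice X -> L_convex X -> K_monotone X0 X1 X ->
  exists E : qnspace (L0_half_line R),
    [/\ qb_function_lattice E, L_convex E,
        Int (Linfty R) (Linfty_weighted R) E
      & qn_equiv X (K_space X0 X1 E)].
Proof.
move=> couple _ _ X [linX qnX compX monoX] LX [[_ [DX _ _] [XS intX [D XD]]]
  Kmono].
have [_ [[lin0 qn0 comp0 mono0] [int0 _]] [[lin1 qn1 comp1 mono1] [int1 _]]] :=
  couple.
have id0 : qn_ideal X0 by [].
have id1 : qn_ideal X1 by [].
have K1_eq0 := sigma_definite couple id0 id1.
have idX : qn_ideal X.
  split => // x y Xx _ y0x; apply: (intX x y) => //.
  by have /andP[y0 yx] := y0x; exact: (sigma_pos_le id0 id1 y0 yx (XS x Xx)).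
have [A CA] := qn_ideal_const id0; have [B CB] := qn_ideal_const id1.
have [G CG] := qn_ideal_const idX.
pose C := Num.max A (Num.max B G).
have C0 : qn_const X0 C by apply: qn_const_le CA => //; rewrite le_max lexx.
have C1 : qn_const X1 C by apply: qn_const_le CB => //;
  rewrite !le_max lexx orbT.
have CX : qn_const X C by apply: qn_const_le CG => //;
  rewrite !le_max lexx !orbT.
have XK : exists D, forall x, X x -> Kfun X0 X1 1 x <= D * qnorm X x.
  by exists D => x Xx; rewrite -sigma_norm; exact: XD.
have DX' x : X0 x -> X1 x -> X x by move=> X0x X1x; exact: DX.
exists (E_space (X0 := X0) (X1 := X1) (X := X)); split.
- exact: (E_function_lattice id0 id1 idX comp0 comp1 compX C0 C1 CX K1_eq0).
- exact: (E_L_convex id0 id1 idX comp0 comp1 C0 C1 K1_eq0 LX).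
- exact: (E_interpolation id0 id1 idX comp0 comp1 compX C0 C1 CX K1_eq0 XS XK
  Kmono DX').
- exact: (K_space_equiv id0 id1 idX comp0 comp1 compX C0 C1 CX K1_eq0 XS XK
  Kmono).
Qed.
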